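(* Let $T>0$ and suppose that $\chi(0)\in\ell^\infty(\mathbf{C}^r)$ and $\gamma\in L^\infty([0,T],\ell^\infty(\mathbf{C}^r))$. Then the expectations $$\chi^{(n)}_{\mathbf k}(t)=\mathsf E_{\mathbf k}[R_{n,t}],\qquad n\ge0,\ \mathbf k\in\mathbf{Z}^d,\ t\in[0,T],$$ are well defined (that is, $R_{n,t}$ is $\mathsf P_{\mathbf k}$-integrable), and the $\chi^{(n)}_{\mathbf k}(t)$ are the unique $L^\infty([0,T],\ell^\infty(\mathbf{C}^r))$ mild solution of the approximation scheme $$\dot\chi^{(0)}_{\mathbf k}=-\lambda_{\mathbf k}\chi^{(0)}_{\mathbf k},$$ $$\dot\chi^{(n)}_{\mathbf k}=\lambda_{\mathbf k}\Big[-\chi^{(n)}_{\mathbf k}+C_fp_{\mathbf k}\chi^{(n)}_{\mathbf k}+C_b\sum_{\mathbf l,\mathbf m\in\mathbf{Z}^d}q_{\mathbf k,\mathbf l,\mathbf m}B_{\mathbf k,\mathbf l,\mathbf m}(\chi^{(n)}_{\mathbf l},\chi^{(n-1)}_{\mathbf m})+d_{\mathbf k}\gamma_{\mathbf k}\Big],\qquad n\ge1,$$ with initial condition $\chi^{(n)}_{\mathbf k}(0)=\chi_{\mathbf k}(0)$ for all $\mathbf k\in\mathbf{Z}^d$ and all $n\ge0$.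
   Context: **Constants.** Fix integers $d,r\ge1$. For $\mathbf k,\mathbf l,\mathbf m\in\mathbf{Z}^d$ fix constants $\lambda_{\mathbf k}>0$ and $p_{\mathbf k},q_{\mathbf k,\mathbf l,\mathbf m},d_{\mathbf k}\in[0,1]$, constants $C_f,C_b\ge0$, and bilinear maps $B_{\mathbf k,\mathbf l,\mathbf m}:\mathbf{C}^r\times\mathbf{C}^r\to\mathbf{C}^r$ with $|B_{\mathbf k,\mathbf l,\mathbf m}(\chi,\chi')|\le|\chi|\,|\chi'|$, where $|\cdot|$ is the Euclidean norm on $\mathbf{C}^r$. Put $q_{\mathbf k}=\sum_{\mathbf l,\mathbf m}q_{\mathbf k,\mathbf l,\mathbf m}$. Standing assumptions: $p_{\mathbf k}+q_{\mathbf k}+d_{\mathbf k}=1$ for all $\mathbf k$, and $p_{\mathbf k}\to0$, $q_{\mathbf k}\to0$ as $|\mathbf k|\to\infty$. $\ell^\infty(\mathbf{C}^r)$ is the space of bounded families $(a_{\mathbf k})_{\mathbf k\in\mathbf{Z}^d}$ in $\mathbf{C}^r$ with the supremum norm. Data: initial condition $\chi(0)=(\chi_{\mathbf k}(0))$ and forcing $\gamma=(\gamma_{\mathbf k}(t))$. A mild solution of the scheme satisfies $\chi^{(0)}_{\mathbf k}(t)=e^{-\lambda_{\mathbf k}t}\chi_{\mathbf k}(0)$ and, for $n\ge1$, $$\chi^{(n)}_{\mathbf k}(t)=e^{-\lambda_{\mathbf k}t}\chi_{\mathbf k}(0)+\int_0^t\lambda_{\mathbf k}e^{-\lambda_{\mathbf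 k}(t-s)}\Big[C_fp_{\mathbf k}\chi^{(n)}_{\mathbf k}(s)+C_b\sum_{\mathbf l,\mathbf m}q_{\mathbf k,\mathbf l,\mathbf m}B_{\mathbf k,\mathbf l,\mathbf m}(\chi^{(n)}_{\mathbf l}(s),\chi^{(n-1)}_{\mathbf m}(s))+d_{\mathbf k}\gamma_{\mathbf k}(s)\Big]ds.$$ **Branching tree.** Let $\mathscr{I}=\bigcup_{n\ge0}\{0,1,2\}^n$ be the set of labels, $\emptyset$ the label of length $0$; for a label $\alpha=(\alpha_1,\dots,\alpha_n)$ write $|\alpha|=n$, $\alpha|_j=(\alpha_1,\dots,\alpha_j)$, and $(\alpha,i)$, $(i,\alpha)$ for the labels obtained by appending, prepending $i\in\{0,1,2\}$. Take independent families of independent variables: $(E_\alpha)_{\alpha\in\mathscr I}$ exponential of mean one; $(U_\alpha)_{\alpha\in\mathscr I}$ uniform on $[0,1]$; and pairs $(Y^{(1)}_\alpha(\mathbf k),Y^{(2)}_\alpha(\mathbf k))$, $\alpha\in\mathscr I$, $\mathbf k\in\mathbf{Z}^d$, with $P[Y^{(1)}_\alpha(\mathbf k)=\mathbf l,Y^{(2)}_\alpha(\mathbf k)=\mathbf m]=q_{\mathbf k,\mathbf l,\mathbf m}/q_{\mathbf k}$ if $q_{\mathbf k}>0$ (arbitrary law if $q_{\mathbf k}=0$). Fix $\mathbf k\in\mathbf{Z}^d$ and set $\hat{\mathbf K}_\emptyset=\mathbf k$, $\tau^B_\emptyset=0$, $\tau^D_\emptyset=\lambda_{\mathbf k}^{-1}E_\emptyset$,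 $I_\emptyset=1$. Inductively, for $\beta\in\mathscr I$ and $i\in\{0,1,2\}$: $\hat{\mathbf K}_{(\beta,0)}=\hat{\mathbf K}_\beta$, $\hat{\mathbf K}_{(\beta,i)}=Y^{(i)}_\beta(\hat{\mathbf K}_\beta)$ for $i=1,2$; $\tau^B_{(\beta,i)}=\tau^D_\beta$, $\tau^D_{(\beta,i)}=\tau^B_{(\beta,i)}+\lambda^{-1}_{\hat{\mathbf K}_{(\beta,i)}}E_{(\beta,i)}$; $I_{(\beta,0)}=1$ if $U_\beta\in[0,p_{\hat{\mathbf K}_\beta}]$ and $0$ otherwise; for $i=1,2$, $I_{(\beta,i)}=1$ if $U_\beta\in[1-q_{\hat{\mathbf K}_\beta},1]$ and $0$ otherwise. With an isolated cemetery state $\Delta$, set $\mathbf K_\alpha=\hat{\mathbf K}_\alpha$ if $\prod_{j=1}^{|\alpha|}I_{\alpha|_j}=1$ and $\mathbf K_\alpha=\Delta$ otherwise. The branching tree rooted at $\mathbf k$ is $\mathcal T_{\mathbf k}=(\mathbf K_\alpha,\tau^B_\alpha,\tau^D_\alpha)_{\alpha\in\mathscr I}$; $\mathsf P_{\mathbf k}$ denotes its law and $\mathsf E_{\mathbf k}$ the corresponding expectation. For a tree $\mathcal T=(\mathbf k_\alpha,s_\alpha,t_\alpha)_{\alpha\in\mathscr I}$ let $\pi_i(\mathcal T)=(\mathbf k_{(i,\alpha)},s_{(i,\alpha)}-t_\emptyset,t_{(i,\alpha)}-t_\emptyset)_{\alpha\in\mathscr I}$, $i=0,1,2$, and let $N_{[0,t]}(\mathcal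 T)$ be the number of $\alpha\in\mathscr I$ with $\mathbf k_\alpha\ne\Delta$ and $s_\alpha\le t$; $N_{[0,t]}<\infty$ holds $\mathsf P_{\mathbf k}$-a.s. for all $t\geq 0$. There is a death at $\emptyset$ if $\mathbf k_{(0)}=\mathbf k_{(1)}=\mathbf k_{(2)}=\Delta$; a flip at $\emptyset$ if $\mathbf k_{(0)}\ne\Delta$, $\mathbf k_{(1)}=\mathbf k_{(2)}=\Delta$; a branch at $\emptyset$ if $\mathbf k_{(0)}=\Delta$ and $\mathbf k_{(1)},\mathbf k_{(2)}\ne\Delta$; $\mathsf P_{\mathbf k}$-a.s. exactly one of these occurs. **Pruned evaluations.** The maps $R_{n,t}$ ($n\ge0$, $t\ge0$) from trees to $\mathbf{C}^r$ are determined on trees with $N_{[0,t]}(\mathcal T)<\infty$ as follows. $R_{0,t}(\mathcal T)=\chi_{\mathbf k_\emptyset}(0)$ if $t_\emptyset\ge t$, and $R_{0,t}(\mathcal T)=0$ otherwise. For $n\ge1$: $R_{n,t}(\mathcal T)=\chi_{\mathbf k_\emptyset}(0)$ if $t_\emptyset\ge t$; and if $t_\emptyset<t$: $R_{n,t}(\mathcal T)=\gamma_{\mathbf k_\emptyset}(t-t_\emptyset)$ for a death at $\emptyset$; $R_{n,t}(\mathcal T)=C_fR_{n,t-t_\emptyset}(\pi_0(\mathcal T))$ for a flip at $\emptyset$; $R_{n,t}(\mathcal T)=C_bB_{\mathbf k_\emptyset,\mathbf k_{(1)},\mathbf k_{(2)}}(R_{n,t-t_\emptyset}(\pi_1(\mathcal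 T)),R_{n-1,t-t_\emptyset}(\pi_2(\mathcal T)))$ for a branch at $\emptyset$. *)

(* Defs.v *)
From HB Require Import structures.
From mathcomp Require Import all_boot all_order all_algebra finmap.
From mathcomp Require Import complex.
From mathcomp Require Import all_classical all_reals all_analysis.

Set Implicit Arguments.
Unset Strict Implicit.
Unset Printing Implicit Defensive.

Import Order.TTheory GRing.Theory Num.Theory.
Import numFieldNormedType.Exports.

Local Open Scope classical_set_scope.
Local Open Scope ring_scope.
Local Open Scope complex_scope.

(* The lattice Z^d, with its discrete sigma-algebra. *)
Definition Zd (d : nat) : Type := 'rV[int]_d.
HB.instance Definition _ (d : nat) := Countable.on (Zd d).
HB.instance Definition _ (d : nat) := isPointed.Build (Zd d) (0 : 'rV[int]_d).
HB.instance Definition _ (d : nat) :=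
  @isMeasurable.Build default_measure_display (Zd d) discrete_measurable
    discrete_measurable0 discrete_measurableC discrete_measurableU.

Definition znorm (R : realType) (d : nat) (k : Zd d) : R :=
  Num.sqrt (\sum_(i < d) ((k : 'rV[int]_d) ord0 i)%:~R ^+ 2).

Definition vanishes_at_infinity (R : realType) (d : nat) (f : Zd d -> R) :=
  forall e : R, 0 < e ->
    exists M : R, forall k : Zd d, M <= znorm R k -> `|f k| <= e.

(* Vectors of C^r. *)
Notation Cvec R r := 'rV[R[i]]_r.

Definition vnorm (R : realType) (r : nat) (x : Cvec R r) : R :=
  Num.sqrt (\sum_(j < r)
    (complex.Re (x ord0 j) ^+ 2 + complex.Im (x ord0 j) ^+ 2)).

(* Measurability, integrability and integrals of C^r-valued functions are taken
   coordinatewise, on real and imaginary parts. *)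
Section vector_integral.
Context d (X : measurableType d) (R : realType) (r : nat).
Implicit Types (D : set X) (f : X -> Cvec R r).

Definition vmeasurable D f := forall j : 'I_r,
  measurable_fun D (fun x => complex.Re (f x ord0 j)) /\
  measurable_fun D (fun x => complex.Im (f x ord0 j)).

Definition vintegrable (mu : {measure set X -> \bar R}) D f :=
  forall j : 'I_r,
  mu.-integrable D (fun x => (complex.Re (f x ord0 j))%:E) /\
  mu.-integrable D (fun x => (complex.Im (f x ord0 j))%:E).

Definition vintegral (mu : {measure set X -> \bar R}) D f : Cvec R r :=
  \row_(j < r) (Rintegral mu D (fun x => complex.Re (f x ord0 j)) +i*
                Rintegral mu D (fun x => complex.Im (f x ord0 j))).

End vector_integral.

(* Absolutely convergent sums over pairs of lattice points, as integrals against
   the counting measure. *)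
Definition vsum2 (R : realType) (d r : nat) (f : Zd d -> Zd d -> Cvec R r) :
    Cvec R r :=
  vintegral (@counting (Zd d * Zd d)%type R) setT (fun lm => f lm.1 lm.2).

Definition linfty (R : realType) (d r : nat) (a : Zd d -> Cvec R r) :=
  exists M : R, forall k, vnorm (a k) <= M.

(* L^oo([0, T], l^oo(C^r)), with coordinatewise measurability. *)
Definition Linfty (R : realType) (d r : nat) (T : R)
    (f : Zd d -> R -> Cvec R r) :=
  (forall k, vmeasurable (`[0, T] : set (measurableTypeR R)) (f k)) /\
  exists M : R, {ae @lebesgue_measure R,
    forall t, t \in `[0, T] -> forall k, vnorm (f k t) <= M}.

Record params (R : realType) (d r : nat) := Params {
  lam_ : Zd d -> R;
  p_ : Zd d -> R;
  q_ : Zd d -> Zd d -> Zd d -> R;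
  d_ : Zd d -> R;
  Cf : R;
  Cb : R;
  B_ : Zd d -> Zd d -> Zd d -> {bilinear Cvec R r -> Cvec R r -> Cvec R r}
}.

Definition qsum (R : realType) (d r : nat) (S : params R d r) (k : Zd d) :
    \bar R :=
  \esum_(lm in [set: Zd d * Zd d]) (q_ S k lm.1 lm.2)%:E.

Definition qtot (R : realType) (d r : nat) (S : params R d r) (k : Zd d) : R :=
  fine (qsum S k).

Record standing (R : realType) (d r : nat) (S : params R d r) : Prop := {
  lam_gt0 : forall k, 0 < lam_ S k;
  p_itv : forall k, 0 <= p_ S k <= 1;
  q_itv : forall k l m, 0 <= q_ S k l m <= 1;
  d_itv : forall k, 0 <= d_ S k <= 1;
  Cf_ge0 : 0 <= Cf S;
  Cb_ge0 : 0 <= Cb S;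
  B_le : forall k l m x y, vnorm (B_ S k l m x y) <= vnorm x * vnorm y;
  pqd_sum : forall k, ((p_ S k)%:E + qsum S k + (d_ S k)%:E = 1)%E;
  p_vanishes : vanishes_at_infinity (p_ S);
  q_vanishes : vanishes_at_infinity (qtot S)
}.

Definition label := seq 'I_3.

Definition i0 : 'I_3 := @Ordinal 3 0 isT.
Definition i1 : 'I_3 := @Ordinal 3 1 isT.
Definition i2 : 'I_3 := @Ordinal 3 2 isT.

(* The value at (beta, i) may depend on beta, i and the value at beta. *)
Definition append_rec (A : Type) (a0 : A) (step : label -> A -> 'I_3 -> A)
    (alpha : label) : A :=
  (foldl (fun ba i => (rcons ba.1 i, step ba.1 ba.2 i)) ([::], a0) alpha).2.

Lemma append_rec_nil (A : Type) (a0 : A) step : append_rec a0 step [::] = a0.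
Proof. by []. Qed.

Lemma append_rec_rcons (A : Type) (a0 : A) step beta i :
  append_rec a0 step (rcons beta i) = step beta (append_rec a0 step beta) i.
Proof.
rewrite /append_rec foldl_rcons /=; congr (step _ _ _).
suff H s : (foldl (fun ba i => (rcons ba.1 i, step ba.1 ba.2 i))
    (s, a0) beta).1 = s ++ beta by rewrite H.
elim: beta s a0 => [|j b IH] s a /=; first by rewrite cats0.
by rewrite IH cat_rcons.
Qed.

Record driving (R : realType) (d : nat) disp (Omega : measurableType disp)
    (P : probability Omega R) := Driving {
  E_ : label -> {RV P >-> R};
  U_ : label -> {RV P >-> R};
  Y_ : label -> Zd d -> {RV P >-> (Zd d * Zd d)%type}
}.

Definition independent_systems (R : realType) disp (Omega : measurableType disp)
    (P : probability Omega R) (J : choiceType) (F : J -> set (set Omega)) :=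
  forall (s : {fset J}) (A : J -> set Omega),
    (forall j, j \in s -> F j (A j)) ->
    P (\bigcap_(j in [set` s]) A j) = (\prod_(j <- s) P (A j))%E.

Definition sigma_of disp disp' (Omega : measurableType disp)
    (V : measurableType disp') (X : Omega -> V) : set (set Omega) :=
  [set X @^-1` A | A in measurable].

(* Exponential variables take values in [0, +oo[ everywhere, not only almost
   surely, so that the tree never evaluates the forcing outside [0, T]. *)
Record is_driving (R : realType) (d r : nat) (S : params R d r) disp
    (Omega : measurableType disp) (P : probability Omega R)
    (V : driving d P) : Prop := {
  E_ge0 : forall alpha w, 0 <= E_ V alpha w;
  E_law : forall alpha (A : set (measurableTypeR R)), measurable A ->
    distribution P (E_ V alpha) A = exponential_prob 1 A;
  U_law : forall alpha (A : set (measurableTypeR R)), measurable A ->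
    distribution P (U_ V alpha) A = uniform_prob (@ltr01 R) A;
  Y_law : forall alpha k l m, 0 < qtot S k ->
    P [set w | Y_ V alpha k w = (l, m)] = (q_ S k l m / qtot S k)%:E;
  EUY_indep : independent_systems P
    (fun j : label + label + label * Zd d =>
      match j with
      | inl (inl alpha) => sigma_of (E_ V alpha)
      | inl (inr alpha) => sigma_of (U_ V alpha)
      | inr (alpha, k) => sigma_of (Y_ V alpha k)
      end)
}.

(* [pos] is [None] at the cemetery state. *)
Record vertex (R : realType) (d : nat) := Vertex {
  pos : option (Zd d);
  born : R;
  dies : R
}.

Definition tree (R : realType) (d : nat) := label -> vertex R d.

Section branching_tree.
Context (R : realType) (d r : nat) (S : params R d r).
Context disp (Omega : measurableType disp) (P : probability Omega R).
Variables (V : driving d P) (k : Zd d) (w : Omega).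

Definition Khat : label -> Zd d :=
  append_rec k (fun beta K i =>
    if i == i0 then K
    else if i == i1 then (Y_ V beta K w).1 else (Y_ V beta K w).2).

Definition tau : label -> R * R :=
  append_rec (0, (lam_ S k)^-1 * E_ V [::] w) (fun beta bd i =>
    (bd.2, bd.2 + (lam_ S (Khat (rcons beta i)))^-1 * E_ V (rcons beta i) w)).

Definition tauB (alpha : label) : R := (tau alpha).1.
Definition tauD (alpha : label) : R := (tau alpha).2.

Definition Ind : label -> bool :=
  append_rec true (fun beta _ i =>
    if i == i0 then U_ V beta w \in `[0, p_ S (Khat beta)]
    else U_ V beta w \in `[1 - qtot S (Khat beta), 1]).

Definition btree : tree R d := fun alpha =>
  Vertex (if (\prod_(1 <= j < (size alpha).+1) Ind (take j alpha) == 1)%N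
          then Some (Khat alpha) else None)
         (tauB alpha) (tauD alpha).

End branching_tree.

Section trees.
Context (R : realType) (d : nat).
Implicit Types (T : tree R d) (t : R).

Definition subtree (i : 'I_3) T : tree R d := fun alpha =>
  Vertex (pos (T (i :: alpha)))
         (born (T (i :: alpha)) - dies (T [::]))
         (dies (T (i :: alpha)) - dies (T [::])).

(* The set of cardinality N_[0,t](T). *)
Definition alive_before t T : set label :=
  [set alpha | pos (T alpha) <> None /\ born (T alpha) <= t].

Definition death T :=
  [/\ pos (T [:: i0]) = None, pos (T [:: i1]) = None
    & pos (T [:: i2]) = None].

Definition flip T :=
  [/\ pos (T [:: i0]) <> None, pos (T [:: i1]) = None
    & pos (T [:: i2]) = None].

Definition branch T (l m : Zd d) :=
  [/\ pos (T [:: i0]) = None, pos (T [:: i1]) = Some l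
    & pos (T [:: i2]) = Some m].

End trees.

Section pruned_evaluation.
Context (R : realType) (d r : nat) (S : params R d r).
Variables (chi0 : Zd d -> Cvec R r) (gamma : Zd d -> R -> Cvec R r).

(* The graph of R_{n,t}: the recursion is not structural, since it goes through
   the whole tree up to time t. *)
Inductive pruned : nat -> R -> tree R d -> Cvec R r -> Prop :=
| pruned_alive n t T k :
    pos (T [::]) = Some k -> t <= dies (T [::]) -> pruned n t T (chi0 k)
| pruned_zero t T k :
    pos (T [::]) = Some k -> dies (T [::]) < t -> pruned 0 t T 0
| pruned_death n t T k :
    pos (T [::]) = Some k -> dies (T [::]) < t -> death T ->
    pruned n.+1 t T (gamma k (t - dies (T [::])))
| pruned_flip n t T k v :
    pos (T [::]) = Some k -> dies (T [::]) < t -> flip T ->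
    pruned n.+1 (t - dies (T [::])) (subtree i0 T) v ->
    pruned n.+1 t T ((Cf S)%:C *: v)
| pruned_branch n t T k l m v1 v2 :
    pos (T [::]) = Some k -> dies (T [::]) < t -> branch T l m ->
    pruned n.+1 (t - dies (T [::])) (subtree i1 T) v1 ->
    pruned n (t - dies (T [::])) (subtree i2 T) v2 ->
    pruned n.+1 t T ((Cb S)%:C *: B_ S k l m v1 v2).

(* R_{n,t}, set to 0 on the trees where the recursion does not end. *)
Definition Rev (n : nat) (t : R) (T : tree R d) : Cvec R r :=
  xget 0 [set v | pruned n t T v].


Lemma pruned_functional n t T v v' :
  pruned n t T v -> pruned n t T v' -> v = v'.
Proof.
move=> H; elim: H v' => {n t T v}
  [n t T k Tk tD|t T k Tk Dt|n t T k Tk Dt [T0 T1 T2]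
  |n t T k v Tk Dt [T0 T1 T2] Hv IH
  |n t T k l m v1 v2 Tk Dt [T0 T1 T2] Hv1 IH1 Hv2 IH2] v' H';
inversion H'; subst => //;
repeat match goal with
  | H : death _ |- _ => case: H => *
  | H : flip _ |- _ => case: H => *
  | H : branch _ _ _ |- _ => case: H => *
  end; try congruence;
try (by move: (le_lt_trans tD Dt); rewrite ltxx);
try (match goal with
  | H1 : is_true (?a <= ?b)%R, H2 : is_true (?b < ?a)%R |- _ =>
    by move: (le_lt_trans H1 H2); rewrite ltxx end).
- by congr (_ *: _); apply: IH.
- have [Ek El Em] : [/\ k = k0, l = l0 & m = m0] by split; congruence.
  by subst k0 l0 m0; rewrite (IH1 v0)// (IH2 v3).
Qed.

(* On a tree whose times and events are consistent, as those of [btree] are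
   almost surely, R_{n,t} is determined as soon as N_[0,t] is finite. *)
Lemma pruned_total n t T :
  (forall beta i, born (T (rcons beta i)) = dies (T beta)) ->
  (forall beta, pos (T beta) <> None ->
    let T' alpha := T (beta ++ alpha) in
    death T' \/ flip T' \/ exists l m, branch T' l m) ->
  pos (T [::]) <> None -> born (T [::]) <= t ->
  finite_set (alive_before t T) ->
  exists v, pruned n t T v.
Proof.
move=> HB He Hr Ht /finite_seqP[s Hs].
have {}Hs : alive_before t T `<=` [set` s] by rewrite Hs.
have [N] := ubnP (size s); elim: N n t T s HB He Hr Ht Hs => // N IH n t T s HB He Hr Ht Hs sN.
case Ek: (pos (T [::])) Hr => [k|] // _.
have [tD|Dt] := leP t (dies (T [::])); first by exists (chi0 k); exact: pruned_alive tD.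
case: n => [|n]; first by exists 0; exact: pruned_zero Ek Dt.
have rec m i : pos (T [:: i]) <> None ->
    exists v, pruned m (t - dies (T [::])) (subtree i T) v.
  move=> Hi; apply: (IH m _ _ [seq behead x | x <- s & x != [::]]) => //.
  - by move=> beta j; rewrite /= -rcons_cons HB.
  - by move=> beta Hb; apply: (He (i :: beta)).
  - by rewrite /= (HB [::] i) subrr subr_ge0 ltW.
  - move=> alpha [/= Ha]; rewrite lerD2r => Hb.
    apply/mapP; exists (i :: alpha) => //; rewrite mem_filter /=.
    by apply: Hs.
  - rewrite size_map size_filter.
    have s0 : [::] \in s by apply: Hs; split => //; rewrite Ek.
    rewrite -(ltn_add2l (count (pred1 [::]) s)) count_predC.
    rewrite (leq_trans sN)// -addn1 addnC leq_add2r -has_count.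
    by apply/hasP; exists [::].
have [|[|[l [m]]]] : death T \/ flip T \/ exists l m, branch T l m.
  by apply: (He [::]); congruence.
- move=> H; exists (gamma k (t - dies (T [::]))); exact: pruned_death.
- case=> T0 T1 T2; have [v Hv] := rec n.+1 i0 T0.
  by exists ((Cf S)%:C *: v); apply: (pruned_flip Ek Dt _ Hv).
- case=> T0 T1 T2.
  have [v1 Hv1] : exists v, pruned n.+1 (t - dies (T [::])) (subtree i1 T) v.
    by apply: rec; rewrite T1.
  have [v2 Hv2] : exists v, pruned n (t - dies (T [::])) (subtree i2 T) v.
    by apply: rec; rewrite T2.
  by exists ((Cb S)%:C *: B_ S k l m v1 v2); apply: (pruned_branch Ek Dt _ Hv1 Hv2).
Qed.

End pruned_evaluation.

Section expectation.
Context (R : realType) (d r : nat) (S : params R d r).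
Context disp (Omega : measurableType disp) (P : probability Omega R).
Variables (V : driving d P) (k : Zd d).

(* Integrability and expectation under the law of the tree rooted at k, as the
   image of P under the random tree. *)
Definition tree_integrable (F : tree R d -> Cvec R r) :=
  vintegrable P setT (fun w => F (btree S V k w)).

Definition tree_expectation (F : tree R d -> Cvec R r) : Cvec R r :=
  vintegral P setT (fun w => F (btree S V k w)).

End expectation.

Section mild.
Context (R : realType) (d r : nat) (S : params R d r).
Variables (chi0 : Zd d -> Cvec R r) (gamma : Zd d -> R -> Cvec R r).

Definition mild_rhs (cur prev : Zd d -> R -> Cvec R r) (k : Zd d) (t : R) :
    Cvec R r :=
  (expR (- lam_ S k * t))%:C *: chi0 k +
  vintegral (@lebesgue_measure R) `[0, t] (fun s =>
    (lam_ S k * expR (- lam_ S k * (t - s)))%:C *: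
      ((Cf S * p_ S k)%:C *: cur k s +
       (Cb S)%:C *: vsum2 (fun l m =>
          (q_ S k l m)%:C *: B_ S k l m (cur l s) (prev m s)) +
       (d_ S k)%:C *: gamma k s)).

Definition mild_at (chi : nat -> Zd d -> R -> Cvec R r) (t : R) :=
  (forall k, chi 0%N k t = (expR (- lam_ S k * t))%:C *: chi0 k) /\
  (forall n k, chi n.+1 k t = mild_rhs (chi n.+1) (chi n) k t).

End mild.

(* Main.v *)
(** Give a vertex the data (E, U, Y) of its label and evaluate the tree
    recursively, with the number of generations truncated at h.  The truncated
    evaluation vanishes or equals R_{n,t}, and equals it for h large, so every
    bound uniform in h passes to R_{n,t} by Fatou and every equation by
    dominated convergence.

    Conditioning on the root (its clock is independent of its choices, which
    are independent of the two subtrees, which are independent of each other)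
    gives the mild equation with h + 1 generations on the left and h on the
    right.  Applied to the norm it gives bounds uniform in h, by induction on n
    and then on h: in the weight e^{mt} the equation contracts by 1/2, since for
    |k| large p_k and q_k are small, and for the finitely many other k a large m
    makes lambda_k / (lambda_k + m) small.  Applied to the positive and negative
    parts of each coordinate, it gives the equation for the expectations.
    The same contraction, iterated on the difference of two solutions, gives
    uniqueness. *)

Require Import Defs.
From HB Require Import structures.
From mathcomp Require Import all_boot all_order all_algebra finmap.
From mathcomp Require Import complex.
From mathcomp Require Import all_classical all_reals all_analysis.
From mathcomp Require Import measurable_realfun ring lra zify.

Set Implicit Arguments.
Unset Strict Implicit.
Unset Printing Implicit Defensive.

Import Order.TTheory GRing.Theory Num.Theory.
Import numFieldNormedType.Exports.

Local Open Scope classical_set_scope.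
Local Open Scope ring_scope.

(** * Independence of grouped variables *)

(** [Rev] picks a value from an inductively defined graph, so neither measurability nor an integral
    can be read off it. The truncated evaluation is a genuine recursion on the depth, and it
    converges to [Rev] at every sample: where the recursion of [Rev] does not end, both are 0.

    Expectations are first computed in [0, +oo]. The one-step identity is proved by Tonelli for an
    arbitrary nonnegative functional [psi] of the value with [psi 0 = 0]. It is applied to a norm
    while finiteness is still unknown, then to positive and negative parts, which are subtracted
    once the norm bound has made both finite.

    The pruning index makes the estimate linear: at a branch one child keeps the level n and the
    other drops to n - 1, so a bound A for the lower level turns the quadratic term into A times the
    unknown. This is why the induction on n is outside and the one on h inside.

    The forcing is bounded only off a null set of times; that is enough because the estimates meet
    it under a time integral. *)

Definition gens (T J : Type) (F : J -> set (set T)) (D : set J) : set (set T) :=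
  \bigcup_(j in D) F j.

(** [Omega] itself with a smaller sigma-algebra: measurability on [sub F D] says that a function
    depends only on the variables indexed by [D]. *)
Notation sub F D := (g_sigma_algebraType (gens F D)).

Section independence.
Context (R : realType) disp (Omega : measurableType disp)
  (P : probability Omega R) (J : choiceType) (F : J -> set (set Omega)).
Hypothesis FI : forall j, setI_closed (F j).
Hypothesis FT : forall j, F j setT.
Hypothesis Fm : forall j, F j `<=` measurable.
Hypothesis Findep : independent_systems P F.

Local Notation gens := (gens F).
Local Notation sub D := (g_sigma_algebraType (gens D)).

(** Finite intersections form a pi-system that generates the same sigma-algebra as [gens D], and
    [Findep] speaks of them directly. *)
Let cyl (D : set J) : set (set Omega) :=
  [set X | exists (s : {fset J}) (A : J -> set Omega),
    [/\ [set` s] `<=` D, forall j, F j (A j) &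
        X = \bigcap_(j in [set` s]) A j]].

Let cyl_setI D : setI_closed (cyl D).
Proof.
move=> _ _ [s [A [sD FA ->]]] [s' [A' [sD' FA' ->]]].
exists (s `|` s')%fset.
exists (fun j => (if j \in s then A j else setT) `&` (if j \in s' then A' j else setT)).
split.
- by move=> j /=; rewrite inE => /orP[]; [exact: sD|exact: sD'].
- by move=> j; apply: FI; case: ifP.
- apply/seteqP; split=> w /=.
  + by move=> [h h'] j _; split; case: ifP => // js; [exact: h|exact: h'].
  + move=> h; split=> j js.
    * by have [|+ _] := h j; rewrite /= ?inE ?js//.
    * by have [|_ +] := h j; rewrite /= ?inE ?js ?orbT//.
Qed.

Let cyl_meas D X : cyl D X -> measurable X.
Proof.
move=> [s [A [_ FA ->]]]; apply: fin_bigcap_measurable => // j _.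
exact: Fm (FA j).
Qed.

Let sub_cyl D : <<s gens D >> = <<s cyl D >>.
Proof.
apply/seteqP; split.
- apply: smallest_sub; first exact: smallest_sigma_algebra.
  move=> X [j Dj FX]; apply: sub_gen_smallest.
  exists [fset j]%fset, (fun i => if i == j then X else setT); split.
  + by move=> i /=; rewrite inE => /eqP->.
  + by move=> i; case: eqP => [->|].
  + apply/seteqP; split=> w /=.
    * by move=> Xw i /=; rewrite inE => /eqP->; rewrite eqxx.
    * by move=> /(_ j); rewrite /= inE eqxx; apply.
- apply: smallest_sub; first exact: smallest_sigma_algebra.
  move=> _ [s [A [sD FA ->]]].
  have : forall j, [set` s] j -> (measurable : set (set (sub D))) (A j).
    move=> j js; apply: sub_gen_smallest; exists j => //; exact: sD.
  by move/(fin_bigcap_measurable (finite_fset s)).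
Qed.

Lemma sub_measurable D (A : set Omega) :
  (measurable : set (set (sub D))) A -> measurable A.
Proof.
move: A; apply: smallest_sub; first exact: sigma_algebra_measurable.
by move=> X [j _] /Fm.
Qed.

Lemma subS D D' : D `<=` D' -> 
  (measurable : set (set (sub D))) `<=` (measurable : set (set (sub D'))).
Proof.
move=> DD'; apply: smallest_sub; first exact: smallest_sigma_algebra.
by move=> X [j Dj FX]; apply: sub_gen_smallest; exists j => //; exact: DD'.
Qed.

Let indep_cyl D1 D2 A B : [disjoint D1 & D2] -> cyl D1 A -> cyl D2 B ->
  P (A `&` B) = (P A * P B)%E.
Proof.
move=> /disj_setPS D12 [s [A1 [sD FA ->]]] [s' [A2 [sD' FA' ->]]].
have ss' : [disjoint s & s']%fset.
  apply/fdisjointP => j js; apply/negP => js'.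
  by apply: (D12 j); split; [exact: sD|exact: sD'].
pose A0 j := if j \in s then A1 j else A2 j.
have -> : \bigcap_(j in [set` s]) A1 j `&` \bigcap_(j in [set` s']) A2 j =
    \bigcap_(j in [set` (s `|` s')%fset]) A0 j.
  apply/seteqP; split=> w /=.
  - move=> [h h'] j /=; rewrite inE /A0; case: ifPn => [js _|js /= js'].
      exact: h.
    exact: h'.
  - move=> h; split=> j js; have := h j; rewrite /= inE /A0.
      by move: js => /= ->; apply.
    rewrite ifN; first by move: js => /= ->; rewrite orbT; apply.
    by apply/negP => /(fdisjointP ss'); move: js => /= ->.
rewrite !Findep//; last by move=> j _; rewrite /A0; case: ifP.
rewrite (big_fsetID _ (mem s))/=; congr (_ * _)%E.
- have -> : [fset x in (s `|` s')%fset | x \in s]%fset = s.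
    by apply/fsetP => j; rewrite !inE/=; case: (j \in s); rewrite ?andbF.
  by apply: eq_big_seq => j js; rewrite /A0 js.
- have -> : [fset x in (s `|` s')%fset | x \notin s]%fset = s'.
    apply/fsetP => j; rewrite !inE/=; case: (boolP (j \in s)) => js /=.
      by apply/esym/negbTE/(fdisjointP ss').
    by rewrite andbT.
  apply: eq_big_seq => j js; rewrite /A0 ifN//.
  by apply/negP => /(fdisjointP ss'); rewrite js.
Qed.

(* Dynkin's lemma, once for each factor. *)
Let dynkin_step (C : set Omega) D : measurable C ->
  (forall B, cyl D B -> P (C `&` B) = (P C * P B)%E) ->
  forall B, (measurable : set (set (sub D))) B -> P (C `&` B) = (P C * P B)%E.
Proof.
move=> mC HC.
have PCfin : P C \is a fin_num by rewrite fin_num_measure.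
move=> B mB; have {mB} : <<s cyl D >> B by rewrite -sub_cyl.
move: B; apply: (@dynkin_induction _ (sub D) (cyl D)
  (fun B => P (C `&` B) = (P C * P B)%E)) => //.
- by rewrite -sub_cyl.
- by rewrite setIT probability_setT mule1.
- move=> S /sub_measurable mS HS.
  rewrite -setDE measureD//; last by rewrite -ge0_fin_numE// fin_num_measure.
  rewrite probability_setC// muleBr//.
  by rewrite mule1 -HS.
- move=> G mG tG HG.
  have {}mG n : (measurable : set (set Omega)) (G n) by exact: (@sub_measurable D (G n) (mG n)).
  rewrite setI_bigcupr !measure_bigcup//; last 2 first.
  + by move=> n _; exact: measurableI.
  + exact: trivIset_setIl.
  rewrite -[X in _ = (X * _)%E](fineK PCfin) -nneseriesZl//.
  by apply: eq_eseriesr => n _; rewrite fineK//; exact: HG.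
Qed.

Lemma indep_sub D1 D2 A B : [disjoint D1 & D2] ->
  (measurable : set (set (sub D1))) A -> (measurable : set (set (sub D2))) B ->
  P (A `&` B) = (P A * P B)%E.
Proof.
move=> D12 mA mB; have mA' := sub_measurable mA.
apply: (@dynkin_step A D2) => // B' cB'.
have mB' := cyl_meas cB'.
rewrite setIC muleC; apply: (@dynkin_step B' D1) => // A' cA'.
by rewrite setIC muleC; apply: indep_cyl cA' cB'.
Qed.

Section decoupling.
Variables D1 D2 : set J.
Hypothesis D12 : [disjoint D1 & D2].
Local Open Scope ereal_scope.

Let T1 : measurableType _ := sub D1.
Let T2 : measurableType _ := sub D2.
Let id1 : Omega -> T1 := id.
Let id2 : Omega -> T2 := id.
Let id12 : Omega -> (T1 * T2)%type := fun w => (w, w).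

Let mid1 : measurable_fun setT id1.
Proof. by move=> _ A mA; rewrite setTI; exact: sub_measurable mA. Qed.
Let mid2 : measurable_fun setT id2.
Proof. by move=> _ A mA; rewrite setTI; exact: sub_measurable mA. Qed.
Let mid12 : measurable_fun setT id12.
Proof. by apply/measurable_fun_pairP. Qed.

HB.instance Definition _ := isMeasurableFun.Build _ _ _ _ id1 mid1.
HB.instance Definition _ := isMeasurableFun.Build _ _ _ _ id2 mid2.
HB.instance Definition _ := isMeasurableFun.Build _ _ _ _ id12 mid12.

Let P1 := distribution P id1.
Let P2 := distribution P id2.
Let P12 := distribution P id12.

(** Independence as an identity of measures: the diagonal map carries [P] to the product of its
    restrictions to the two sigma-algebras. *)
Let P12E X : measurable X -> (P1 \x P2) X = P12 X.
Proof.
apply: product_measure_unique => A B mA mB.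
exact: (indep_sub D12 mA mB).
Qed.

(** One sample read through two disjoint groups of variables may be replaced by two independent
    samples. This does the work of conditional expectation: one group is frozen while the other is
    integrated. *)
Lemma ge0_decouple (G : (T1 * T2)%type -> \bar R) :
  measurable_fun setT G -> (forall x, 0 <= G x) ->
  \int[P]_w G (w, w) = \int[P]_w1 \int[P]_w2 G (w1, w2).
Proof.
move=> mG G0.
transitivity (\int[P12]_x G x); first by rewrite ge0_integral_distribution.
rewrite (eq_measure_integral (P1 \x P2)); last first.
  by move=> A mA _; exact/esym/P12E.
rewrite fubini_tonelli1//.
rewrite ge0_integral_distribution//; last 2 first.
- exact: measurable_fun_fubini_tonelli_F.
- by move=> x; exact: integral_ge0.
apply: eq_integral => w _ /=; rewrite /fubini_F.
by rewrite ge0_integral_distribution//; exact: measurableT_comp.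
Qed.

Lemma ge0_indep_integralM (X : T1 -> \bar R) (Y : T2 -> \bar R) :
  measurable_fun setT X -> measurable_fun setT Y ->
  (forall w, 0 <= X w) -> (forall w, 0 <= Y w) ->
  \int[P]_w (X w * Y w) = \int[P]_w X w * \int[P]_w Y w.
Proof.
move=> mX mY X0 Y0.
have mX' : measurable_fun setT (X \o id1) by exact: measurableT_comp.
have mY' : measurable_fun setT (Y \o id2) by exact: measurableT_comp.
rewrite (@ge0_decouple (fun x => X x.1 * Y x.2)); last 2 first.
- by apply: emeasurable_funM; exact: measurableT_comp.
- by move=> x; exact: mule_ge0.
transitivity (\int[P]_w1 (X w1 * \int[P]_w Y w)).
  by apply: eq_integral => w1 _; rewrite -ge0_integralZl.
by rewrite ge0_integralZr//; exact: integral_ge0.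
Qed.

(** The signed version, meant for coordinates of two sibling subtrees. Integrability of the product
    comes from the nonnegative case applied to absolute values; Fubini then applies. *)
Lemma indep_integralM (X : T1 -> R) (Y : T2 -> R) :
  measurable_fun setT X -> measurable_fun setT Y ->
  P.-integrable setT (EFin \o X) -> P.-integrable setT (EFin \o Y) ->
  P.-integrable setT (fun w => (X w * Y w)%:E) /\
  \int[P]_w (X w * Y w)%:E = \int[P]_w (X w)%:E * \int[P]_w (Y w)%:E.
Proof.
move=> mX mY iX iY.
have EdistX (f : T1 -> R) : measurable_fun setT f ->
    \int[P1]_w (f w)%:E = \int[P]_w (f w)%:E.
  move=> mf; rewrite integralE [RHS]integralE.
  by congr (_ - _); rewrite ge0_integral_distribution//;
    [exact/measurable_funepos/measurable_EFinP|
     exact/measurable_funeneg/measurable_EFinP].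
have EdistY (f : T2 -> R) : measurable_fun setT f ->
    \int[P2]_w (f w)%:E = \int[P]_w (f w)%:E.
  move=> mf; rewrite integralE [RHS]integralE.
  by congr (_ - _); rewrite ge0_integral_distribution//;
    [exact/measurable_funepos/measurable_EFinP|
     exact/measurable_funeneg/measurable_EFinP].
have fX := integrable_fin_num measurableT iX.
have fY := integrable_fin_num measurableT iY.
have mXY : measurable_fun setT (fun x : T1 * T2 => X x.1 * Y x.2)%R.
  by apply: measurable_funM; exact: measurableT_comp.
have mXY' : measurable_fun setT (fun w : Omega => X w * Y w)%R.
  by apply: measurable_funM; [exact: (measurableT_comp mX mid1)|
    exact: (measurableT_comp mY mid2)].
have absXY : \int[P]_w `|X w * Y w|%:E < +oo.
  under eq_integral do rewrite normrM EFinM.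
  rewrite (@ge0_indep_integralM (fun w => `|X w|%:E) (fun w => `|Y w|%:E))//;
    try by [apply/measurable_EFinP; exact: measurableT_comp].
  have /integrableP[_ aX] := iX; have /integrableP[_ aY] := iY.
  apply: lte_mul_pinfty => //; first exact: integral_ge0.
  by rewrite ge0_fin_numE//; exact: integral_ge0.
have iXY : P.-integrable setT (fun w => (X w * Y w)%:E).
  by apply/integrableP; split => //; exact/measurable_EFinP.
split => //.
have i12 : (P1 \x P2).-integrable setT (fun x => (X x.1 * Y x.2)%:E).
  apply/integrableP; split; first exact/measurable_EFinP.
  rewrite (eq_measure_integral P12); last by move=> A mA _; exact: P12E.
  rewrite ge0_integral_distribution//.
  by apply: measurableT_comp => //; exact/measurable_EFinP.
transitivity (\int[P12]_x (X x.1 * Y x.2)%:E).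
  by rewrite integral_distribution//; exact/measurable_EFinP.
rewrite (eq_measure_integral (P1 \x P2)); last first.
  by move=> A mA _; exact/esym/P12E.
have iY2 : P2.-integrable setT (EFin \o Y).
  apply/integrableP; split; first exact/measurable_EFinP.
  rewrite /= (EdistY (fun w => `|Y w|%R))//; last exact: measurableT_comp.
  by have /integrableP[] := iY.
have iX1 : P1.-integrable setT (EFin \o X).
  apply/integrableP; split; first exact/measurable_EFinP.
  rewrite /= (EdistX (fun w => `|X w|%R))//; last exact: measurableT_comp.
  by have /integrableP[] := iX.
rewrite -integral12_prod_meas1//= /fubini_F/=.
transitivity (\int[P1]_w1 ((X w1)%:E * \int[P]_w (Y w)%:E)).
  by apply: eq_integral => w1 _; rewrite -EdistY// -integralZl.
by rewrite -(fineK fY) integralZr// EdistX// fineK.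
Qed.

End decoupling.
End independence.

(** * Integration against a measure with a density *)

Section density.
Context d (T : measurableType d) (R : realType).
Variables (mu nu : {measure set T -> \bar R}) (g : T -> R).
Hypotheses (mg : measurable_fun setT g) (g0 : forall x, 0 <= g x).
Hypothesis nuE : forall A, measurable A -> nu A = (\int[mu]_(x in A) (g x)%:E)%E.
Local Open Scope ereal_scope.

Import HBNNSimple.

(** From indicators to simple functions, then by monotone convergence; it serves to write the
    exponential law through its density. *)
Lemma ge0_integral_density (f : T -> \bar R) :
  measurable_fun setT f -> (forall x, 0 <= f x) ->
  \int[nu]_x f x = \int[mu]_x (f x * (g x)%:E).
Proof.
move=> mf f0; pose f_ := nnsfun_approx measurableT mf.
have nnsfE (h : {nnsfun T >-> R}) :
    \int[nu]_x (h x)%:E = \int[mu]_x ((h x)%:E * (g x)%:E).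
  under [LHS]eq_integral do rewrite fimfunE -fsumEFin//.
  rewrite ge0_integral_fsum//; last 2 first.
  - by move=> r; exact/measurable_EFinP/measurableT_comp.
  - by move=> n x _; rewrite EFinM nnfun_muleindic_ge0.
  under [RHS]eq_integral.
    move=> x _; rewrite fimfunE -fsumEFin// ge0_mule_fsuml; last first.
      by move=> r; rewrite EFinM nnfun_muleindic_ge0.
    over.
  rewrite [RHS]ge0_integral_fsum//; last 2 first.
  - move=> r; apply: emeasurable_funM; last exact/measurable_EFinP.
    by apply/measurable_EFinP; do 2 apply/measurableT_comp => //.
  - by move=> n x _; rewrite mule_ge0 ?lee_fin// -lee_fin EFinM nnfun_muleindic_ge0.
  apply: eq_fsbigr => r _.
  rewrite integralZl_indic_nnsfun//=.
  rewrite integral_indic//= setIT nuE//.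
  have [r0|r0] := ltP r 0%R.
    have -> : h @^-1` [set r] = set0 by rewrite preimage_nnfun0.
    rewrite integral_set0 mule0; apply/esym/integral0_eq => x _.
    by rewrite indicE in_set0 mulr0 mul0e.
  rewrite integral_mkcond -ge0_integralZl//; last 2 first.
  - apply/(measurable_restrictT _ _).1 => //; apply: measurable_funTS; exact/measurable_EFinP.
  - by move=> x _; rewrite patchE; case: ifP; rewrite lee_fin.
  apply: eq_integral => x _; rewrite patchE indicE.
  by case: ifPn; rewrite ?mulr1// mulr0 mule0 mul0e.
transitivity (limn (fun n => \int[nu]_x (f_ n x)%:E)).
  rewrite -monotone_convergence//=.
  - apply: eq_integral => x _; apply/esym/cvg_lim => //=.
    exact: cvg_nnsfun_approx.
  - by move=> n; exact/measurable_EFinP/measurable_funTS.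
  - by move=> n x _; rewrite lee_fin.
  - by move=> x _ a b ab; rewrite lee_fin; exact/lefP/nd_nnsfun_approx.
under eq_fun do rewrite nnsfE.
rewrite -monotone_convergence//=.
- apply: eq_integral => x _.
  by apply/cvg_lim => //; apply: cvgeZr => //; exact: cvg_nnsfun_approx.
- move=> n; apply: emeasurable_funM; exact/measurable_EFinP.
- by move=> n x _; rewrite mule_ge0// lee_fin.
- move=> x _ a b ab; rewrite lee_wpmul2r ?lee_fin//.
  exact/lefP/nd_nnsfun_approx.
Qed.

End density.

(** * Pairs of lattice points and uniform variables *)

Section countable.
Context d (C : measurableType d) d' (T : measurableType d') d2 (U : measurableType d2).
Hypothesis mC : forall A : set C, measurable A.
Hypothesis cC : countable [set: C].

Lemma measurable_fun_slices (g : C * T -> U) :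
  (forall c, measurable_fun setT (fun x => g (c, x))) -> measurable_fun setT g.
Proof.
move=> mg _ A mA; rewrite setTI.
rewrite (_ : g @^-1` A =
  \bigcup_c ([set c] `*` ((fun x => g (c, x)) @^-1` A))).
  apply: countable_bigcupT_measurable => // c.
  by apply: measurableX => //; rewrite -[X in measurable X]setTI; exact: mg.
by apply/seteqP; split => [[c x] gA|[c x] [_ _ [/= -> //]]]; exists c.
Qed.

(** Meant for [f] the random pair of positions of the children and [g] the evaluations from fixed
    positions: a random index with countably many values preserves measurability. *)
Lemma measurable_fun_select (f : T -> C) (g : C -> T -> U) :
  measurable_fun setT f -> (forall c, measurable_fun setT (g c)) ->
  measurable_fun setT (fun x => g (f x) x).
Proof.
move=> mf mg; pose h x := g x.1 x.2.
rewrite (_ : (fun _ => _) = h \o (fun x => (f x, x)))//.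
apply: measurableT_comp; first exact: measurable_fun_slices.
by apply/measurable_fun_pairP; split => //; exact: measurable_id.
Qed.

End countable.

Section pairs.
Context (d : nat).
Local Notation Z2 := (Zd d * Zd d)%type.

Lemma Z2_measurable (A : set Z2) : measurable A.
Proof.
apply: countable_measurable; last exact: countableP.
move=> [l m]; have -> : [set (l, m)] = [set l] `*` [set m].
  by apply/seteqP; split => [_ -> //|[l' m'] /= [-> ->]].
exact: measurableX.
Qed.

Lemma Z2_countable : countable [set: Z2].
Proof. exact: countableP. Qed.

Lemma Z2_measurable_fun d' (U : measurableType d') (f : Z2 -> U) :
  measurable_fun setT f.
Proof. by move=> _ A _; exact: Z2_measurable. Qed.

Context (R : realType).

Lemma counting_set1 (T : choiceType) (x : T) : @counting T R [set x] = 1%E.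
Proof. by rewrite /counting asboolT// fset_set1 cardfs1. Qed.

(** A countable partition into fibres that are empty or singletons: it witnesses sigma-finiteness of
    the counting measure and turns its integrals into series. *)
Let F (n : nat) : set Z2 := [set x | choice.pickle x = n].

Let F1 n : F n = set0 \/ exists x, F n = [set x].
Proof.
have [->|/set0P[x xn]] := eqVneq (F n) set0; [by left|right; exists x].
apply/seteqP; split => [y yn|y /= ->//].
by apply: (pcan_inj choice.pickleK); rewrite xn.
Qed.

Let FT : [set: Z2] = \bigcup_n F n.
Proof. by apply/seteqP; split => // x _; exists (choice.pickle x). Qed.

Let tF : trivIset setT F.
Proof. by move=> i j _ _ [x [/= <- <-]]. Qed.

Lemma sigma_finite_counting2 : sigma_finite [set: Z2] (@counting Z2 R).
Proof.
exists F => // n; split; first exact: Z2_measurable.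
by case: (F1 n) => [->|[x ->]]; rewrite ?measure0 ?counting_set1 ltry.
Qed.

(* An alias: [counting] itself already carries the sigma-finite structure of
   the type nat. *)
Definition counting2 : set Z2 -> \bar R := counting.
HB.instance Definition _ := Measure.on counting2.
HB.instance Definition _ :=
  Measure_isSigmaFinite.Build _ _ _ counting2 sigma_finite_counting2.

Local Open Scope ereal_scope.

Lemma ge0_integral_counting (f : Z2 -> \bar R) : (forall x, 0 <= f x) ->
  \int[counting]_x f x = \esum_(x in [set: Z2]) f x.
Proof.
move=> f0; rewrite [in RHS]FT esum_bigcupT// -nneseries_esumT; last first.
  by move=> n; exact: esum_ge0.
rewrite [in LHS]FT ge0_integral_bigcup//; last 2 first.
- by move=> n; exact: Z2_measurable.
- by rewrite -FT; exact: Z2_measurable_fun.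
apply: eq_eseriesr => n _; case: (F1 n) => [->|[x ->]].
  by rewrite integral_set0 esum_set0.
rewrite esum_set1// (eq_integral (cst (f x))); last by move=> y /[!inE]/= ->.
rewrite integral_cst; last exact: Z2_measurable.
by rewrite [X in (_ * X)%E]counting_set1 mule1.
Qed.

Lemma integral_counting_set1 (a : Z2) (f : Z2 -> \bar R) : (forall x, 0 <= f x) ->
  \int[counting]_x (if x == a then f x else 0) = f a.
Proof.
move=> f0; rewrite -[RHS]mule1 -(counting_set1 a) -integral_cst; last exact: Z2_measurable.
rewrite [RHS]integral_mkcond; apply: eq_integral => x _.
by rewrite patchE; case: eqP => [->|xa]; [rewrite mem_set|rewrite memNset].
Qed.

End pairs.

Section uniform.
Context (R : realType).
Local Notation unif := (uniform_prob (@ltr01 R)).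

Lemma uniform_prob_itv (a b : R) (ba bb : bool) : 0 <= a -> a <= b -> b <= 1 ->
  unif [set` Interval (BSide ba a) (BSide bb b)] = (b - a)%:E.
Proof.
move=> a0 ab b1; rewrite /uniform_prob.
rewrite (eq_integral (cst 1%E)); last first.
  move=> x /[!inE] /= xab; rewrite /uniform_pdf subr0 invr1 ifT//.
  move: xab; rewrite in_itv; case: ba; case: bb => /= /andP[h1 h2];
    apply/andP; split; lra.
rewrite integral_cst//= mul1e lebesgue_measure_itv/= lte_fin.
case: ltP => [//|ba']; have -> : b = a by apply/eqP; rewrite eq_le ba' ab.
by rewrite subrr.
Qed.

Variables p q : R.
Hypotheses (p0 : 0 <= p) (q0 : 0 <= q) (pq1 : p + q <= 1).

Let I1 : set R := `[0, p].
Let I2 : set R := `[1 - q, 1].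

(** The two closed intervals meet at most in the point p, which happens when p + q = 1. Flip and
    branch are therefore disjoint only up to a null event, and their probabilities are computed on
    the differences. *)
Let null : unif (I1 `&` I2) = 0%E.
Proof.
apply: (@subset_measure0 _ _ _ unif _ `[p, p]%classic) => //.
- by apply: measurableI; exact: measurable_itv.
- by move=> x; rewrite /I1 /I2 /= !in_itv /= => -[/andP[h1 h2] /andP[h3 h4]]; apply/andP; split; [have := pq1; lra|].
- by rewrite [LHS]uniform_prob_itv// ?subrr//; have := pq1; have := p0; have := q0; lra.
Qed.

Lemma uniform_flip : unif (I1 `\` I2) = p%:E.
Proof.
rewrite measureD; [|exact: measurable_itv|exact: measurable_itv|]; last first.
  by rewrite -ge0_fin_numE// fin_num_measure//; exact: measurable_itv.
by rewrite [X in (_ - X)%E]null sube0 [LHS]uniform_prob_itv ?subr0//; have := pq1; have := p0; have := q0; lra.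
Qed.

Lemma uniform_branch : unif (I2 `\` I1) = q%:E.
Proof.
rewrite measureD; [|exact: measurable_itv|exact: measurable_itv|]; last first.
  by rewrite -ge0_fin_numE// fin_num_measure//; exact: measurable_itv.
rewrite [X in (_ - X)%E](_ : _ = 0%E) ?sube0; last by rewrite setIC; exact: null.
have -> : q%:E = (1 - (1 - q))%:E by congr (_%:E); ring.
by apply: uniform_prob_itv; have := pq1; have := p0; have := q0; lra.
Qed.

Lemma uniform_death : unif (~` (I1 `|` I2)) = (1 - p - q)%:E.
Proof.
have mU : measurable (I1 `|` I2) by apply: measurableU; exact: measurable_itv.
rewrite probability_setC//.
rewrite -(setDUK (@subsetUl _ I1 I2)) setDUl setDv set0U.
rewrite measureU; [|exact: measurable_itv|..]; last 2 first.
- apply: measurableD; exact: measurable_itv.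
- by rewrite setDE setICA setICr setI0.
rewrite [X in (_ - (_ + X))%E]uniform_branch [X in (_ - (X + _))%E](_ : _ = p%:E).
  by have -> : 1 - p - q = 1 - (p + q) by ring.
rewrite -[p in RHS]subr0.
by apply: uniform_prob_itv; have := pq1; have := p0; have := q0; lra.
Qed.

End uniform.

(** * Exponential clocks *)

Section exponential.
Context (R : realType).
Local Notation mu := (@lebesgue_measure R).

(** By uniqueness of Lebesgue measure: its image under s |-> l (t - s), scaled by l, gives every
    half-open interval its length. *)
Lemma lebesgue_affine (l t : R) (l0 : 0 < l) (f : R -> \bar R) :
  measurable_fun setT f -> (forall x, (0 <= f x)%E) ->
  (\int[mu]_x f x = l%:E * \int[mu]_s f (l * (t - s))%R)%E.
Proof.
move=> mf f0.
pose phi : R -> measurableTypeR R := fun s => l * (t - s).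
have mphi : measurable_fun setT phi.
  by apply: measurable_funM => //; exact: measurable_funB.
pose k : {nonneg R} := NngNum (ltW l0).
pose rho : {measure set (measurableTypeR R) -> \bar R} := pushforward mu phi.
pose nu : {measure set (measurableTypeR R) -> \bar R} := mscale k (rho mphi).
rewrite (eq_measure_integral nu); last first.
  move=> A mA _; apply: lebesgue_measure_unique => // _ [[a b]] _ <-.
  change (mu `]a, b]%classic = l%:E * mu (phi @^-1` `]a, b]%classic))%E.
  have -> : phi @^-1` [set` Interval (BRight a) (BRight b)] =
      [set` Interval (BLeft (t - b / l)) (BLeft (t - a / l))].
    apply/seteqP; split => s /=; rewrite !in_itv/= /phi => /andP[h1 h2]; apply/andP; split.
    - by rewrite lerBlDr addrC -lerBlDr ler_pdivlMr// mulrC.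
    - by rewrite ltrBrDr addrC -ltrBrDr ltr_pdivrMr// mulrC.
    - by rewrite mulrC -ltr_pdivrMr// ltrBrDr addrC -ltrBrDr.
    - by rewrite mulrC -ler_pdivlMr// lerBlDr addrC -lerBlDr.
  rewrite !lebesgue_measure_itv/= !lte_fin ltrD2l ltrN2 ltr_pM2r ?invr_gt0//.
  case: ifPn; last by rewrite mule0.
  by move=> ab; rewrite -!EFinB -EFinM; congr (_%:E); field; rewrite gt_eqF.
by rewrite ge0_integral_mscale//= ge0_integral_pushforward.
Qed.

(** The source of the contraction: integrated against the kernel of a clock of rate l, the weight
    e^{ms} comes back with the factor l / (l + m). The case m = 0 gives the law of the clock before
    t. *)
Lemma integral_exp_window (l m t : R) : 0 < l -> 0 <= m -> 0 <= t ->
  (\int[mu]_(s in `[0%R, t]) (l * expR (- l * (t - s)) * expR (m * s))%:E =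
   (l / (l + m) * (expR (m * t) - expR (- l * t)))%:E)%E.
Proof.
move=> l0 m0; rewrite le_eqVlt => /predU1P[<-|t0].
  by rewrite set_itv1 integral_set1 !mulr0 subrr mulr0.
have lm0 : 0 < l + m by exact: ltr_wpDr.
pose F s := l / (l + m) * expR (- l * t + (l + m) * s).
have dg (x : R) : is_derive x (1 : R) (fun s : R => - l * t + (l + m) * s) (l + m).
  by apply: is_derive_eq; rewrite add0r mul1r /GRing.scale/= mulr1.
have dF (x : R) : is_derive x (1 : R) F (l * expR (- l * (t - x)) * expR (m * x)).
  have := @is_deriveZ _ _ _ _ (l / (l + m)) _ _ _
    (is_derive1_comp (is_derive_expR _) (dg x)).
  congr (is_derive _ _ _ _); rewrite /GRing.scale/= -mulrA -expRD.
  rewrite (_ : - l * t + (l + m) * x = - l * (t - x) + m * x); last by ring.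
  by field; rewrite gt_eqF.
have cf : continuous (fun s : R => l * expR (- l * (t - s)) * expR (m * s)).
  move=> x; apply/differentiable_continuous/derivable1_diffP.
  exact: ex_derive.
have cF : continuous F.
  by move=> x; apply/differentiable_continuous/derivable1_diffP; have [] := dF x.
transitivity (F t - F 0)%:E.
  apply: continuous_FTC2 => //.
  - exact: continuous_subspaceT.
  - split.
    + by move=> x _; have [] := dF x.
    + by apply: cvg_at_right_filter; exact: cF.
    + by apply: cvg_at_left_filter; exact: cF.
  - by move=> x _; rewrite derive1E; have [_ ->] := dF x.
congr (_%:E); rewrite /F -mulrBr mulr0 addr0; congr (_ * (expR _ - _)).
by ring.
Qed.

Local Notation nu := (exponential_prob (1 : R)).

Section split.
Variables (l t : R).
Hypotheses (l0 : 0 < l) (t0 : 0 <= t).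

Let after x := t <= l^-1 * x.

Let mafter : measurable_fun setT after.
Proof. by apply: measurable_fun_ler => //; exact: measurable_funM. Qed.

Let mA : measurable_fun setT (fun x : R => t - l^-1 * x).
Proof. by apply: measurable_funB => //; apply: measurable_funM. Qed.

Let mB : measurable_fun setT (fun s : R => l * (t - s)).
Proof. by apply: measurable_funM => //; apply: measurable_funB. Qed.

Let pdf_ge0 x : 0 <= exponential_pdf (1 : R) x.
Proof. exact: exponential_pdf_ge0. Qed.

Let weight x := if after x then 0 else exponential_pdf (1 : R) x.

Let mweight : measurable_fun setT weight.
Proof. by apply: measurable_fun_ifT => //; exact: measurable_exponential_pdf. Qed.

Let weight_ge0 x : 0 <= weight x.
Proof. by rewrite /weight; case: ifP. Qed.

Let integral_before (H : R -> \bar R) : measurable_fun setT H ->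
    (forall s, 0 <= H s)%E ->
  (\int[mu]_x ((weight x)%:E * H (t - l^-1 * x)%R) =
   \int[mu]_(s in `[0%R, t]) ((l * expR (- l * (t - s)))%:E * H s))%E.
Proof.
move=> mH H0.
rewrite (lebesgue_affine t l0); last 2 first.
- apply: emeasurable_funM; first exact/measurable_EFinP.
  exact: (measurableT_comp mH mA).
- by move=> x; rewrite mule_ge0// lee_fin.
rewrite -ge0_integralZl//; last 3 first.
- apply: emeasurable_funM.
    by apply/measurable_EFinP; exact: (measurableT_comp mweight mB).
  exact: (measurableT_comp (measurableT_comp mH mA) mB).
- by move=> x _; rewrite mule_ge0// lee_fin.
- by rewrite lee_fin ltW.
rewrite -integral_itv_obnd_cbnd; last first.
  apply: measurable_funTS; apply: emeasurable_funM => //.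
  apply/measurable_EFinP; apply: measurable_funM => //.
  by apply: measurableT_comp => //; apply: measurable_funM => //; exact: measurable_funB.
rewrite [RHS]integral_mkcond; apply: eq_integral => s _.
rewrite patchE mulKf ?gt_eqF// opprB addrCA subrr addr0.
rewrite /weight /after mulKf ?gt_eqF//.
rewrite mem_setE in_itv/=.
have -> : (t <= t - s) = ~~ (0 < s) by rewrite lerBrDl -lerBrDr subrr leNgt.
case: ltP => s0/=; last by rewrite mul0e mule0.
case: leP => st.
  rewrite exponential_pdfE ?mulr_ge0 ?subr_ge0 ?(ltW l0)//.
  by rewrite mul1r muleA -EFinM mulN1r mulNr.
by rewrite lt0_exponential_pdf ?pmulr_rlt0 ?subr_lt0// mul0e mule0.
Qed.

(** By complement: the density has total mass 1, and its part before t contributes 1 - e^{-lt} by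
    [integral_exp_window] with m = 0. *)
Let nuD : (\int[mu]_x (if after x then exponential_pdf 1 x else 0)%:E = (expR (- l * t))%:E)%E.
Proof.
have mg : measurable_fun setT (fun x => if after x then exponential_pdf (1:R) x else 0).
  by apply: measurable_fun_ifT => //; exact: measurable_exponential_pdf.
have : (\int[mu]_x ((if after x then exponential_pdf 1 x else 0)%:E +
    (weight x)%:E * 1) = 1)%E.
  rewrite -[RHS](integral_exponential_pdf (@ltr01 R)); apply: eq_integral => x _.
  by rewrite /weight mule1; case: ifP; rewrite ?adde0 ?add0e.
rewrite ge0_integralD//; last 4 first.
- by move=> x _; case: ifP; rewrite lee_fin.
- exact/measurable_EFinP.
- by move=> x _; rewrite mule1 lee_fin.
- by apply: emeasurable_funM => //; exact/measurable_EFinP.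
rewrite (integral_before (H := cst 1%E))//=.
have := @integral_exp_window l 0 t l0 (lexx _) t0.
under eq_integral do rewrite mul0r expR0 EFinM.
move=> ->; rewrite addr0 divff ?gt_eqF// mul1r mul0r expR0 => h.
have hf : (\int[mu]_x (if after x then exponential_pdf 1 x else 0)%:E)%E \is a fin_num.
  rewrite ge0_fin_numE; last by apply: integral_ge0 => x _; rewrite lee_fin; case: ifP.
  apply: (@le_lt_trans _ _ 1%E); last by rewrite ltry.
  rewrite -h leeDl// lee_fin subr_ge0 -expR0 ler_expR mulNr oppr_le0.
  by rewrite mulr_ge0// ltW.
move: h; rewrite -(fineK hf) -EFinD => -[h]; congr (_%:E).
by move/eqP: h; rewrite addrA subr_eq addrC (inj_eq (addrI _)) => /eqP.
Qed.

(** Where the kernel of the mild equation comes from: the clock outlasts t with probability e^{-lt},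
    and otherwise the time s that is left when it rings has density l e^{-l(t-s)} on [0, t]. *)
Lemma integral_exponential_split (a : \bar R) (H : R -> \bar R) :
    (0 <= a)%E -> measurable_fun setT H -> (forall s, 0 <= H s)%E ->
  (\int[nu]_x (if (t <= l^-1 * x)%R then a else H (t - l^-1 * x)%R) =
   a * (expR (- l * t))%:E +
   \int[mu]_(s in `[0%R, t]) ((l * expR (- l * (t - s)))%:E * H s))%E.
Proof.
move=> a0 mH H0.
have mG : measurable_fun setT (fun x : R => H (t - l^-1 * x)).
  exact: (measurableT_comp mH mA).
rewrite (@ge0_integral_density _ _ _ mu nu (exponential_pdf 1))//; last 3 first.
- exact: measurable_exponential_pdf.
- exact: measurable_fun_ifT.
- by move=> x; case: ifP.
rewrite -integral_before// -nuD -ge0_integralZl//; last 2 first.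
- apply/measurable_EFinP/measurable_fun_ifT => //.
  exact: measurable_exponential_pdf.
- by move=> x _; rewrite lee_fin; case: ifP.
rewrite -ge0_integralD//; last 4 first.
- by move=> x _; rewrite mule_ge0// lee_fin; case: ifP.
- apply: emeasurable_funM => //; apply/measurable_EFinP/measurable_fun_ifT => //.
  exact: measurable_exponential_pdf.
- by move=> x _; rewrite mule_ge0// lee_fin.
- by apply: emeasurable_funM => //; exact/measurable_EFinP.
apply: eq_integral => x _; rewrite /weight -/(after x).
by case: ifP => _; rewrite ?mul0e ?adde0// mule0 add0e muleC.
Qed.

End split.

End exponential.

(** * One vertex of the branching tree *)

Section driving.
Context (R : realType) (d r : nat) (S : params R d r) (HS : standing S).
Context (disp : measure_display) (Omega : measurableType disp)
  (P : probability Omega R) (V : driving d P) (HV : is_driving S V).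

Local Notation Z2 := (Zd d * Zd d)%type.

Lemma qsum_fin k : qsum S k \is a fin_num.
Proof.
have := pqd_sum HS k.
have : (0 <= qsum S k)%E.
  by apply: esum_ge0 => -[l m] _; rewrite lee_fin; case/andP: (q_itv HS k l m).
by case: (qsum S k).
Qed.

Lemma qtotE k : (qtot S k)%:E = qsum S k.
Proof. by rewrite /qtot fineK// qsum_fin. Qed.

Lemma q_ge0 k l m : 0 <= q_ S k l m.
Proof. by case/andP: (q_itv HS k l m). Qed.

Lemma qtot_ge0 k : 0 <= qtot S k.
Proof.
rewrite -lee_fin qtotE; apply: esum_ge0 => -[l m] _.
by rewrite lee_fin q_ge0.
Qed.

Lemma pqd1 k : p_ S k + qtot S k + d_ S k = 1.
Proof. by have := pqd_sum HS k; rewrite -qtotE => -[]. Qed.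

Lemma p_ge0 k : 0 <= p_ S k. Proof. by case/andP: (p_itv HS k). Qed.
Lemma d_ge0 k : 0 <= d_ S k. Proof. by case/andP: (d_itv HS k). Qed.

Lemma integral_q k :
  (\int[@counting Z2 R]_lm (q_ S k lm.1 lm.2)%:E = (qtot S k)%:E)%E.
Proof.
rewrite qtotE ge0_integral_counting// => -[l m].
by rewrite lee_fin q_ge0.
Qed.

Lemma q_le_qtot k l m : q_ S k l m <= qtot S k.
Proof.
rewrite -lee_fin qtotE -[leLHS](@esum_set1 _ _ (l, m) (fun lm => (q_ S k lm.1 lm.2)%:E)).
  apply: le_ereal_sup => _ [A [fA AS] <-]; exists A => //.
  by rewrite lee_fin q_ge0.
Qed.

Definition label_of (j : label + label + label * Zd d) : label :=
  match j with
  | inl (inl alpha) => alpha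
  | inl (inr alpha) => alpha
  | inr (alpha, _) => alpha
  end.

Definition sys (j : label + label + label * Zd d) : set (set Omega) :=
  match j with
  | inl (inl alpha) => sigma_of (E_ V alpha)
  | inl (inr alpha) => sigma_of (U_ V alpha)
  | inr (alpha, k) => sigma_of (Y_ V alpha k)
  end.

Let sigma_ofI d' (T : measurableType d') (X : Omega -> T) : setI_closed (sigma_of X).
Proof.
move=> _ _ [A mA <-] [B mB <-]; exists (A `&` B); first exact: measurableI.
by rewrite preimage_setI.
Qed.

Let sigma_ofT d' (T : measurableType d') (X : Omega -> T) : sigma_of X setT.
Proof. by exists setT. Qed.

Let sigma_of_meas d' (T : measurableType d') (X : {RV P >-> T}) :
  sigma_of X `<=` measurable.
Proof. by move=> _ [A mA <-]; exact: measurable_funPTI. Qed.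

Lemma sysI j : setI_closed (sys j).
Proof. case: j => [[alpha|alpha]|[alpha k]]; exact: sigma_ofI. Qed.

Lemma sysT j : sys j setT.
Proof. case: j => [[alpha|alpha]|[alpha k]]; exact: sigma_ofT. Qed.

Lemma sysm j : sys j `<=` measurable.
Proof. case: j => [[alpha|alpha]|[alpha k]]; exact: sigma_of_meas. Qed.

Lemma sys_indep : independent_systems P sys.
Proof. exact: EUY_indep HV. Qed.

Lemma measurable_sub d' (T : measurableType d') (X : Omega -> T) j D :
  sigma_of X = sys j -> D j -> measurable_fun setT (X : sub sys D -> T).
Proof.
move=> XF Dj _ A mA; rewrite setTI; apply: sub_gen_smallest; exists j => //.
by rewrite -XF; exists A.
Qed.

Lemma sub_comp D d' (T : measurableType d') (f : sub sys D -> T) :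
  measurable_fun setT f -> measurable_fun setT (f : Omega -> T).
Proof.
move=> mf _ A mA; rewrite setTI; apply: (sub_measurable sysm (D := D)).
by rewrite -[X in measurable X]setTI; exact: mf.
Qed.

Lemma sub_comp2 D d1 (T1 : measurableType d1) d' (T : measurableType d')
    (f : T1 * sub sys D -> T) :
  measurable_fun setT f -> measurable_fun setT (f : T1 * Omega -> T).
Proof.
move=> mf.
pose id' : T1 * Omega -> T1 * sub sys D := fun x => x.
have mid' : measurable_fun setT id'.
  have mi : measurable_fun setT (id : Omega -> sub sys D).
    by move=> _ A mA; rewrite setTI; exact: (sub_measurable sysm mA).
  apply/measurable_fun_pairP; split; first exact: measurable_fst.
  exact: (measurableT_comp mi measurable_snd).
exact: (measurableT_comp mf mid').
Qed.

(** The variables are grouped around a vertex: its clock, its [choices] (the variables [U] and [Y]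
    of the same label), and those of its proper descendants. The disjointness lemmas below license
    the successive conditionings on these groups. *)
Definition strictly_below (beta : label) : set (label + label + label * Zd d) :=
  [set j | exists i, prefix (rcons beta i) (label_of j)].

Definition at_or_below (beta : label) : set (label + label + label * Zd d) :=
  [set j | prefix beta (label_of j)].

Definition choices (beta : label) : set (label + label + label * Zd d) :=
  [set j | label_of j = beta /\ j <> inl (inl beta)].

Lemma choices_below beta : [disjoint choices beta & strictly_below beta].
Proof.
apply/disj_setPS => j /= [[jb _] [a]]; rewrite jb => /size_prefix.
by rewrite size_rcons ltnn.
Qed.

Lemma clock_rest beta :
  [disjoint [set inl (inl beta)] & choices beta `|` strictly_below beta].
Proof.
apply/disj_setPS => _ /= [-> [[_ //]|[a] /size_prefix]].
by rewrite size_rcons ltnn.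
Qed.

Lemma siblings_disjoint beta :
  [disjoint at_or_below (rcons beta i1) & at_or_below (rcons beta i2)].
Proof.
apply/disj_setPS => j /= [/prefixP[s1 E] /prefixP[s2]].
rewrite E => /(congr1 (nth i0 ^~ (size beta))).
by rewrite !cat_rcons !nth_cat ltnn subnn.
Qed.

Lemma below_rcons beta i : at_or_below (rcons beta i) `<=` strictly_below beta.
Proof. by move=> j Hj; exists i. Qed.

Section fixed_time.
Variables (beta : label) (k : Zd d).

Definition flips w := U_ V beta w \in `[0, p_ S k].
Definition splits w := U_ V beta w \in `[1 - qtot S k, 1].

Let mU D : D (inl (inr beta)) ->
  measurable_fun setT (U_ V beta : sub sys D -> R).
Proof. exact: measurable_sub. Qed.

Let mY D : D (inr (beta, k)) ->
  measurable_fun setT (Y_ V beta k : sub sys D -> Z2).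
Proof. exact: measurable_sub. Qed.

Lemma measurable_mem_itv d' (T : measurableType d') (u : T -> R) (I : interval R) :
  measurable_fun setT u -> measurable_fun setT (fun w => u w \in I).
Proof.
move=> mu'; apply: (measurable_fun_bool true).
rewrite (_ : _ @^-1` _ = u @^-1` [set` I]); last first.
  by apply/seteqP; split => w.
by apply: mu' => //; exact: measurable_itv.
Qed.

Let UE (A : set R) : measurable A ->
  P (U_ V beta @^-1` A) = uniform_prob (@ltr01 R) A.
Proof. by move=> mA; rewrite -(U_law HV beta mA). Qed.

Let pq1 : p_ S k + qtot S k <= 1.
Proof. by rewrite -(pqd1 k) lerDl d_ge0. Qed.

Lemma prob_flip : P [set w | flips w && ~~ splits w] = (p_ S k)%:E.
Proof.
rewrite -(uniform_flip (p_ge0 k) (qtot_ge0 k) pq1) -UE; last exact: measurableD.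
congr (P _); apply/seteqP; split => w /=.
  by move=> /andP[? /negP].
by move=> [? ?]; apply/andP; split => //; apply/negP.
Qed.

Lemma prob_branch : P [set w | ~~ flips w && splits w] = (qtot S k)%:E.
Proof.
rewrite -(uniform_branch (p_ge0 k) (qtot_ge0 k) pq1) -UE; last exact: measurableD.
congr (P _); apply/seteqP; split => w /=.
  by move=> /andP[/negP].
by move=> [? ?]; apply/andP; split => //; apply/negP.
Qed.

Lemma prob_death : P [set w | ~~ flips w && ~~ splits w] = (d_ S k)%:E.
Proof.
have -> : d_ S k = 1 - p_ S k - qtot S k by rewrite -(pqd1 k); ring.
rewrite -(uniform_death (p_ge0 k) (qtot_ge0 k) pq1) -UE; last first.
  by apply: measurableC; exact: measurableU.
congr (P _); apply/seteqP; split => w /=.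
  by move=> /andP[/negP ? /negP ?] [].
by move=> /not_orP[? ?]; apply/andP; split => //; apply/negP.
Qed.

Lemma measurable_flips D : D (inl (inr beta)) ->
  measurable_fun setT (flips : sub sys D -> bool).
Proof. by move=> /mU; exact: measurable_mem_itv. Qed.

Lemma measurable_splits D : D (inl (inr beta)) ->
  measurable_fun setT (splits : sub sys D -> bool).
Proof. by move=> /mU; exact: measurable_mem_itv. Qed.

Lemma measurable_Y D : D (inr (beta, k)) ->
  measurable_fun setT (Y_ V beta k : sub sys D -> Z2).
Proof. exact: mY. Qed.

Let P01 (b : Omega -> bool) : measurable_fun setT b ->
  (\int[P]_w (b w)%:R%:E = P [set w | b w])%E.
Proof.
move=> mb; have mA : measurable [set w | b w].
  by rewrite -[X in measurable X]setTI; exact: (mb measurableT [set true]).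
rewrite -[in RHS](setIT [set w | b w]) -integral_indic//; apply: eq_integral => w _.
rewrite indicE; congr ((nat_of_bool _)%:R%:E).
by apply/idP/idP => [bw|/set_mem//]; exact: mem_set.
Qed.

Let mEFinb d' (T : measurableType d') (b : T -> bool) : measurable_fun setT b ->
  measurable_fun setT (fun w => (b w)%:R%:E : \bar R).
Proof.
move=> mb; apply/measurable_EFinP.
rewrite (_ : (fun _ => _) = fun w => if b w then 1 else 0 : R).
  exact: measurable_fun_ifT.
by apply/funext => w; case: (b w).
Qed.

Lemma prob_branch_to l m :
  P [set w | ~~ flips w && splits w && (Y_ V beta k w == (l, m))] = (q_ S k l m)%:E.
Proof.
pose A := [set w | ~~ flips w && splits w].
pose B := Y_ V beta k @^-1` [set (l, m)].
have -> : [set w | ~~ flips w && splits w && (Y_ V beta k w == (l, m))] = A `&` B.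
  by apply/seteqP; split => w /=; [move=> /andP[? /eqP]|move=> [? ?]; apply/andP; split => //; apply/eqP].
pose D1 : set (label + label + label * Zd d) := [set inl (inr beta)].
pose D2 : set (label + label + label * Zd d) := [set inr (beta, k)].
have D12 : [disjoint D1 & D2] by apply/disj_setPS => j /= [->].
rewrite (indep_sub sysI sysT sysm sys_indep D12); last 2 first.
- have mb : measurable_fun setT ((fun w => ~~ flips w && splits w) : sub sys D1 -> bool).
    apply: measurable_and; last exact: measurable_splits.
    by apply: measurable_neg; exact: measurable_flips.
  by rewrite -[X in measurable X]setTI; exact: (mb measurableT [set true]).
- have mYs : measurable_fun setT (Y_ V beta k : sub sys D2 -> Z2).
    exact: mY.
  by rewrite -[X in measurable X]setTI; apply: mYs => //; exact: Z2_measurable.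
rewrite prob_branch.
(* When q_k = 0 the law of [Y] is unspecified, but both sides are then 0, because q_{k,l,m} is at
   most q_k. *)
have [q0|q0] := eqVneq (qtot S k) 0.
  rewrite q0 mul0e; congr (_%:E); apply/esym/eqP; rewrite eq_le q_ge0 andbT -q0.
  exact: q_le_qtot.
have qp : 0 < qtot S k by rewrite lt_neqAle eq_sym q0; exact: qtot_ge0.
rewrite [P B](Y_law HV beta l m qp) -EFinM mulrC divfK//.
Qed.

Local Open Scope ereal_scope.

Let D := strictly_below beta.

(** The random pair is resolved by summing the indicators of [Y = lm] over all pairs. Tonelli moves
    the sum outside, and for a fixed pair the event depends on the choices only while [G lm] depends
    on the descendants only. *)
Lemma ge0_integral_branch (G : Z2 -> sub sys D -> \bar R) :
  (forall lm, measurable_fun setT (G lm)) -> (forall lm w, 0 <= G lm w) ->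
  \int[P]_w ((~~ flips w && splits w)%:R%:E * G (Y_ V beta k w) w) =
  \int[@counting Z2 R]_lm ((q_ S k lm.1 lm.2)%:E * \int[P]_w G lm w).
Proof.
move=> mG G0.
have mG' lm : measurable_fun setT (G lm : Omega -> _) by exact: sub_comp (mG lm).
have mb lm D' : choices beta `<=` D' -> measurable_fun setT
    ((fun w => (~~ flips w && splits w && (Y_ V beta k w == lm))%:R%:E) : sub sys D' -> \bar R).
  move=> D'c; apply: mEFinb; apply: measurable_and; first apply: measurable_and.
  - by apply: measurable_neg; apply: measurable_flips; exact: D'c.
  - by apply: measurable_splits; exact: D'c.
  - apply: (measurable_fun_bool true).
    rewrite (_ : _ @^-1` _ = Y_ V beta k @^-1` [set lm]); last first.
      by apply/seteqP; split => w /= /eqP.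
    by apply: mY => //; [exact: D'c|exact: Z2_measurable].
pose h (x : Z2 * Omega) : \bar R :=
  (~~ flips x.2 && splits x.2 && (Y_ V beta k x.2 == x.1))%:R%:E * G x.1 x.2.
have mh : measurable_fun setT h.
  apply: measurable_fun_slices; [exact: Z2_measurable|exact: Z2_countable|].
  move=> lm; apply: emeasurable_funM; last exact: mG'.
  exact: (sub_comp (mb lm _ (@subset_refl _ (choices beta)))).
have h0 x : 0 <= h x by rewrite mule_ge0// lee_fin.
transitivity (\int[P]_w \int[@counting Z2 R]_lm h (lm, w)).
  apply: eq_integral => w _; rewrite /h/=.
  rewrite -(integral_counting_set1 (Y_ V beta k w)
    (f := fun lm => (~~ flips w && splits w)%:R%:E * G lm w)); last first.
    by move=> lm; rewrite mule_ge0// lee_fin.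
  apply: eq_integral => lm _; rewrite eq_sym; case: eqP => _; rewrite ?andbT//.
  by rewrite andbF mul0e.
rewrite -[LHS](@fubini_tonelli _ _ Z2 Omega R (@counting2 d R) P h mh h0).
apply: eq_integral => -[l m] _; rewrite /fubini_F /h/=.
rewrite (ge0_indep_integralM sysI sysT sysm sys_indep (choices_below beta)
  (X := fun w => (~~ flips w && splits w && (Y_ V beta k w == (l, m)))%:R%:E)
  (Y := G (l, m)))//; last exact: mb.
congr (_ * _); rewrite -prob_branch_to P01//.
apply: (@sub_comp (choices beta)); apply: measurable_and; first apply: measurable_and.
- by apply: measurable_neg; exact: measurable_flips.
- exact: measurable_splits.
- apply: (measurable_fun_bool true).
  rewrite (_ : _ @^-1` _ = Y_ V beta k @^-1` [set (l, m)]); last first.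
    by apply/seteqP; split => w /= /eqP.
  by apply: mY => //; exact: Z2_measurable.
Qed.

(** The integrand splits over the flip, branch and death events; on the null event where [U] hits
    both closed intervals it is 0 by convention. *)
Lemma ge0_integral_event (X : sub sys D -> \bar R) (G : Z2 -> sub sys D -> \bar R)
    (c : \bar R) :
  measurable_fun setT X -> (forall w, 0 <= X w) ->
  (forall lm, measurable_fun setT (G lm)) -> (forall lm w, 0 <= G lm w) -> 0 <= c ->
  \int[P]_w (if flips w then (if splits w then 0 else X w)
             else if splits w then G (Y_ V beta k w) w else c) =
  (p_ S k)%:E * \int[P]_w X w +
  \int[@counting Z2 R]_lm ((q_ S k lm.1 lm.2)%:E * \int[P]_w G lm w) +
  (d_ S k)%:E * c.
Proof.
move=> mX X0 mG G0 c0.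
have mX' : measurable_fun setT (X : Omega -> _) by exact: sub_comp mX.
have mG' lm : measurable_fun setT (G lm : Omega -> _) by exact: sub_comp (mG lm).
have mf : measurable_fun setT (flips : sub sys (choices beta) -> bool).
  exact: measurable_flips.
have ms : measurable_fun setT (splits : sub sys (choices beta) -> bool).
  exact: measurable_splits.
have mf' : measurable_fun setT flips := sub_comp mf.
have ms' : measurable_fun setT splits := sub_comp ms.
transitivity (\int[P]_w ((flips w && ~~ splits w)%:R%:E * X w +
    (~~ flips w && splits w)%:R%:E * G (Y_ V beta k w) w +
    (~~ flips w && ~~ splits w)%:R%:E * c)).
  apply: eq_integral => w _.
  by case: (flips w); case: (splits w); rewrite /= ?mul0e ?mul1e ?add0e ?adde0.
have mnn : measurable_fun setT (fun w => ~~ flips w && ~~ splits w).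
  by apply: measurable_and; exact: measurable_neg.
have mn : measurable_fun setT (fun w => ~~ flips w && splits w).
  by apply: measurable_and => //; exact: measurable_neg.
have mfn : measurable_fun setT (fun w => flips w && ~~ splits w).
  by apply: measurable_and => //; exact: measurable_neg.
have mGY : measurable_fun setT (fun w => G (Y_ V beta k w) w).
  apply: (measurable_fun_select _ _ (f := Y_ V beta k) (g := fun lm w => G lm w)) => //.
  - exact: Z2_measurable.
  - exact: Z2_countable.
rewrite ge0_integralD//; last 4 first.
- by move=> w _; rewrite adde_ge0// mule_ge0// lee_fin.
- by apply: emeasurable_funD; apply: emeasurable_funM => //; exact: mEFinb.
- by move=> w _; rewrite mule_ge0// lee_fin.
- by apply: emeasurable_funM => //; exact: mEFinb.
rewrite ge0_integralD//; last 4 first.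
- by move=> w _; rewrite mule_ge0// lee_fin.
- by apply: emeasurable_funM => //; exact: mEFinb.
- by move=> w _; rewrite mule_ge0// lee_fin.
- by apply: emeasurable_funM => //; exact: mEFinb.
congr (_ + _ + _).
- rewrite (ge0_indep_integralM sysI sysT sysm sys_indep (choices_below beta)
    (X := fun w => (flips w && ~~ splits w)%:R%:E) (Y := X))//; last first.
    by apply: mEFinb; apply: measurable_and => //; exact: measurable_neg.
  by rewrite P01// prob_flip.
- exact: ge0_integral_branch.
- rewrite ge0_integralZr//; last exact: mEFinb.
  by rewrite P01// prob_death.
Qed.

End fixed_time.
End driving.

Section node.
Context (R : realType) (d r : nat) (S : params R d r) (HS : standing S).
Context (disp : measure_display) (Omega : measurableType disp)
  (P : probability Omega R) (V : driving d P) (HV : is_driving S V).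

Local Notation Z2 := (Zd d * Zd d)%type.
Local Notation mu := (@lebesgue_measure R).
Local Notation sys := (sys V).
Local Notation rate := (lam_ S).

Definition clock (beta : label) (k : Zd d) (w : Omega) : R :=
  (rate k)^-1 * E_ V beta w.

Lemma clock_ge0 beta k w : 0 <= clock beta k w.
Proof. by rewrite mulr_ge0 ?invr_ge0 ?(ltW (lam_gt0 HS k))// (E_ge0 HV). Qed.

Lemma measurable_clock beta k D : D (inl (inl beta)) ->
  measurable_fun setT (clock beta k : sub sys D -> R).
Proof.
move=> Db; apply: measurable_funM => //.
exact: measurable_sub Db.
Qed.

Lemma measurable_sub_id D D' : D' `<=` D ->
  measurable_fun setT (id : sub sys D -> sub sys D').
Proof. by move=> DD _ A mA; rewrite setTI; exact: subS DD _ mA. Qed.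

Local Open Scope ereal_scope.

Lemma measurable_integral_slice d1 (T1 : measurableType d1) D (X : T1 * sub sys D -> \bar R) :
  measurable_fun setT X -> (forall x, 0 <= X x) ->
  measurable_fun setT (fun s => \int[P]_w X (s, w)).
Proof.
move=> mX X0; apply: (@measurable_fun_fubini_tonelli_F _ _ T1 Omega R P X) => //.
exact: sub_comp2 mX.
Qed.

Lemma measurable_integral_counting (f : Z2 -> R -> \bar R) :
  (forall lm, measurable_fun setT (f lm)) -> (forall lm s, 0 <= f lm s) ->
  measurable_fun setT (fun s => \int[@counting Z2 R]_lm f lm s).
Proof.
move=> mf f0.
apply: (@measurable_fun_fubini_tonelli_G _ _ Z2 (measurableTypeR R) R
  (@counting2 d R) (fun x => f x.1 x.2)) => //.
apply: measurable_fun_slices => //; [exact: Z2_measurable|exact: Z2_countable].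
Qed.

Section one_step.
Variables (beta : label) (k : Zd d).
Let D : set (label + label + label * Zd d) := strictly_below beta.
Variables (a : \bar R) (X : R * sub sys D -> \bar R)
  (G : Z2 -> R * sub sys D -> \bar R) (g : R -> \bar R).
Hypotheses (a0 : 0 <= a) (X0 : forall x, 0 <= X x) (G0 : forall lm x, 0 <= G lm x)
  (g0 : forall s, 0 <= g s).
Hypotheses (mX : measurable_fun setT X) (mG : forall lm, measurable_fun setT (G lm))
  (mg : measurable_fun setT g).

Definition node_mean (s : R) : \bar R :=
  (p_ S k)%:E * \int[P]_w X (s, w) +
  \int[@counting Z2 R]_lm ((q_ S k lm.1 lm.2)%:E * \int[P]_w G lm (s, w)) +
  (d_ S k)%:E * g s.

Lemma measurable_node_mean : measurable_fun setT node_mean.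
Proof.
apply: emeasurable_funD; last exact: measurable_funeM.
apply: emeasurable_funD.
  by apply: measurable_funeM; exact: measurable_integral_slice.
apply: measurable_integral_counting.
  by move=> lm; apply: measurable_funeM; exact: measurable_integral_slice.
by move=> lm s; rewrite mule_ge0 ?lee_fin ?q_ge0//; exact: integral_ge0.
Qed.

Lemma node_mean_ge0 s : 0 <= node_mean s.
Proof.
apply: adde_ge0; first apply: adde_ge0.
- by rewrite mule_ge0 ?lee_fin ?p_ge0//; exact: integral_ge0.
- apply: integral_ge0 => lm _.
  by rewrite mule_ge0 ?lee_fin ?q_ge0//; exact: integral_ge0.
- by rewrite mule_ge0 ?lee_fin ?d_ge0.
Qed.

Definition node_value (t : R) (w : Omega) : \bar R :=
  if (t <= clock beta k w)%R then a else
  let s := (t - clock beta k w)%R in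
  if flips S V beta k w then (if splits S V beta k w then 0 else X (s, w))
  else if splits S V beta k w then G (Y_ V beta k w) (s, w) else g s.

(** Conditioning in two stages: once the clock is decoupled from all the rest, the remaining time is
    frozen and [ge0_integral_event] applies; the clock is then integrated with its exponential
    law. *)
Lemma ge0_integral_node t : (0 <= t)%R ->
  \int[P]_w node_value t w = a * (expR (- rate k * t))%:E +
  \int[mu]_(s in `[0%R, t])
    ((rate k * expR (- rate k * (t - s)))%:E * node_mean s).
Proof.
move=> t0.
pose D1 : set (label + label + label * Zd d) := [set inl (inl beta)].
pose D2 := choices beta `|` D.
pose T1 : measurableType _ := sub sys D1.
pose T2 : measurableType _ := sub sys D2.
have mc : measurable_fun setT (fun x : T1 * T2 => clock beta k x.1).
  have m1 : measurable_fun setT (clock beta k : T1 -> R) by exact: measurable_clock.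
  exact: (measurableT_comp m1 measurable_fst).
have mft : measurable_fun setT (fun x : T1 * T2 => flips S V beta k x.2).
  have m2 : measurable_fun setT (flips S V beta k : T2 -> bool) by apply: measurable_flips; left.
  exact: (measurableT_comp m2 measurable_snd).
have mst : measurable_fun setT (fun x : T1 * T2 => splits S V beta k x.2).
  have m2 : measurable_fun setT (splits S V beta k : T2 -> bool) by apply: measurable_splits; left.
  exact: (measurableT_comp m2 measurable_snd).
have mYt : measurable_fun setT (fun x : T1 * T2 => Y_ V beta k x.2).
  have m2 : measurable_fun setT (Y_ V beta k : T2 -> Z2) by apply: measurable_Y; left.
  exact: (measurableT_comp m2 measurable_snd).
have msub : measurable_fun setT (fun x : T1 * T2 => (t - clock beta k x.1)%R).
  exact: measurable_funB.
have mpair : measurable_fun setT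
    (fun x : T1 * T2 => ((t - clock beta k x.1)%R, x.2 : sub sys D)).
  apply/measurable_fun_pairP; split => //.
  have m2 : measurable_fun setT (id : T2 -> sub sys D).
    by apply: measurable_sub_id => j Dj; right.
  exact: (measurableT_comp m2 measurable_snd).
(* [node_value] as a function of two samples: the first is read for the clock only, the second for
   the choices and the descendants. *)
pose Q (x : T1 * T2) : \bar R :=
  if (t <= clock beta k x.1)%R then a else
  if flips S V beta k x.2 then
    (if splits S V beta k x.2 then 0 else X ((t - clock beta k x.1)%R, x.2))
  else if splits S V beta k x.2 then
    G (Y_ V beta k x.2) ((t - clock beta k x.1)%R, x.2)
  else g (t - clock beta k x.1)%R.
have mQ : measurable_fun setT Q.
  apply: measurable_fun_ifT => //; first exact: measurable_fun_ler.
  apply: measurable_fun_ifT => //; apply: measurable_fun_ifT => //.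
  - exact: (measurableT_comp mX mpair).
  - apply: (measurable_fun_select _ _ (f := fun x : T1 * T2 => Y_ V beta k x.2)
      (g := fun lm x => G lm ((t - clock beta k x.1)%R, x.2))) => //.
    + exact: Z2_measurable.
    + exact: Z2_countable.
    + by move=> lm; exact: (measurableT_comp (mG lm) mpair).
  - exact: (measurableT_comp mg msub).
have Q0 x : 0 <= Q x by rewrite /Q; do 4 ?[case: ifP => //].
transitivity (\int[P]_w Q (w, w)); first by apply: eq_integral.
rewrite (ge0_decouple (@sysI _ _ _ _ _ V) (@sysT _ _ _ _ _ V) (@sysm _ _ _ _ _ V)
  (sys_indep HV) (@clock_rest d beta) mQ Q0).
transitivity (\int[P]_w (if (t <= clock beta k w)%R then a
    else node_mean (t - clock beta k w)%R)).
  apply: eq_integral => w1 _; rewrite /Q/=; case: ifP => _.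
    by rewrite integral_cst//= probability_setT mule1.
  rewrite (ge0_integral_event HS HV k
    (X := fun w => X ((t - clock beta k w1)%R, w))
    (G := fun lm w => G lm ((t - clock beta k w1)%R, w)))//.
  - exact: measurableT_comp.
  - by move=> lm; exact: measurableT_comp.
pose h (x : R) : \bar R := if (t <= (rate k)^-1 * x)%R then a
    else node_mean (t - (rate k)^-1 * x)%R.
have mh : measurable_fun setT h.
  have mr : measurable_fun setT (fun x : R => (rate k)^-1 * x)%R by exact: measurable_funM.
  apply: measurable_fun_ifT => //; first exact: measurable_fun_ler.
  by apply: (measurableT_comp measurable_node_mean); exact: measurable_funB.
have h0 x : 0 <= h x by rewrite /h; case: ifP => // _; exact: node_mean_ge0.
transitivity (\int[exponential_prob (1 : R)]_x h x).
  pose e : Omega -> measurableTypeR R := E_ V beta.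
  have me : measurable_fun setT e by exact: measurable_funPT (E_ V beta).
  pose rho : {measure set (measurableTypeR R) -> \bar R} := pushforward P e.
  pose nu : {measure set (measurableTypeR R) -> \bar R} := exponential_prob (1 : R).
  transitivity (\int[rho me]_x h x).
    by rewrite ge0_integral_pushforward.
  exact: (@eq_measure_integral _ (measurableTypeR R) R setT (nu (@ltr01 R)) (rho me) h
    (fun A mA _ => E_law HV beta mA)).
apply: integral_exponential_split => //.
- exact: (lam_gt0 HS).
- exact: measurable_node_mean.
- exact: node_mean_ge0.
Qed.

End one_step.
End node.

(** * The contraction rate *)

Section contraction.
Context (R : realType) (d : nat).

Lemma coord_le_znorm (k : Zd d) (i : 'I_d) :
  `|((k : 'rV[int]_d) ord0 i)%:~R| <= znorm R k.
Proof.
rewrite /znorm -sqrtr_sqr ler_wsqrtr// (bigD1 i)//= lerDl.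
by apply: sumr_ge0 => ? _; exact: sqr_ge0.
Qed.

(** The ball sits in a box of integer vectors, which [dec] parametrizes by a finite type after a
    shift of every coordinate by [N]. *)
Lemma finite_ball (M : R) : finite_set [set k : Zd d | znorm R k < M].
Proof.
pose N := Num.trunc `|M|.
pose dec (f : {ffun 'I_d -> 'I_(N.+1 + N.+1)}) : Zd d :=
  \row_i ((f i)%:Z - N%:Z).
apply: (sub_finite_set (B := range dec)); last exact: finite_image.
move=> k kM.
have bound i : (`|(k : 'rV[int]_d) ord0 i| <= N%:Z)%R.
  have : `|((k : 'rV[int]_d) ord0 i)%:~R : R| < N.+1%:R.
    apply: le_lt_trans (coord_le_znorm k i) _; apply: lt_trans kM _.
    by apply: le_lt_trans (ler_norm _) _; exact: truncnS_gt.
  by rewrite -intr_norm -[N.+1%:R]/((N.+1%:Z)%:~R) ltr_int; lia.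
have lt i : (`|((k : 'rV[int]_d) ord0 i + N%:Z)%R|%N < N.+1 + N.+1)%N.
  have := bound i; move: ((k : 'rV[int]_d) ord0 i) => z; clear; clearbody N; lia.
exists [ffun i => Ordinal (lt i)] => //.
apply/rowP => i; rewrite mxE ffunE/=.
have := bound i; move: ((k : 'rV[int]_d) ord0 i) => z; clear; clearbody N; lia.
Qed.

Lemma finite_upper_bound (T : choiceType) (A : set T) (f : T -> R) : finite_set A ->
  exists2 L, 1 <= L & forall x, A x -> f x <= L.
Proof.
move=> /finite_seqP[s ->]; elim: s => [|y s [L L1 HL]]; first by exists 1.
exists (Num.max L (f y)); first by rewrite le_max L1.
by move=> x /=; rewrite inE le_max => /predU1P[->|/HL ->//]; rewrite lexx orbT.
Qed.

(* Far from the origin b is small whatever mu is; the finitely many remaining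
   positions have bounded rates, which a large mu dominates. *)
Lemma contraction_rate (rate b : Zd d -> R) (C : R) :
  (forall k, 0 < rate k) -> (forall k, 0 <= b k <= C) -> vanishes_at_infinity b ->
  exists2 m, 0 <= m & forall k, rate k / (rate k + m) * b k <= 2^-1.
Proof.
move=> rate0 bC /(_ 2^-1)[|M HM]; first by rewrite invr_gt0.
have [L L1 HL] := finite_upper_bound rate (finite_ball M).
pose C1 := Num.max C 1.
have C11 : 1 <= C1 by rewrite le_max lexx orbT.
have C10 : 0 < C1 by exact: lt_le_trans C11.
have L0 : 0 < L by exact: lt_le_trans L1.
(* Inside the ball the product of rate and [b] is at most [L * C1], which is half of this m; outside
   the ball [b] alone is at most 1/2. *)
exists (2 * C1 * L) => [|k]; first by rewrite !mulr_ge0// ltW.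
have m0 : 0 < 2 * C1 * L by rewrite !mulr_gt0.
have /andP[b0 bC1] := bC k.
have s0 : 0 < rate k + 2 * C1 * L by rewrite addr_gt0.
have [Mk|kM] := leP M (znorm R k).
  apply: (@le_trans _ _ (b k)); last by rewrite (le_trans (ler_norm _))// HM.
  by rewrite ler_piMl// ler_pdivrMr// mul1r lerDl ltW.
rewrite mulrAC ler_pdivrMr//.
apply: (@le_trans _ _ (L * C1)).
  by apply: ler_pM => //; [exact: ltW|exact: HL|rewrite le_max bC1].
rewrite mulrDr -[leLHS]add0r; apply: lerD.
  by rewrite mulr_ge0 ?invr_ge0// ltW.
have -> : 2^-1 * (2 * C1 * L) = C1 * L by field.
by rewrite mulrC.
Qed.

Lemma vanishes_at_infinityD (f g : Zd d -> R) (a b : R) :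
  vanishes_at_infinity f -> vanishes_at_infinity g ->
  vanishes_at_infinity (fun k => a * f k + b * g k).
Proof.
move=> vf vg e e0.
pose N (a : R) := 2 * (`|a| + 1).
have N0 x : 0 < N x by rewrite mulr_gt0// ltr_wpDl.
have [Mf Hf] := vf (e / N a) (divr_gt0 e0 (N0 a)).
have [Mg Hg] := vg (e / N b) (divr_gt0 e0 (N0 b)).
have half x y : `|y| <= e / N x -> `|x * y| <= e / 2.
  move=> h; rewrite normrM.
  apply: (@le_trans _ _ (`|x| * (e / N x))); first exact: ler_wpM2l.
  rewrite mulrA ler_pdivrMr//.
  have -> : e / 2 * N x = e * `|x| + e by rewrite /N; field.
  by rewrite mulrC lerDl ltW.
exists (Num.max Mf Mg) => k; rewrite ge_max => /andP[fk gk].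
apply: le_trans (ler_normD _ _) _.
by rewrite [e]splitr lerD// half ?Hf ?Hg.
Qed.

End contraction.

Local Open Scope complex_scope.

(** * Coordinates of complex vectors *)

Section coordinates.
Context (R : realType) (r : nat).
Implicit Types x y : Cvec R r.

Definition coord_ix := ('I_r * bool)%type.
Implicit Types c : coord_ix.

Definition co c x : R :=
  if c.2 then complex.Im (x ord0 c.1) else complex.Re (x ord0 c.1).

Definition cvec c : Cvec R r :=
  \row_j (if j == c.1 then (if c.2 then 0 +i* 1 else 1 +i* 0) else 0).

(** The l^1 norm of the 2r real coordinates. It is tied to coordinatewise bounds more directly than
    the Euclidean norm, and passing between them costs the factor [dimR] = 2r. *)
Definition norm1 x : R := \sum_c `|co c x|.

Lemma co_ext x y : (forall c, co c x = co c y) -> x = y.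
Proof.
move=> h; apply/rowP => j; apply/eqP; rewrite eq_complex.
by have /= := h (j, false); have /= := h (j, true); rewrite /co/= => -> ->; rewrite !eqxx.
Qed.

Lemma coD c x y : co c (x + y) = co c x + co c y.
Proof. by rewrite /co mxE; case: ifP => _; rewrite raddfD. Qed.

Lemma coZ c (a : R) x : co c (a%:C *: x) = a * co c x.
Proof.
rewrite /co mxE; case: (x ord0 c.1) => u v /=.
by case: ifP => _; rewrite mul0r ?addr0 ?subr0.
Qed.

Lemma co0 c : co c 0 = 0.
Proof. by rewrite /co mxE; case: ifP. Qed.

Lemma coB c x y : co c (x - y) = co c x - co c y.
Proof.
by rewrite coD; congr (_ + _); rewrite /co mxE; case: ifP => _; rewrite raddfN.
Qed.

Lemma co_sum c (I : Type) (s : seq I) (F : I -> Cvec R r) :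
  co c (\sum_(i <- s) F i) = \sum_(i <- s) co c (F i).
Proof. exact: (big_morph (co c) (coD c) (co0 c)). Qed.

Lemma cvec_sum x : x = \sum_c (co c x)%:C *: cvec c.
Proof.
apply: co_ext => c; rewrite co_sum (bigD1 c)//= big1 ?addr0.
  rewrite coZ [co c (cvec c)](_ : _ = 1) ?mulr1//.
  by rewrite /co /cvec mxE eqxx; case: (c.2).
move=> c' cc'; rewrite coZ [co c (cvec c')](_ : _ = 0) ?mulr0//.
rewrite /co /cvec mxE; case: eqP => [E|_]; last by case: ifP.
have : c.2 != c'.2 by apply: contra cc' => /eqP E2; case: (c) (c') E E2 => ? ? [? ?] /= -> ->.
by case: (c.2); case: (c'.2).
Qed.

Lemma sum_coord (F : coord_ix -> R) :
  \sum_c F c = \sum_(j < r) (F (j, false) + F (j, true)).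
Proof.
transitivity (\sum_(j < r) \sum_(b : bool) F (j, b)).
  by rewrite pair_bigA; apply: eq_bigr => -[].
by apply: eq_bigr => j _; rewrite big_bool addrC.
Qed.

Lemma vnorm_sum x : vnorm x = Num.sqrt (\sum_c co c x ^+ 2).
Proof. by rewrite /vnorm sum_coord. Qed.

Lemma vnorm_ge0 x : 0 <= vnorm x. Proof. exact: sqrtr_ge0. Qed.

Lemma norm1_ge0 x : 0 <= norm1 x. Proof. by apply: sumr_ge0. Qed.

Lemma norm10 : norm1 0 = 0.
Proof. by apply: big1 => c _; rewrite co0 normr0. Qed.

Lemma norm1Z (a : R) x : norm1 (a%:C *: x) = `|a| * norm1 x.
Proof. by rewrite mulr_sumr; apply: eq_bigr => c _; rewrite coZ normrM. Qed.

Lemma norm1B x y : norm1 (x - y) <= norm1 x + norm1 y.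
Proof. by rewrite -big_split; apply: ler_sum => c _; rewrite coB ler_normB. Qed.

Lemma co_le_norm1 c x : `|co c x| <= norm1 x.
Proof. by rewrite /norm1 (bigD1 c)//= lerDl sumr_ge0. Qed.

Lemma co_le_vnorm c x : `|co c x| <= vnorm x.
Proof.
rewrite vnorm_sum -sqrtr_sqr ler_wsqrtr// (bigD1 c)//= lerDl.
by apply: sumr_ge0 => ? _; exact: sqr_ge0.
Qed.

Lemma vnorm_le_norm1 x : vnorm x <= norm1 x.
Proof.
rewrite vnorm_sum -[leRHS]ger0_norm ?norm1_ge0// -sqrtr_sqr ler_wsqrtr//.
rewrite /norm1; elim: (index_enum _) => [|c s IH]; first by rewrite !big_nil expr0n.
rewrite !big_cons sqrrD -real_normK ?num_real// -addrA lerD2l.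
apply: (le_trans IH); rewrite lerDr mulrn_wge0// mulr_ge0//.
by apply: sumr_ge0.
Qed.

Definition dimR : R := #|{: coord_ix}|%:R.

Lemma dimR_ge0 : 0 <= dimR. Proof. exact: ler0n. Qed.

Lemma sum_le_dimR (F : coord_ix -> R) (M : R) : (forall c, F c <= M) ->
  \sum_c F c <= dimR * M.
Proof.
move=> FM; apply: (@le_trans _ _ (\sum_(c : coord_ix) M)); first exact: ler_sum.
by rewrite sumr_const -mulr_natl.
Qed.

Lemma norm1_le_vnorm x : norm1 x <= dimR * vnorm x.
Proof. by apply: sum_le_dimR => c; exact: co_le_vnorm. Qed.

Section bilinear.
Variable B : {bilinear Cvec R r -> Cvec R r -> Cvec R r}.
Hypothesis B1 : forall x y, vnorm (B x y) <= vnorm x * vnorm y.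

Definition struct_const a b c : R := co c (B (cvec a) (cvec b)).

(** In real coordinates a bilinear map is a finite combination of products, so that measurability,
    expectation and convergence of [B x y] reduce to those of products of coordinates. *)
Lemma co_bilinear c x y :
  co c (B x y) = \sum_a \sum_b struct_const a b c * (co a x * co b y).
Proof.
rewrite {1}(cvec_sum x) linear_sumlz co_sum; apply: eq_bigr => a _.
rewrite {1}(cvec_sum y) linear_sumr co_sum; apply: eq_bigr => b _.
by rewrite linearZl_LR linearZr_LR !coZ mulrA mulrC mulrA.
Qed.

Lemma norm1_bilinear x y : norm1 (B x y) <= dimR * (norm1 x * norm1 y).
Proof.
apply: sum_le_dimR => c; apply: (le_trans (co_le_vnorm _ _)).
apply: (le_trans (B1 _ _)).
by apply: ler_pM; rewrite ?vnorm_ge0 ?vnorm_le_norm1.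
Qed.

End bilinear.

Section integration.
Context dd (X : measurableType dd) (mu : {measure set X -> \bar R}) (D : set X).
Implicit Types f : X -> Cvec R r.

Lemma co_vintegral c f : co c (vintegral mu D f) = Rintegral mu D (fun w => co c (f w)).
Proof. by rewrite /co /vintegral mxE; case: ifP. Qed.

Lemma vintegrableP f : vintegrable mu D f <->
  forall c, mu.-integrable D (fun w => (co c (f w))%:E).
Proof.
split => [h [j b]|h j]; first by have [hR hI] := h j; rewrite /co/=; case: b.
by split; [have := h (j, false)|have := h (j, true)].
Qed.

Lemma vmeasurableP f : vmeasurable D f <->
  forall c, measurable_fun D (fun w => co c (f w)).
Proof.
split => [h [j b]|h j]; first by have [hR hI] := h j; rewrite /co/=; case: b.
by split; [have := h (j, false)|have := h (j, true)].
Qed.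

End integration.

Lemma measurable_norm1 dd (X : measurableType dd) (D : set X) (f : X -> Cvec R r) :
  (forall c, measurable_fun D (fun w => co c (f w))) ->
  measurable_fun D (fun w => norm1 (f w)).
Proof.
move=> mf; apply: measurable_sum => c.
exact: measurableT_comp (mf c).
Qed.

End coordinates.

(** * Recursive evaluation of the tree *)

Section tree_link.
Context (R : realType) (d r : nat) (S : params R d r) (HS : standing S).
Context (disp : measure_display) (Omega : measurableType disp)
  (P : probability Omega R) (V : driving d P) (HV : is_driving S V).
Variables (chi0 : Zd d -> Cvec R r) (gamma gamma' : Zd d -> R -> Cvec R r) (T : R).
Hypothesis gammaE : forall k t, 0 <= t <= T -> gamma' k t = gamma k t.

Definition child (w : Omega) (beta : label) (k : Zd d) (i : 'I_3) : Zd d :=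
  if i == i0 then k
  else if i == i1 then (Y_ V beta k w).1 else (Y_ V beta k w).2.

Definition opens (w : Omega) (beta : label) (k : Zd d) (i : 'I_3) : bool :=
  if i == i0 then flips S V beta k w else splits S V beta k w.

Section at_sample.
Variable w : Omega.

(** Recursion on the first letter, carrying the absolute label [beta]: in this form a subtree is
    again an object of the same kind. The branching tree is defined by appending a last letter, and
    the [_rcons] lemmas reconcile the two descriptions. *)
Fixpoint place (beta : label) (k : Zd d) (alpha : label) : Zd d :=
  if alpha is i :: alpha' then place (rcons beta i) (child w beta k i) alpha' else k.

Fixpoint open_path (beta : label) (k : Zd d) (alpha : label) : bool :=
  if alpha is i :: alpha' then
    opens w beta k i && open_path (rcons beta i) (child w beta k i) alpha'
  else true.

Fixpoint birth (beta : label) (k : Zd d) (s : R) (alpha : label) : R :=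
  if alpha is i :: alpha' then
    birth (rcons beta i) (child w beta k i) (s + clock S V beta k w) alpha'
  else s.

(* The subtree of the branching tree rooted at the label beta and position k,
   with its times counted from the birth of beta. *)
Definition tree_at (beta : label) (k : Zd d) : tree R d := fun alpha =>
  Vertex (if open_path beta k alpha then Some (place beta k alpha) else None)
    (birth beta k 0 alpha)
    (birth beta k 0 alpha + clock S V (beta ++ alpha) (place beta k alpha) w).

Lemma place_rcons beta k alpha i :
  place beta k (rcons alpha i) = child w (beta ++ alpha) (place beta k alpha) i.
Proof.
elim: alpha beta k => [|j alpha IH] beta k /=; first by rewrite cats0.
by rewrite IH cat_rcons.
Qed.

Lemma open_path_rcons beta k alpha i :
  open_path beta k (rcons alpha i) =
  open_path beta k alpha && opens w (beta ++ alpha) (place beta k alpha) i.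
Proof.
elim: alpha beta k => [|j alpha IH] beta k /=; first by rewrite cats0 andbT.
by rewrite IH cat_rcons andbA.
Qed.

Lemma birth_rcons beta k s alpha i :
  birth beta k s (rcons alpha i) =
  birth beta k s alpha + clock S V (beta ++ alpha) (place beta k alpha) w.
Proof.
elim: alpha beta k s => [|j alpha IH] beta k s /=; first by rewrite cats0.
by rewrite IH cat_rcons.
Qed.

Lemma birth_shift beta k s alpha : birth beta k s alpha = s + birth beta k 0 alpha.
Proof.
elim: alpha beta k s => [|j alpha IH] beta k s /=; first by rewrite addr0.
by rewrite IH [in RHS]IH add0r addrA.
Qed.

Lemma Khat_place k alpha : Khat V k w alpha = place [::] k alpha.
Proof.
elim/last_ind: alpha => [//|alpha i IH].
by rewrite place_rcons -IH /Khat append_rec_rcons.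
Qed.

Lemma tau_birth k alpha : tau S V k w alpha =
  (birth [::] k 0 alpha, birth [::] k 0 alpha + clock S V alpha (place [::] k alpha) w).
Proof.
elim/last_ind: alpha => [|alpha i IH]; first by rewrite /= add0r.
by rewrite birth_rcons /tau append_rec_rcons -/(tau S V k w _) IH Khat_place.
Qed.

Lemma Ind_opens k alpha i :
  Ind S V k w (rcons alpha i) = opens w alpha (place [::] k alpha) i.
Proof. by rewrite /Ind append_rec_rcons Khat_place. Qed.

Lemma prod_Ind k alpha :
  (\prod_(1 <= j < (size alpha).+1) Ind S V k w (take j alpha) == 1)%N =
  open_path [::] k alpha.
Proof.
elim/last_ind: alpha => [|alpha i IH]; first by rewrite big_geq.
rewrite open_path_rcons size_rcons big_nat_recr//=.
rewrite -[X in take X (rcons _ _)](size_rcons alpha i) take_size Ind_opens -IH.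
under eq_big_nat.
  move=> j /andP[_ js]; rewrite -cats1 takel_cat//; over.
by case: opens; rewrite ?muln1 ?andbT// muln0 andbF.
Qed.

Lemma btree_at k : btree S V k w = tree_at [::] k.
Proof.
apply/funext => alpha.
by rewrite /btree /tree_at prod_Ind Khat_place /tauB /tauD tau_birth.
Qed.

(** The hypothesis makes the positions agree: below a child that does not open, every position on
    the left is the cemetery state. The times agree since both sides count from the death of the
    parent. *)
Lemma subtree_at beta k i : opens w beta k i ->
  subtree i (tree_at beta k) = tree_at (rcons beta i) (child w beta k i).
Proof.
move=> oi; apply/funext => alpha; rewrite /subtree /tree_at /= oi /= cats0 !add0r.
rewrite (birth_shift _ _ (clock _ _ _ _ _)) cat_rcons.
congr Vertex; first by rewrite addrC addKr.
by ring.
Qed.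

Lemma pos_child beta k i :
  pos (tree_at beta k [:: i]) = if opens w beta k i then Some (child w beta k i) else None.
Proof. by rewrite /= andbT. Qed.

Lemma dies_root beta k : dies (tree_at beta k [::]) = clock S V beta k w.
Proof. by rewrite /= add0r cats0. Qed.

(* The evaluation of the tree of label beta and position k, set to 0 once h
   generations have not sufficed. *)
Fixpoint Phi (h n : nat) (t : R) (beta : label) (k : Zd d) : Cvec R r :=
  if h is h'.+1 then
    if t <= clock S V beta k w then chi0 k
    else if n is n'.+1 then
      let s := t - clock S V beta k w in
      if flips S V beta k w then
        if splits S V beta k w then 0
        else (Cf S)%:C *: Phi h' n s (rcons beta i0) k
      else if splits S V beta k w then
        let lm := Y_ V beta k w in
        (Cb S)%:C *: B_ S k lm.1 lm.2
          (Phi h' n s (rcons beta i1) lm.1) (Phi h' n' s (rcons beta i2) lm.2)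
      else gamma' k s
    else 0
  else 0.

(** A 0 caused by exhausted depth, or by the null event where [U] hits both intervals, propagates to
    the root through flips and, by bilinearity, through branches. Otherwise the computation is a
    derivation of [pruned]. Clocks are nonnegative, so the times left stay below T and [gamma'] may
    stand for [gamma]. *)
Lemma Phi_pruned h n t beta k : t <= T ->
  Phi h n t beta k = 0 \/ pruned S chi0 gamma n t (tree_at beta k) (Phi h n t beta k).
Proof.
elim: h n t beta k => [|h IH] n t beta k tT; first by left.
have root : pos (tree_at beta k [::]) = Some k by [].
have dE := dies_root beta k.
have tT' : t - clock S V beta k w <= T.
  by rewrite lerBlDr (le_trans tT)// lerDl (clock_ge0 HS HV).
rewrite /=; case: leP => ct; first by right; apply: pruned_alive root _; rewrite dE.
case: n => [|n]; first by left.
have ct' : dies (tree_at beta k [::]) < t by rewrite dE.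
case fl: (flips S V beta k w); case sp: (splits S V beta k w); first by left.
- case: (IH n.+1 _ (rcons beta i0) k tT') => [->|H]; first by left; rewrite scaler0.
  right; apply: (pruned_flip root ct').
    by split; rewrite pos_child /opens /= ?fl ?sp.
  by rewrite dE subtree_at.
- set lm := Y_ V beta k w.
  case: (IH n.+1 _ (rcons beta i1) lm.1 tT') => [->|H1].
    by left; rewrite linear0l scaler0.
  case: (IH n _ (rcons beta i2) lm.2 tT') => [->|H2].
    by left; rewrite linear0r scaler0.
  right; apply: (pruned_branch (l := lm.1) (m := lm.2) root ct').
  + by split; rewrite pos_child /opens /= ?fl ?sp.
  + by rewrite dE subtree_at.
  + by rewrite dE subtree_at.
- right; rewrite gammaE; last by rewrite subr_ge0 ltW.
  rewrite -dE; apply: pruned_death root ct' _.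
  by split; rewrite pos_child /opens /= ?fl ?sp.
Qed.

(** Induction on the derivation, which is a finite object: its height is a sufficient number of
    generations. *)
Lemma pruned_Phi n t tr v : pruned S chi0 gamma n t tr v ->
  forall beta k, t <= T -> tr = tree_at beta k ->
  exists h0, forall h, (h0 <= h)%N -> Phi h n t beta k = v.
Proof.
elim=> {n t tr v}
  [n t tr k0 Tk tD|t tr k0 Tk Dt|n t tr k0 Tk Dt [T0 T1 T2]
  |n t tr k0 v Tk Dt [T0 T1 T2] Hv IH
  |n t tr k0 l m v1 v2 Tk Dt [T0 T1 T2] Hv1 IH1 Hv2 IH2] beta k tT trE;
  move: Tk; rewrite trE => -[kk]; subst k0;
  have tT' : t - clock S V beta k w <= T by
    rewrite lerBlDr (le_trans tT)// lerDl (clock_ge0 HS HV).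
- exists 1%N => -[//|h] _ /=; rewrite trE dies_root in tD.
  by rewrite tD.
- exists 1%N => -[//|h] _ /=; rewrite trE dies_root in Dt.
  by rewrite leNgt Dt.
- exists 1%N => -[//|h] _; rewrite trE dies_root in Dt.
  move: T0 T1 T2; rewrite trE dies_root !pos_child /opens /Phi/=.
  case: (flips S V beta k w) => //; case: (splits S V beta k w) => // _ _ _.
  by rewrite leNgt Dt/= gammaE// subr_ge0 ltW.
- move: T0 T1 T2; rewrite trE !pos_child.
  case o0: (opens w beta k i0) => // _; case o1: (opens w beta k i1) => // _ _.
  case: (IH (rcons beta i0) k) => [||h0 Hh].
  + by rewrite trE dies_root.
  + by rewrite trE subtree_at// dies_root.
  exists h0.+1 => -[//|h] hh /=; rewrite trE dies_root in Dt Hh.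
  rewrite leNgt Dt/=; move: o0 o1; rewrite /opens/= => -> ->.
  by rewrite Hh.
- move: T0 T1 T2; rewrite trE !pos_child.
  case o0: (opens w beta k i0) => // _; case o1: (opens w beta k i1) => // -[lE].
  case o2: (opens w beta k i2) => // -[mE].
  move: IH1 IH2; rewrite trE dies_root => IH1 IH2.
  case: (IH1 (rcons beta i1) l tT') => [|h1 Hh1].
    by rewrite -lE subtree_at.
  case: (IH2 (rcons beta i2) m tT') => [|h2 Hh2].
    by rewrite -mE subtree_at.
  exists (maxn h1 h2).+1 => -[//|h] /=; rewrite ltnS geq_max => /andP[hh1 hh2].
  rewrite trE dies_root in Dt.
  rewrite leNgt Dt/=; move: o0 o1; rewrite /opens/= => -> ->.
  by move: lE mE; rewrite /child/= => -> ->; rewrite Hh1// Hh2.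
Qed.

(** If no value is derivable, [Rev] is 0 by the default of [xget] and so is [Phi] at every depth.
    Both conclusions thus hold at every sample, not only almost surely. *)
Lemma Rev_Phi n t k : t <= T ->
  (exists h0, forall h, (h0 <= h)%N ->
     Phi h n t [::] k = Rev S chi0 gamma n t (btree S V k w)) /\
  (forall h, Phi h n t [::] k = 0 \/
     Phi h n t [::] k = Rev S chi0 gamma n t (btree S V k w)).
Proof.
move=> tT; rewrite btree_at.
have [[v Hv]|nv] := pselect (exists v, pruned S chi0 gamma n t (tree_at [::] k) v).
  have -> : Rev S chi0 gamma n t (tree_at [::] k) = v.
    apply: (@pruned_functional _ _ _ S chi0 gamma n t (tree_at [::] k)) => //.
    by apply: (@xgetPex _ 0 [set v | pruned S chi0 gamma n t (tree_at [::] k) v]); exists v.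
  split; first exact: (pruned_Phi Hv).
  move=> h; case: (Phi_pruned h n [::] k tT) => [|H]; [by left|right].
  exact: pruned_functional H Hv.
have -> : Rev S chi0 gamma n t (tree_at [::] k) = 0.
  by apply: xgetPN => v Hv; apply: nv; exists v.
have Phi0 h : Phi h n t [::] k = 0.
  case: (Phi_pruned h n [::] k tT) => [//|H].
  by exfalso; apply: nv; eexists; exact: H.
by split; [exists 0%N|left].
Qed.

End at_sample.
End tree_link.

(** * Measurability of the truncated evaluation and its one-step identity *)

Section evaluation.
Context (R : realType) (d r : nat) (S : params R d r) (HS : standing S).
Context (disp : measure_display) (Omega : measurableType disp)
  (P : probability Omega R) (V : driving d P) (HV : is_driving S V).
Variables (chi0 : Zd d -> Cvec R r) (g : Zd d -> R -> Cvec R r).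
Hypothesis mg : forall k c, measurable_fun setT (fun t => co c (g k t)).

Local Notation Z2 := (Zd d * Zd d)%type.
Local Notation mu := (@lebesgue_measure R).
Local Notation sys := (sys V).
Local Notation rate := (lam_ S).
Local Notation Phi h n t beta k w := (Phi S V chi0 g w h n t beta k).

Definition offspring (h n : nat) (k : Zd d) (beta : label) (lm : Z2) (s : R) (w : Omega) :
    Cvec R r :=
  B_ S k lm.1 lm.2 (Phi h n.+1 s (rcons beta i1) lm.1 w)
    (Phi h n s (rcons beta i2) lm.2 w).

Let measurable_rcons D beta i : at_or_below (rcons beta i) `<=` D ->
  measurable_fun setT (fun x : R * sub sys D =>
    (x.1, x.2 : sub sys (at_or_below (rcons beta i)))).
Proof.
move=> DD; apply/measurable_fun_pairP; split; first exact: measurable_fst.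
have m2 : measurable_fun setT (id : sub sys D -> sub sys (at_or_below (rcons beta i))).
  exact: measurable_sub_id DD.
exact: (measurableT_comp m2 measurable_snd).
Qed.

Lemma measurable_co_bilinear d1 (T1 : measurableType d1) k l m (x y : T1 -> Cvec R r) :
  (forall c, measurable_fun setT (fun w => co c (x w))) ->
  (forall c, measurable_fun setT (fun w => co c (y w))) ->
  forall c, measurable_fun setT (fun w => co c (B_ S k l m (x w) (y w))).
Proof.
move=> mx my c; under eq_fun do rewrite co_bilinear.
by do 2 (apply: measurable_sum => ?); apply: measurable_funM => //; exact: measurable_funM.
Qed.

Lemma measurable_coZ d1 (T1 : measurableType d1) (a : R) (x : T1 -> Cvec R r) :
  (forall c, measurable_fun setT (fun w => co c (x w))) ->
  forall c, measurable_fun setT (fun w => co c (a%:C *: x w)).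
Proof. by move=> mx c; under eq_fun do rewrite coZ; exact: measurable_funM. Qed.

Let measurable_offspring_of h :
  (forall n beta k c, measurable_fun setT
    (fun x : R * sub sys (at_or_below beta) => co c (Phi h n x.1 beta k x.2))) ->
  forall n k beta lm D, strictly_below beta `<=` D -> forall c, measurable_fun setT
    (fun x : R * sub sys D => co c (offspring h n k beta lm x.1 x.2)).
Proof.
move=> IH n k beta lm D bD.
have DD i : at_or_below (rcons beta i) `<=` D.
  by move=> j /below_rcons /bD.
apply: measurable_co_bilinear => c.
- exact: (measurableT_comp (IH n.+1 _ _ c) (measurable_rcons (DD i1))).
- exact: (measurableT_comp (IH n _ _ c) (measurable_rcons (DD i2))).
Qed.

(** Joint measurability in time and sample is required because a child is evaluated at the random
    time left by its parent. The sigma-algebra of the labels at or below [beta] records the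
    dependence that the independence arguments exploit. *)
Lemma measurable_Phi h n beta k c : measurable_fun setT
  (fun x : R * sub sys (at_or_below beta) => co c (Phi h n x.1 beta k x.2)).
Proof.
elim: h n beta k c => [|h IH] n beta k c.
  by under eq_fun do rewrite /= co0; exact: measurable_cst.
pose D := at_or_below (d := d) beta.
have below : strictly_below beta `<=` D.
  move=> j [i /prefixP[s E]]; change (prefix beta (label_of j)); rewrite E cat_rcons; exact: prefix_prefix.
have DE : D (inl (inl beta)) by exact: prefix_refl.
have DU : D (inl (inr beta)) by exact: prefix_refl.
have DY : D (inr (beta, k)) by exact: prefix_refl.
have mc : measurable_fun setT (fun x : R * sub sys D => clock S V beta k x.2).
  have m2 : measurable_fun setT (clock S V beta k : sub sys D -> R) by exact: measurable_clock.
  exact: (measurableT_comp m2 measurable_snd).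
have mf : measurable_fun setT (fun x : R * sub sys D => flips S V beta k x.2).
  have m2 : measurable_fun setT (flips S V beta k : sub sys D -> bool) by exact: measurable_flips.
  exact: (measurableT_comp m2 measurable_snd).
have ms : measurable_fun setT (fun x : R * sub sys D => splits S V beta k x.2).
  have m2 : measurable_fun setT (splits S V beta k : sub sys D -> bool) by exact: measurable_splits.
  exact: (measurableT_comp m2 measurable_snd).
have mY : measurable_fun setT (fun x : R * sub sys D => Y_ V beta k x.2).
  have m2 : measurable_fun setT (Y_ V beta k : sub sys D -> Z2) by exact: measurable_Y.
  exact: (measurableT_comp m2 measurable_snd).
have mleft : measurable_fun setT (fun x : R * sub sys D => x.1 - clock S V beta k x.2).
  exact: measurable_funB.
have mpair : measurable_fun setT
    (fun x : R * sub sys D => (x.1 - clock S V beta k x.2, x.2)).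
  by apply/measurable_fun_pairP; split => //; exact: measurable_snd.
rewrite (_ : (fun _ => _) = (fun x : R * sub sys D =>
  if x.1 <= clock S V beta k x.2 then co c (chi0 k)
  else if n is n'.+1 then
    if flips S V beta k x.2 then
      if splits S V beta k x.2 then 0
      else co c ((Cf S)%:C *: Phi h n'.+1 (x.1 - clock S V beta k x.2) (rcons beta i0) k x.2)
    else if splits S V beta k x.2 then
      co c ((Cb S)%:C *: offspring h n' k beta (Y_ V beta k x.2) (x.1 - clock S V beta k x.2) x.2)
    else co c (g k (x.1 - clock S V beta k x.2))
  else 0)); last first.
  apply/funext => x /=; case: ifP => // _; case: n => [|n]; first by rewrite co0.
  by case: ifP => _; case: ifP => _ //; rewrite co0.
apply: measurable_fun_ifT => //; first exact: measurable_fun_ler.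
case: n => [//|n].
apply: measurable_fun_ifT => //; apply: measurable_fun_ifT => //.
- apply: measurable_coZ => {}c.
  have DD : at_or_below (rcons beta i0) `<=` D by move=> j /below_rcons /below.
  exact: (measurableT_comp (measurableT_comp (IH n.+1 _ k c) (measurable_rcons DD)) mpair).
- apply: (measurable_fun_select _ _ (f := fun x : R * sub sys D => Y_ V beta k x.2)
    (g := fun lm (x : R * sub sys D) =>
      co c ((Cb S)%:C *: offspring h n k beta lm (x.1 - clock S V beta k x.2) x.2))) => //.
  + exact: Z2_measurable.
  + exact: Z2_countable.
  + move=> lm; apply: measurable_coZ => {}c.
    exact: (measurableT_comp (measurable_offspring_of IH n k lm below c) mpair).
- exact: (measurableT_comp (mg k c) mleft).
Qed.

Lemma measurable_offspring h n k beta lm c : measurable_fun setT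
  (fun x : R * sub sys (strictly_below beta) => co c (offspring h n k beta lm x.1 x.2)).
Proof. by apply: measurable_offspring_of => //; exact: measurable_Phi. Qed.

Lemma measurable_Phi_below h n beta i k c : measurable_fun setT
  (fun x : R * sub sys (strictly_below beta) => co c (Phi h n x.1 (rcons beta i) k x.2)).
Proof.
have H : measurable_fun setT (fun x : R * sub sys (strictly_below beta) =>
    (x.1, x.2 : sub sys (at_or_below (rcons beta i)))).
  by apply: measurable_rcons; exact: below_rcons.
pose f1 : R * sub sys (at_or_below (rcons beta i)) -> R := fun x => co c (Phi h n x.1 (rcons beta i) k x.2).
have m1 : measurable_fun setT f1 by exact: measurable_Phi.
exact: (measurableT_comp m1 H).
Qed.

Section functional.
Variable psi : Cvec R r -> R.
Hypotheses (psi0 : psi 0 = 0) (psi_ge0 : forall x, 0 <= psi x).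
Hypothesis mpsi : forall dd (X : measurableType dd) (f : X -> Cvec R r),
  (forall c, measurable_fun setT (fun w => co c (f w))) ->
  measurable_fun setT (fun w => psi (f w)).

(** The bracket of the mild equation, seen through [psi], with time s left. [psi] will be [norm1]
    for the bounds, and the positive and negative parts of a coordinate for the equation. *)
Definition psi_mean (h n : nat) (beta : label) (k : Zd d) (s : R) : \bar R :=
  ((p_ S k)%:E * \int[P]_w (psi ((Cf S)%:C *: Phi h n.+1 s (rcons beta i0) k w))%:E +
  \int[@counting Z2 R]_lm ((q_ S k lm.1 lm.2)%:E *
     \int[P]_w (psi ((Cb S)%:C *: offspring h n k beta lm s w))%:E) +
  (d_ S k)%:E * (psi (g k s))%:E)%E.

Let X h n beta k (x : R * sub sys (strictly_below beta)) : \bar R :=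
  (psi ((Cf S)%:C *: Phi h n.+1 x.1 (rcons beta i0) k x.2))%:E.

Let G h n beta k lm (x : R * sub sys (strictly_below beta)) : \bar R :=
  (psi ((Cb S)%:C *: offspring h n k beta lm x.1 x.2))%:E.

Let mX h n beta k : measurable_fun setT (X h n (beta := beta) k).
Proof.
apply/measurable_EFinP/mpsi/measurable_coZ => c; exact: measurable_Phi_below.
Qed.

Let mG h n beta k lm : measurable_fun setT (G h n (beta := beta) k lm).
Proof.
apply/measurable_EFinP/mpsi/measurable_coZ => c; exact: measurable_offspring.
Qed.

Let mpsig k : measurable_fun setT (fun s => (psi (g k s))%:E).
Proof. by apply/measurable_EFinP/mpsi. Qed.

Lemma measurable_psi_mean h n beta k : measurable_fun setT (psi_mean h n beta k).
Proof.
apply: (@measurable_node_mean _ _ _ S HS _ _ P V beta k (X h n (beta := beta) k)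
  (G h n (beta := beta) k) (fun s => (psi (g k s))%:E)) => //.
- by move=> x; rewrite lee_fin.
- by move=> lm x; rewrite lee_fin.
Qed.

Lemma psi_mean_ge0 h n beta k s : (0 <= psi_mean h n beta k s)%E.
Proof.
apply: (@node_mean_ge0 _ _ _ S HS _ _ P V beta k (X h n (beta := beta) k)
  (G h n (beta := beta) k) (fun s => (psi (g k s))%:E)) => //.
- by move=> x; rewrite lee_fin.
- by move=> lm x; rewrite lee_fin.
- by move=> x; rewrite lee_fin.
Qed.

(** An identity in [0, +oo], with no integrability assumed. It is [ge0_integral_node] applied to
    [psi] of the evaluation; [psi0] accounts for the null event where the evaluation is set to 0. *)
Lemma integral_Phi_step h n t beta k : 0 <= t ->
  (\int[P]_w (psi (Phi h.+1 n.+1 t beta k w))%:E =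
   (psi (chi0 k))%:E * (expR (- rate k * t))%:E +
   \int[mu]_(s in `[0%R, t])
     ((rate k * expR (- rate k * (t - s)))%:E * psi_mean h n beta k s))%E.
Proof.
move=> t0.
rewrite -(@ge0_integral_node _ _ _ S HS _ _ P V HV beta k (psi (chi0 k))%:E (X h n (beta := beta) k)
  (G h n (beta := beta) k) (fun s => (psi (g k s))%:E))//.
- apply: eq_integral => w _; rewrite /node_value /=.
  case: ifP => // _; case: ifP => _; case: ifP => _ //.
  by rewrite psi0.
- by rewrite lee_fin.
- by move=> x; rewrite lee_fin.
- by move=> lm x; rewrite lee_fin.
- by move=> x; rewrite lee_fin.
Qed.

Lemma integral_Phi_step0 h t beta k : 0 <= t ->
  (\int[P]_w (psi (Phi h.+1 0 t beta k w))%:E =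
   (psi (chi0 k))%:E * (expR (- rate k * t))%:E)%E.
Proof.
move=> t0.
(* At level 0 the value is 0 as soon as the clock rings before t: this is the node identity with all
   offspring functions equal to 0. *)
pose Z : R * sub sys (strictly_below beta) -> \bar R := fun _ => 0%E.
pose zero : R -> \bar R := fun _ => 0%E.
transitivity (\int[P]_w node_value S k (psi (chi0 k))%:E Z (fun _ => Z) zero t w)%E.
  apply: eq_integral => w _; rewrite /node_value /=.
  by case: ifP => // _; rewrite psi0; do 2 case: ifP.
rewrite (ge0_integral_node HS HV)//; try by [rewrite lee_fin | exact: measurable_cst].
rewrite [X in (_ + X)%E]integral0_eq ?adde0// => s _.
rewrite /node_mean integral0 !mule0 add0e adde0 integral0_eq ?mule0// => lm _.
  by rewrite mule0.
by move=> _; exact: measurable_cst.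
Qed.

End functional.
End evaluation.

(** * Uniform bounds *)

Lemma ae_lebesgueS (R : realType) (A B : R -> Prop) : (forall t, A t -> B t) ->
  {ae @lebesgue_measure R, forall t, A t} -> {ae @lebesgue_measure R, forall t, B t}.
Proof.
exact: (@filterS _ _ (ae_filter_ringOfSetsType (@lebesgue_measure R))).
Qed.

Section mass.
Context (R : realType) (d r : nat) (S : params R d r) (HS : standing S).
Context (disp : measure_display) (Omega : measurableType disp)
  (P : probability Omega R) (V : driving d P) (HV : is_driving S V).
Variables (chi0 : Zd d -> Cvec R r) (g : Zd d -> R -> Cvec R r).
Hypothesis mg : forall k c, measurable_fun setT (fun t => co c (g k t)).
Variables (Mc Mg : R).
Hypothesis chi0M : forall k, norm1 (chi0 k) <= Mc.
Hypothesis gM : {ae @lebesgue_measure R, forall t, forall k, norm1 (g k t) <= Mg}.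

Local Notation Z2 := (Zd d * Zd d)%type.
Local Notation mu := (@lebesgue_measure R).
Local Notation sys := (sys V).
Local Notation rate := (lam_ S).
Local Notation Phi h n t beta k w := (Phi S V chi0 g w h n t beta k).

Definition mass h n t beta k : \bar R := (\int[P]_w (norm1 (Phi h n t beta k w))%:E)%E.

Lemma mass_ge0 h n t beta k : (0 <= mass h n t beta k)%E.
Proof. by apply: integral_ge0 => w _; rewrite lee_fin norm1_ge0. Qed.

Lemma measurable_Phi_at h n t beta k c : measurable_fun setT
  (fun w : sub sys (at_or_below beta) => co c (Phi h n t beta k w)).
Proof.
pose f x := co c (Phi h n x.1 beta k x.2).
have mf : measurable_fun setT (f : R * sub sys (at_or_below beta) -> R).
  exact: measurable_Phi.
have mt : measurable_fun setT (fun w : sub sys (at_or_below beta) => (t, w)).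
  by apply/measurable_fun_pairP; split; [exact: measurable_cst|exact: measurable_id].
exact: (measurableT_comp mf mt).
Qed.

Lemma measurable_Phi_Omega h n t beta k c : measurable_fun setT
  (fun w : Omega => co c (Phi h n t beta k w)).
Proof. by apply: (sub_comp (D := at_or_below beta)); exact: measurable_Phi_at. Qed.

(** The bilinear bound reduces to the product of the two norms, whose expectation factorizes since
    siblings read disjoint sets of variables. *)
Lemma mass_offspring h n k beta (lm : Z2) s :
  (\int[P]_w (norm1 (offspring S V chi0 g h n k beta lm s w))%:E <=
   (dimR R r)%:E * (mass h n.+1 s (rcons beta i1) lm.1 *
      mass h n s (rcons beta i2) lm.2))%E.
Proof.
pose x w := Phi h n.+1 s (rcons beta i1) lm.1 w.
pose y w := Phi h n s (rcons beta i2) lm.2 w.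
have mx : measurable_fun setT (fun w : Omega => norm1 (x w)).
  by apply: measurable_norm1 => c; exact: measurable_Phi_Omega.
have my : measurable_fun setT (fun w : Omega => norm1 (y w)).
  by apply: measurable_norm1 => c; exact: measurable_Phi_Omega.
rewrite /mass -(ge0_indep_integralM (@sysI _ _ _ _ _ V) (@sysT _ _ _ _ _ V)
   (@sysm _ _ _ _ _ V) (sys_indep HV) (@siblings_disjoint d beta)
   (X := fun w => (norm1 (x w))%:E) (Y := fun w => (norm1 (y w))%:E)); last 4 first.
- apply/measurable_EFinP/measurable_norm1 => c; exact: measurable_Phi_at.
- apply/measurable_EFinP/measurable_norm1 => c; exact: measurable_Phi_at.
- by move=> w; rewrite lee_fin norm1_ge0.
- by move=> w; rewrite lee_fin norm1_ge0.
rewrite -ge0_integralZl//; last 3 first.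
- by apply: emeasurable_funM; exact/measurable_EFinP.
- by move=> w _; rewrite -EFinM lee_fin mulr_ge0// norm1_ge0.
- by rewrite lee_fin dimR_ge0.
apply: ge0_le_integral => //.
- by move=> w _; rewrite lee_fin norm1_ge0.
- apply/measurable_EFinP/measurable_norm1 => c.
  by apply: measurable_co_bilinear => {}c; exact: measurable_Phi_Omega.
- by apply: emeasurable_funM => //; apply: emeasurable_funM; exact/measurable_EFinP.
- by move=> w _; rewrite -!EFinM lee_fin norm1_bilinear//; exact: (B_le HS).
Qed.

Let wgt k t s : R := rate k * expR (- rate k * (t - s)).

Let wgt_ge0 k t s : 0 <= wgt k t s.
Proof. by rewrite mulr_ge0 ?expR_ge0 ?ltW ?(lam_gt0 HS). Qed.

Lemma measurable_wgt k t : measurable_fun setT (wgt k t).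
Proof.
apply: measurable_funM => //; apply: measurableT_comp => //.
by apply: measurable_funM => //; exact: measurable_funB.
Qed.

Lemma Mc_ge0 : 0 <= Mc.
Proof. exact: le_trans (norm1_ge0 _) (chi0M 0). Qed.

Lemma mass_step h n beta k t (F : R -> R) : 0 <= t ->
  measurable_fun setT F -> (forall s, 0 <= F s) ->
  {ae mu, forall s, s \in `[0, t] -> (psi_mean S V chi0 g (@norm1 R r) h n beta k s <= (F s)%:E)%E} ->
  (mass h.+1 n.+1 t beta k <=
   Mc%:E + \int[mu]_(s in `[0%R, t]) (wgt k t s * F s)%:E)%E.
Proof.
move=> t0 mF F0 pF; rewrite /mass (integral_Phi_step HS HV chi0 mg (@norm10 R r) (@norm1_ge0 R r)
  (fun _ _ f => @measurable_norm1 _ _ _ _ setT f))//.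
apply: leeD.
  rewrite -EFinM lee_fin (le_trans _ (chi0M k))// ler_piMr ?norm1_ge0//.
  by rewrite -expR0 ler_expR mulNr oppr_le0 mulr_ge0// ltW// (lam_gt0 HS).
apply: ae_ge0_le_integral => //.
- move=> s _; rewrite mule_ge0 ?lee_fin ?wgt_ge0//.
  by apply: psi_mean_ge0 => //; exact: norm1_ge0.
- apply: measurable_funTS; apply: emeasurable_funM.
    by apply/measurable_EFinP; exact: (measurable_wgt k t).
  by apply: measurable_psi_mean => //; [exact: norm1_ge0|move=> *; exact: measurable_norm1].
- by move=> s _; rewrite lee_fin mulr_ge0.
- by apply/measurable_EFinP/measurable_funTS/measurable_funM => //; exact: measurable_wgt.
- apply: ae_lebesgueS pF => s H st; rewrite [leRHS]EFinM lee_wpmul2l ?lee_fin ?wgt_ge0//.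
  exact: H.
Qed.

Variable T : R.

(** The inner induction on h keeps the bound D e^{mt}: the recursion lowers the depth by one, and
    the weight e^{mt} pays for the factor [b k] whatever its size. Uniformity in h and in the
    position is what the limit will use. *)
Lemma mass_bound n : exists2 A, 0 <= A & forall h t beta k, 0 <= t <= T ->
  (mass h n t beta k <= A%:E)%E.
Proof.
have mass00 n' t beta k : mass 0 n' t beta k = 0%E.
  by rewrite /mass integral0_eq// => w _; rewrite norm10.
have chi_e k t : 0 <= t -> norm1 (chi0 k) * expR (- rate k * t) <= Mc.
  move=> t0; rewrite (le_trans _ (chi0M k))// ler_piMr ?norm1_ge0//.
  by rewrite -expR0 ler_expR mulNr oppr_le0 mulr_ge0// ltW// (lam_gt0 HS).
have [Mg' Mg'0 gM'] : exists2 M, 0 <= M & {ae mu, forall t, forall k, norm1 (g k t) <= M}.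
  exists (Num.max 0 Mg); first by rewrite le_max lexx.
  by apply: ae_lebesgueS gM => t H k; rewrite le_max H orbT.
elim: n => [|n [A A0 HA]].
  exists Mc => [|h t beta k /andP[t0 tT]]; first exact: Mc_ge0.
  case: h => [|h]; first by rewrite mass00 lee_fin Mc_ge0.
  rewrite /mass (integral_Phi_step0 HS HV chi0 g (@norm10 R r) (@norm1_ge0 R r))//.
  by rewrite -EFinM lee_fin chi_e.
have Cf0 := Cf_ge0 HS; have Cb0 := Cb_ge0 HS; have dim0 := dimR_ge0 R r.
(* The factor in front of the unknown of level n + 1: a flip gives C_f p_k, a branch gives C_b q_k
   times [dimR] from the bilinear bound and [A] from the level below. It vanishes at infinity
   because p and q do. *)
pose b k := Cf S * p_ S k + (Cb S * dimR R r * A) * qtot S k.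
have [m m0 Hm] : exists2 m, 0 <= m & forall k, rate k / (rate k + m) * b k <= 2^-1.
  apply: (contraction_rate (C := Cf S + Cb S * dimR R r * A)).
  - exact: lam_gt0 HS.
  - move=> k; have := pqd1 HS k; have := p_ge0 HS k; have := qtot_ge0 HS k.
    have := d_ge0 HS k => d0 q0 p0 pqd; apply/andP; split.
      by rewrite addr_ge0// !mulr_ge0.
    rewrite lerD// ler_piMr ?mulr_ge0//; lra.
  - by apply: vanishes_at_infinityD; [exact: p_vanishes HS|exact: q_vanishes HS].
(* Half of [D] pays for the initial condition and the forcing; the contraction keeps the unknown
   within the other half. *)
have [D DE D0] : exists2 D, D = 2 * (Mc + Mg') & 0 <= D.
  by eexists; first reflexivity; rewrite mulr_ge0// addr_ge0// Mc_ge0.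
suff H h t beta k : 0 <= t <= T -> (mass h n.+1 t beta k <= (D * expR (m * t))%:E)%E.
  exists (D * expR (m * T)) => [|h t beta k tT]; first by rewrite mulr_ge0// expR_ge0.
  apply: (le_trans (H h t beta k tT)); rewrite lee_fin ler_wpM2l// ler_expR.
  by rewrite ler_wpM2l//; case/andP: tT.
elim: h t beta k => [|h IH] t beta k /andP[t0 tT].
  by rewrite mass00 lee_fin mulr_ge0// expR_ge0.
pose F s := b k * D * expR (m * s) + Mg'.
have b0 : 0 <= b k.
  by rewrite addr_ge0// !mulr_ge0// ?(p_ge0 HS) ?(qtot_ge0 HS).
apply: (@le_trans _ _ (Mc%:E + \int[mu]_(s in `[0%R, t]) (wgt k t s * F s)%:E)%E).
  apply: mass_step => //.
  - apply: measurable_funD => //; apply: measurable_funM => //.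
    by apply: measurableT_comp => //; exact: measurable_funM.
  - by move=> s; rewrite addr_ge0// mulr_ge0 ?expR_ge0// mulr_ge0.
  apply: ae_lebesgueS gM' => s gs; rewrite in_itv/= => /andP[s0 st].
  have sT : 0 <= s <= T by rewrite s0 (le_trans st).
  have e0 := expR_ge0 (m * s).
  rewrite /F /b /psi_mean !mulrDl !EFinD; apply: leeD; first apply: leeD.
  - under eq_integral do rewrite norm1Z ger0_norm// EFinM.
    rewrite ge0_integralZl//; last 2 first.
    + by apply/measurable_EFinP/measurable_norm1 => c; exact: measurable_Phi_Omega.
    + by move=> w _; rewrite lee_fin norm1_ge0.
    rewrite -/(mass h n.+1 s (rcons beta i0) k).
    apply: (@le_trans _ _ ((p_ S k)%:E * ((Cf S)%:E * (D * expR (m * s))%:E))%E).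
      rewrite lee_wpmul2l ?lee_fin ?(p_ge0 HS)// lee_wpmul2l ?lee_fin//.
      exact: IH.
    by rewrite -!EFinM lee_fin le_eqVlt; apply/orP; left; apply/eqP; ring.
  - apply: (@le_trans _ _ (\int[@counting Z2 R]_lm ((q_ S k lm.1 lm.2)%:E *
        (Cb S * dimR R r * A * (D * expR (m * s)))%:E)%E)%E).
      apply: ge0_le_integral => //.
      + by move=> lm _; rewrite mule_ge0 ?lee_fin ?(q_ge0 HS)//; apply: integral_ge0 => w _;
          rewrite lee_fin norm1_ge0.
      + exact: Z2_measurable_fun.
      + exact: Z2_measurable_fun.
      move=> lm _; rewrite lee_wpmul2l ?lee_fin ?(q_ge0 HS)//.
      under eq_integral do rewrite norm1Z ger0_norm// EFinM.
      rewrite ge0_integralZl//; last 2 first.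
      + apply/measurable_EFinP/measurable_norm1 => c.
        by apply: measurable_co_bilinear => {}c; exact: measurable_Phi_Omega.
      + by move=> w _; rewrite lee_fin norm1_ge0.
      apply: (@le_trans _ _ ((Cb S)%:E * ((dimR R r)%:E * ((D * expR (m * s))%:E * A%:E)))%E).
        rewrite lee_wpmul2l ?lee_fin//.
        apply: (le_trans (mass_offspring _ _ _ _ _ _)).
        rewrite lee_wpmul2l ?lee_fin//.
        by apply: lee_pmul; rewrite ?mass_ge0 ?IH ?HA.
      by rewrite -!EFinM lee_fin le_eqVlt; apply/orP; left; apply/eqP; ring.
    rewrite ge0_integralZr//; last 3 first.
    + exact: Z2_measurable_fun.
    + by move=> lm _; rewrite lee_fin (q_ge0 HS).
    + by rewrite lee_fin !mulr_ge0.
    by rewrite (integral_q HS) -EFinM lee_fin le_eqVlt; apply/orP; left; apply/eqP; ring.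
  - rewrite -EFinM lee_fin; apply: (@le_trans _ _ (1 * Mg')); last by rewrite mul1r.
    by apply: ler_pM; rewrite ?norm1_ge0 ?(d_ge0 HS)//; case/andP: (d_itv HS k).
have l0 := lam_gt0 HS k.
(* The constant part of [F] carries the weight e^{0 s}, so that both integrals are instances of
   [integral_exp_window]. *)
rewrite (_ : \int[mu]_(s in `[0%R, t]) (wgt k t s * F s)%:E =
   (b k * D)%:E * \int[mu]_(s in `[0%R, t]) (wgt k t s * expR (m * s))%:E +
   Mg'%:E * \int[mu]_(s in `[0%R, t]) (wgt k t s * expR (0 * s))%:E)%E; last first.
  have mwe a : measurable_fun (`[0%R, t]%classic : set (measurableTypeR R))
      (fun s : R => wgt k t s * expR (a * s)).
    apply: measurable_funTS; apply: measurable_funM; first exact: (measurable_wgt k t).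
    by apply: measurableT_comp => //; exact: measurable_funM.
  have Z a M : 0 <= M -> (M%:E * \int[mu]_(s in `[0%R, t]) (wgt k t s * expR (a * s))%:E =
      \int[mu]_(s in `[0%R, t]) (M * (wgt k t s * expR (a * s)))%:E)%E.
    move=> M0; under [RHS]eq_integral do rewrite EFinM.
    rewrite ge0_integralZl//.
    - by apply/measurable_EFinP; exact: mwe.
    - by move=> s _; rewrite lee_fin mulr_ge0 ?wgt_ge0 ?expR_ge0.
  rewrite !Z//; last by rewrite mulr_ge0.
  rewrite -ge0_integralD//; last 4 first.
  - by move=> s _; rewrite lee_fin mulr_ge0 ?(mulr_ge0 b0 D0)// mulr_ge0 ?wgt_ge0 ?expR_ge0.
  - by apply/measurable_EFinP/measurable_funM => //; exact: mwe.
  - by move=> s _; rewrite lee_fin mulr_ge0 ?(mulr_ge0 b0 D0)// mulr_ge0 ?wgt_ge0 ?expR_ge0.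
  - by apply/measurable_EFinP/measurable_funM => //; exact: mwe.
  apply: eq_integral => s _; rewrite -EFinD /F mul0r expR0.
  by congr (_%:E); ring.
rewrite /wgt !integral_exp_window// mul0r expR0 addr0 divff ?gt_eqF// mul1r.
rewrite -!EFinM -!EFinD lee_fin.
have e1 : 0 <= expR (- rate k * t) by exact: expR_ge0.
have em : 1 <= expR (m * t) by rewrite -expR0 ler_expR mulr_ge0.
have Hk := Hm k.
have H1 : b k * D * (rate k / (rate k + m) * (expR (m * t) - expR (- rate k * t))) <=
    2^-1 * D * expR (m * t).
  rewrite (_ : b k * D * _ = (rate k / (rate k + m) * b k) *
    (D * (expR (m * t) - expR (- rate k * t)))); last by ring.
  have lm0 : 0 < rate k + m by rewrite ltr_wpDr.
  rewrite -[leRHS]mulrA; apply: ler_pM => //.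
  - by rewrite mulr_ge0// divr_ge0// ltW.
  - rewrite mulr_ge0// subr_ge0 (le_trans _ em)// -expR0 ler_expR mulNr oppr_le0.
    by rewrite mulr_ge0// ltW.
  - by rewrite ler_wpM2l// gerBl.
have H2 : Mg' * (1 - expR (- rate k * t)) <= Mg' by rewrite ler_piMr// gerBl.
have H3 : Mc + Mg' <= 2^-1 * D * expR (m * t).
  rewrite DE mulrA mulVf ?pnatr_eq0// mul1r.
  by rewrite -[leLHS]mulr1 ler_wpM2l// addr_ge0// Mc_ge0.
have H4 : D * expR (m * t) = 2^-1 * D * expR (m * t) + 2^-1 * D * expR (m * t) by field.
by rewrite H4; lra.
Qed.

End mass.

(** * The recursion for the truncated expectations *)

Section posneg.
Context d (X : measurableType d) (R : realType) (mu : {measure set X -> \bar R}).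
Variables (D : set X) (mD : measurable D) (f : X -> R).
Hypothesis intf : mu.-integrable D (EFin \o f).
Local Open Scope ereal_scope.

Let posE : (EFin \o f)^\+ = (fun x => (Num.max (f x) 0)%:E).
Proof. by apply/funext => x; rewrite funeposE/= EFin_max. Qed.

Let negE : (EFin \o f)^\- = (fun x => (Num.max (- f x) 0)%:E).
Proof. by apply/funext => x; rewrite funenegE/= EFin_max. Qed.

Lemma integral_pos_fin : \int[mu]_(x in D) (Num.max (f x) 0)%:E \is a fin_num.
Proof. by rewrite -posE; exact: integrable_pos_fin_num. Qed.

Lemma integral_neg_fin : \int[mu]_(x in D) (Num.max (- f x) 0)%:E \is a fin_num.
Proof. by rewrite -negE; exact: integrable_neg_fin_num. Qed.

Lemma integral_pos_neg : \int[mu]_(x in D) (Num.max (f x) 0)%:E -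
  \int[mu]_(x in D) (Num.max (- f x) 0)%:E = (Rintegral mu D f)%:E.
Proof.
rewrite -posE -negE -integralE /Rintegral fineK//.
exact: integrable_fin_num.
Qed.

End posneg.

Lemma max_pos_neg (R : realType) (a : R) : Num.max a 0 - Num.max (- a) 0 = a.
Proof. by case: (leP a 0) => h; [rewrite max_l ?oppr_ge0// sub0r opprK|rewrite max_r ?oppr_le0 ?ltW// subr0]. Qed.

Section expectations.
Context (R : realType) (d r : nat) (S : params R d r) (HS : standing S).
Context (disp : measure_display) (Omega : measurableType disp)
  (P : probability Omega R) (V : driving d P) (HV : is_driving S V).
Variables (chi0 : Zd d -> Cvec R r) (g : Zd d -> R -> Cvec R r).
Hypothesis mg : forall k c, measurable_fun setT (fun t => co c (g k t)).
Variables (Mc Mg : R).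
Hypothesis chi0M : forall k, norm1 (chi0 k) <= Mc.
Hypothesis gM : {ae @lebesgue_measure R, forall t, forall k, norm1 (g k t) <= Mg}.
Variable T : R.

Local Notation Z2 := (Zd d * Zd d)%type.
Local Notation Phi h n t beta k w := (Phi S V chi0 g w h n t beta k).
Local Notation mass := (mass S V chi0 g).
Local Notation offspring := (offspring S V chi0 g).

Definition EPhi h n s beta k : Cvec R r := vintegral P setT (fun w => Phi h n s beta k w).

Lemma le_mass_co h n t beta k c :
  (\int[P]_w `|co c (Phi h n t beta k w)|%:E <= mass h n t beta k)%E.
Proof.
apply: ge0_le_integral => //.
- by apply/measurable_EFinP; apply: measurableT_comp => //; exact: measurable_Phi_Omega.
- by apply/measurable_EFinP/measurable_norm1 => ?; exact: measurable_Phi_Omega.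
- by move=> w _; rewrite lee_fin co_le_norm1.
Qed.

Lemma integrable_Phi h n t beta k c : 0 <= t <= T ->
  P.-integrable setT (fun w => (co c (Phi h n t beta k w))%:E).
Proof.
move=> tT; apply/integrableP; split.
  by apply/measurable_EFinP; exact: measurable_Phi_Omega.
have [A A0 HA] := mass_bound HS HV mg chi0M gM T n.
by apply: le_lt_trans (le_mass_co _ _ _ _ _ _) _; apply: le_lt_trans (HA h t beta k tT) _; rewrite ltry.
Qed.

Lemma co_EPhiE h n t beta k c : 0 <= t <= T ->
  (\int[P]_w (co c (Phi h n t beta k w))%:E = (co c (EPhi h n t beta k))%:E)%E.
Proof.
move=> tT; rewrite co_vintegral /Rintegral fineK//.
by apply: integrable_fin_num => //; exact: integrable_Phi.
Qed.

Lemma co_EPhi_le n A h t beta k c : 0 <= t <= T ->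
  (mass h n t beta k <= A%:E)%E -> `|co c (EPhi h n t beta k)| <= A.
Proof.
move=> tT mA; rewrite -lee_fin -abse_EFin -co_EPhiE//.
apply: (le_trans (le_abse_integral _ _ _)) => //.
  by apply/measurable_EFinP; exact: measurable_Phi_Omega.
exact: le_trans (le_mass_co _ _ _ _ _ _) mA.
Qed.

(** The expectation passes through [B]: in coordinates it is a finite combination of products of a
    coordinate of one sibling and a coordinate of the other, which are independent and
    integrable. *)
Lemma EPhi_offspring h n k beta (lm : Z2) s c : 0 <= s <= T ->
  P.-integrable setT (fun w => (co c (offspring h n k beta lm s w))%:E) /\
  (\int[P]_w (co c (offspring h n k beta lm s w))%:E =
   (co c (B_ S k lm.1 lm.2 (EPhi h n.+1 s (rcons beta i1) lm.1) (EPhi h n s (rcons beta i2) lm.2)))%:E)%E.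
Proof.
move=> sT.
pose x w := Phi h n.+1 s (rcons beta i1) lm.1 w.
pose y w := Phi h n s (rcons beta i2) lm.2 w.
pose B := B_ S k lm.1 lm.2.
have prod a b :
    P.-integrable setT (fun w => (co a (x w) * co b (y w))%:E) /\
    (\int[P]_w (co a (x w) * co b (y w))%:E =
      \int[P]_w (co a (x w))%:E * \int[P]_w (co b (y w))%:E)%E.
  apply: (indep_integralM (@sysI _ _ _ _ _ V) (@sysT _ _ _ _ _ V)
   (@sysm _ _ _ _ _ V) (sys_indep HV) (@siblings_disjoint d beta)
   (X := fun w => co a (x w)) (Y := fun w => co b (y w))).
  - exact: measurable_Phi_at.
  - exact: measurable_Phi_at.
  - exact: integrable_Phi.
  - exact: integrable_Phi.
have E w : (co c (offspring h n k beta lm s w))%:E =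
   (\sum_a \sum_b ((struct_const B a b c)%:E * (co a (x w) * co b (y w))%:E))%E.
  rewrite /offspring co_bilinear -sumEFin; apply: eq_bigr => a _.
  by rewrite -sumEFin; apply: eq_bigr => b _; rewrite EFinM.
have i1' a b : P.-integrable setT (fun w => (struct_const B a b c)%:E * (co a (x w) * co b (y w))%:E)%E.
  by apply: integrableZl => //; exact: (prod a b).1.
have i2' a : P.-integrable setT (fun w => \sum_b ((struct_const B a b c)%:E * (co a (x w) * co b (y w))%:E))%E.
  by apply: integrable_sum => // b _; exact: i1'.
under [X in _.-integrable _ X]eq_fun do rewrite E.
under eq_integral do rewrite E.
split; first by apply: integrable_sum => // a _; exact: i2'.
rewrite integral_sum//.
rewrite co_bilinear -sumEFin; apply: eq_bigr => a _.
rewrite integral_sum// -sumEFin; apply: eq_bigr => b _.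
rewrite integralZl//; last exact: (prod a b).1.
by rewrite (prod a b).2 !co_EPhiE// -!EFinM.
Qed.

Lemma integrable_q k (F : Z2 -> R) (M : R) : (forall lm, `|F lm| <= M) ->
  (@counting Z2 R).-integrable setT (fun lm => (q_ S k lm.1 lm.2 * F lm)%:E).
Proof.
move=> FM.
have M0 : 0 <= M by exact: le_trans (normr_ge0 _) (FM (0, 0)).
apply/integrableP; split; first exact: Z2_measurable_fun.
apply: (@le_lt_trans _ _ (\int[@counting Z2 R]_lm ((q_ S k lm.1 lm.2)%:E * M%:E)%E)%E).
  apply: ge0_le_integral => //; try exact: Z2_measurable_fun.
  by move=> lm _; rewrite -EFinM lee_fin normrM ger0_norm ?(q_ge0 HS)// ler_wpM2l ?(q_ge0 HS).
rewrite ge0_integralZr//; last 2 first.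
- exact: Z2_measurable_fun.
- by move=> lm _; rewrite lee_fin (q_ge0 HS).
by rewrite (integral_q HS) -EFinM ltry.
Qed.

Definition offspring_drift h n beta k s : Cvec R r :=
  (Cf S * p_ S k)%:C *: EPhi h n.+1 s (rcons beta i0) k +
  (Cb S)%:C *: vsum2 (fun l m => (q_ S k l m)%:C *:
     B_ S k l m (EPhi h n.+1 s (rcons beta i1) l) (EPhi h n s (rcons beta i2) m)) +
  (d_ S k)%:C *: g k s.

Section coordinate.
Variable c : coord_ix r.

Definition pos_part (x : Cvec R r) : R := Num.max (co c x) 0.
Definition neg_part (x : Cvec R r) : R := Num.max (- co c x) 0.

Lemma pos_part0 : pos_part 0 = 0. Proof. by rewrite /pos_part co0 maxxx. Qed.
Lemma neg_part0 : neg_part 0 = 0. Proof. by rewrite /neg_part co0 oppr0 maxxx. Qed.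
Lemma pos_part_ge0 x : 0 <= pos_part x. Proof. by rewrite le_max lexx orbT. Qed.
Lemma neg_part_ge0 x : 0 <= neg_part x. Proof. by rewrite le_max lexx orbT. Qed.
Lemma measurable_pos_part dd (X : measurableType dd) (f : X -> Cvec R r) :
  (forall c, measurable_fun setT (fun w => co c (f w))) ->
  measurable_fun setT (fun w => pos_part (f w)).
Proof. by move=> mf; exact: measurable_maxr. Qed.
Lemma measurable_neg_part dd (X : measurableType dd) (f : X -> Cvec R r) :
  (forall c, measurable_fun setT (fun w => co c (f w))) ->
  measurable_fun setT (fun w => neg_part (f w)).
Proof. by move=> mf; apply: measurable_maxr => //; exact: measurableT_comp (mf c). Qed.

(** The positive part of a bilinear value is not a function of the expectations of its arguments, so
    neither [psi_mean] closes by itself; their difference does. Finiteness of both, from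
    [mass_bound], must come before the subtraction. *)
Lemma drift_coord h n beta k s : 0 <= s <= T ->
  [/\ psi_mean S V chi0 g pos_part h n beta k s \is a fin_num,
     psi_mean S V chi0 g neg_part h n beta k s \is a fin_num &
   (psi_mean S V chi0 g pos_part h n beta k s - psi_mean S V chi0 g neg_part h n beta k s =
    (co c (offspring_drift h n beta k s))%:E)%E].
Proof.
move=> sT.
have [A A0 HA] := mass_bound HS HV mg chi0M gM T n.
have [A' A'0 HA'] := mass_bound HS HV mg chi0M gM T n.+1.
pose f1 w := co c ((Cf S)%:C *: Phi h n.+1 s (rcons beta i0) k w).
have if1 : P.-integrable setT (EFin \o f1).
  rewrite (_ : _ \o _ = (fun w => (Cf S)%:E * (co c (Phi h n.+1 s (rcons beta i0) k w))%:E)%E).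
    by apply: integrableZl => //; exact: integrable_Phi.
  by apply/funext => w; rewrite /f1/= coZ EFinM.
have If1 : Rintegral P setT f1 = Cf S * co c (EPhi h n.+1 s (rcons beta i0) k).
  rewrite co_vintegral -RintegralZl//; last exact: integrable_Phi.
  by apply: eq_Rintegral => w _; rewrite /f1 coZ.
pose f2 lm w := co c ((Cb S)%:C *: offspring h n k beta lm s w).
have if2 lm : P.-integrable setT (EFin \o f2 lm).
  rewrite (_ : _ \o _ = (fun w => (Cb S)%:E * (co c (offspring h n k beta lm s w))%:E)%E).
    by apply: integrableZl => //; exact: (EPhi_offspring _ _ _ _ _ _ sT).1.
  by apply/funext => w; rewrite /f2/= coZ EFinM.
pose b lm := co c (B_ S k lm.1 lm.2 (EPhi h n.+1 s (rcons beta i1) lm.1)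
  (EPhi h n s (rcons beta i2) lm.2)).
have If2 lm : Rintegral P setT (f2 lm) = Cb S * b lm.
  have [io Io] := EPhi_offspring h n k beta lm c sT.
  rewrite (_ : b lm = Rintegral P setT (fun w => co c (offspring h n k beta lm s w))).
    by rewrite -RintegralZl//; apply: eq_Rintegral => w _; rewrite /f2 coZ.
  by rewrite /Rintegral Io.
(* A bound uniform in the pair [lm], which makes the sums of positive and of negative parts against
   q both finite. *)
pose M := Cb S * (dimR R r * (A' * A)).
have Hmass lm : (\int[P]_w (norm1 ((Cb S)%:C *: offspring h n k beta lm s w))%:E <= M%:E)%E.
  under eq_integral do rewrite norm1Z ger0_norm ?(Cb_ge0 HS)// EFinM.
  rewrite ge0_integralZl//; last 3 first.
  - apply/measurable_EFinP/measurable_norm1 => c'.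
    by apply: measurable_co_bilinear => ?; exact: measurable_Phi_Omega.
  - by move=> w _; rewrite lee_fin norm1_ge0.
  - by rewrite lee_fin (Cb_ge0 HS).
  rewrite /M !EFinM lee_wpmul2l ?lee_fin ?(Cb_ge0 HS)//.
  apply: (le_trans (mass_offspring HS HV chi0 mg _ _ _ _ _ _)).
  rewrite lee_wpmul2l ?lee_fin ?dimR_ge0//.
  by apply: lee_pmul; rewrite ?mass_ge0 ?HA' ?HA.
have mo lm c' : measurable_fun setT (fun w : Omega => co c' ((Cb S)%:C *: offspring h n k beta lm s w)).
  apply: measurable_coZ => {}c'.
  by apply: measurable_co_bilinear => ?; exact: measurable_Phi_Omega.
have bound (psi : Cvec R r -> R) lm : (forall x, 0 <= psi x) -> (forall x, psi x <= norm1 x) ->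
    measurable_fun setT (fun w : Omega => psi ((Cb S)%:C *: offspring h n k beta lm s w)) ->
    (\int[P]_w (psi ((Cb S)%:C *: offspring h n k beta lm s w))%:E <= M%:E)%E.
  move=> p0 p1 mp; apply: le_trans (Hmass lm).
  apply: ge0_le_integral => //.
  - by move=> w _; rewrite lee_fin.
  - exact/measurable_EFinP.
  - by apply/measurable_EFinP/measurable_norm1.
  - by move=> w _; rewrite lee_fin.
have pos_le x : pos_part x <= norm1 x.
  by rewrite ge_max norm1_ge0 (le_trans (ler_norm _) (co_le_norm1 _ _)).
have neg_le x : neg_part x <= norm1 x.
  by rewrite ge_max norm1_ge0 andbT (le_trans (ler_norm _))// normrN co_le_norm1.
pose Fp lm := fine (\int[P]_w (pos_part ((Cb S)%:C *: offspring h n k beta lm s w))%:E)%E.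
pose Fn lm := fine (\int[P]_w (neg_part ((Cb S)%:C *: offspring h n k beta lm s w))%:E)%E.
have FpE : forall lm, (\int[P]_w (pos_part ((Cb S)%:C *: offspring h n k beta lm s w))%:E = (Fp lm)%:E)%E.
  by move=> lm; rewrite /Fp fineK//; exact: (integral_pos_fin measurableT (if2 lm)).
have FnE : forall lm, (\int[P]_w (neg_part ((Cb S)%:C *: offspring h n k beta lm s w))%:E = (Fn lm)%:E)%E.
  by move=> lm; rewrite /Fn fineK//; exact: (integral_neg_fin measurableT (if2 lm)).
have Fp1 lm : `|Fp lm| <= M.
  rewrite ger0_norm -?lee_fin -FpE; last by apply: integral_ge0 => w _; rewrite lee_fin pos_part_ge0.
  by apply: bound; [exact: pos_part_ge0|exact: pos_le|exact: measurable_pos_part].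
have Fn1 lm : `|Fn lm| <= M.
  rewrite ger0_norm -?lee_fin -FnE; last by apply: integral_ge0 => w _; rewrite lee_fin neg_part_ge0.
  by apply: bound; [exact: neg_part_ge0|exact: neg_le|exact: measurable_neg_part].
have FpnE lm : Fp lm - Fn lm = Cb S * b lm.
  have := integral_pos_neg measurableT (if2 lm).
  rewrite [X in (X - _)%E]FpE [X in (_ - X)%E]FnE If2 -EFinB => -[->//].
have ip := integrable_q k Fp1.
have iN := integrable_q k Fn1.
rewrite /psi_mean.
have qE (F : Z2 -> R) G : (forall lm, (G lm = (F lm)%:E)%E) ->
   (\int[@counting Z2 R]_lm ((q_ S k lm.1 lm.2)%:E * G lm) =
    \int[@counting Z2 R]_lm (q_ S k lm.1 lm.2 * F lm)%:E)%E.
  by move=> GE; apply: eq_integral => lm _; rewrite GE EFinM.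
rewrite (qE Fp _ FpE) (qE Fn _ FnE).
have fp1 := integral_pos_fin measurableT if1; have fn1 := integral_neg_fin measurableT if1.
have fp2 := integrable_fin_num measurableT ip; have fn2 := integrable_fin_num measurableT iN.
split.
- rewrite fin_numD; apply/andP; split; last by [].
  rewrite fin_numD; apply/andP; split; last exact: fp2.
  by apply: fin_numM => //; exact: fp1.
- rewrite fin_numD; apply/andP; split; last by [].
  rewrite fin_numD; apply/andP; split; last exact: fn2.
  by apply: fin_numM => //; exact: fn1.
pose u1 := fine (\int[P]_w (Num.max (f1 w) 0)%:E)%E.
pose v1 := fine (\int[P]_w (Num.max (- f1 w) 0)%:E)%E.
pose u2 := fine (\int[@counting Z2 R]_lm (q_ S k lm.1 lm.2 * Fp lm)%:E)%E.
pose v2 := fine (\int[@counting Z2 R]_lm (q_ S k lm.1 lm.2 * Fn lm)%:E)%E.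
have U1 : (\int[P]_w (pos_part ((Cf S)%:C *: Phi h n.+1 s (rcons beta i0) k w))%:E = u1%:E)%E.
  by rewrite /u1 fineK.
have V1 : (\int[P]_w (neg_part ((Cf S)%:C *: Phi h n.+1 s (rcons beta i0) k w))%:E = v1%:E)%E.
  by rewrite /v1 fineK.
have U2 : (\int[@counting Z2 R]_lm (q_ S k lm.1 lm.2 * Fp lm)%:E = u2%:E)%E.
  by rewrite /u2 fineK.
have V2 : (\int[@counting Z2 R]_lm (q_ S k lm.1 lm.2 * Fn lm)%:E = v2%:E)%E.
  by rewrite /v2 fineK.
have E1 : u1 - v1 = Cf S * co c (EPhi h n.+1 s (rcons beta i0) k).
  have := integral_pos_neg measurableT if1.
  by rewrite If1 [X in (X - _)%E]U1 [X in (_ - X)%E]V1 => -[].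
have E2 : u2 - v2 = Cb S * co c (vsum2 (fun l m => (q_ S k l m)%:C *:
     B_ S k l m (EPhi h n.+1 s (rcons beta i1) l) (EPhi h n s (rcons beta i2) m))).
  have := integralB measurableT ip iN.
  rewrite [X in _ = (X - _)%E]U2 [X in _ = (_ - X)%E]V2 => E2.
  rewrite /vsum2 co_vintegral -RintegralZl//.
    rewrite /Rintegral -[LHS]/(fine (u2%:E - v2%:E)%E) -E2; congr fine.
    apply: eq_integral => lm _; rewrite -EFinB -mulrBr FpnE coZ; congr (_%:E).
    by rewrite mulrCA.
  under [X in _.-integrable _ X]eq_fun do rewrite /= coZ.
  (* One [dimR] comes from the bilinear bound; the other two sum the coordinate bounds of the two
     expectations into [norm1]. *)
  apply: (@integrable_q k b (dimR R r * (dimR R r * A' * (dimR R r * A)))) => lm.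
  apply: (le_trans (co_le_norm1 _ _)); apply: (le_trans (norm1_bilinear _ _ _)).
    exact: (B_le HS).
  apply: ler_wpM2l; first exact: dimR_ge0.
  apply: ler_pM; rewrite ?norm1_ge0//; apply: sum_le_dimR => c'.
    exact: (co_EPhi_le _ _ (HA' _ _ _ _ sT)).
  exact: (co_EPhi_le _ _ (HA _ _ _ _ sT)).
rewrite U1 V1 U2 V2.
transitivity ((p_ S k * (u1 - v1) + (u2 - v2) +
    d_ S k * (pos_part (g k s) - neg_part (g k s)))%:E).
  rewrite (_ : p_ S k * (u1 - v1) + _ + _ =
    (p_ S k * u1 + u2 + d_ S k * pos_part (g k s)) -
    (p_ S k * v1 + v2 + d_ S k * neg_part (g k s)))//.
  by ring.
rewrite /offspring_drift !coD !coZ E1 E2 max_pos_neg; congr (_%:E); ring.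
Qed.

End coordinate.
End expectations.

Section recursion.
Context (R : realType) (d r : nat) (S : params R d r) (HS : standing S).
Context (disp : measure_display) (Omega : measurableType disp)
  (P : probability Omega R) (V : driving d P) (HV : is_driving S V).
Variables (chi0 : Zd d -> Cvec R r) (g : Zd d -> R -> Cvec R r).
Hypothesis mg : forall k c, measurable_fun setT (fun t => co c (g k t)).
Variables (Mc Mg : R).
Hypothesis chi0M : forall k, norm1 (chi0 k) <= Mc.
Hypothesis gM : {ae @lebesgue_measure R, forall t, forall k, norm1 (g k t) <= Mg}.
Variable T : R.

Local Notation mu := (@lebesgue_measure R).
Local Notation rate := (lam_ S).
Local Notation Phi h n t beta k w := (Phi S V chi0 g w h n t beta k).

Local Notation EPhi := (EPhi S V chi0 g).
Local Notation drift := (offspring_drift S V chi0 g).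

Section coordinate.
Variables (h n : nat) (t : R) (beta : label) (k : Zd d) (c : coord_ix r).
Hypothesis tT : 0 <= t <= T.

Let wgt s : R := rate k * expR (- rate k * (t - s)).

Let wgt_ge0 s : 0 <= wgt s.
Proof. by rewrite mulr_ge0 ?expR_ge0// ltW// (lam_gt0 HS). Qed.

Let inT s : s \in (`[0, t] : interval R) -> 0 <= s <= T.
Proof.
by rewrite in_itv/= => /andP[s0 st]; rewrite s0 (le_trans st)//; case/andP: tT.
Qed.

(** Integrability in s is read off the one-step identity itself: its left side is finite and its
    terms are nonnegative. *)
Let part_integrable (psi : Cvec R r -> R) (psi0 : psi 0 = 0) (psi_ge0 : forall x, 0 <= psi x)
    (mpsi : forall dd (X : measurableType dd) (f : X -> Cvec R r),
      (forall c, measurable_fun setT (fun w => co c (f w))) ->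
      measurable_fun setT (fun w => psi (f w))) :
  (\int[P]_w (psi (Phi h.+1 n.+1 t beta k w))%:E)%E \is a fin_num ->
  (forall s, 0 <= s <= T -> psi_mean S V chi0 g psi h n beta k s \is a fin_num) ->
  let f s := fine (psi_mean S V chi0 g psi h n beta k s) in
  mu.-integrable `[0, t] (EFin \o (fun s => wgt s * f s)) /\
  (\int[P]_w (psi (Phi h.+1 n.+1 t beta k w))%:E =
   (psi (chi0 k) * expR (- rate k * t))%:E +
   \int[mu]_(s in `[0%R, t]) (wgt s * f s)%:E)%E.
Proof.
move=> fin finm f.
have /andP[t0 _] := tT.
have E := integral_Phi_step HS HV chi0 mg psi0 psi_ge0 mpsi h n beta k t0.
have I : (\int[mu]_(s in `[0%R, t]) ((rate k * expR (- rate k * (t - s)))%:E *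
    psi_mean S V chi0 g psi h n beta k s) = \int[mu]_(s in `[0%R, t]) (wgt s * f s)%:E)%E.
  apply: eq_integral => s; rewrite inE/= => st.
  by rewrite [in RHS]EFinM /f fineK// finm// inT.
rewrite I in E; split; last by rewrite E EFinM.
have f0 s : 0 <= f s by rewrite /f fine_ge0// psi_mean_ge0.
have mf : measurable_fun setT f.
  by apply: measurableT_comp => //; exact: measurable_psi_mean.
apply/integrableP; split.
  apply: measurable_funTS; apply/measurable_EFinP; apply: measurable_funM => //.
  exact: (measurable_wgt S k t).
rewrite [ltLHS](_ : _ = \int[mu]_(s in `[0%R, t]) (wgt s * f s)%:E)%E; last first.
  by apply: eq_integral => s _ /=; rewrite ger0_norm // mulr_ge0.
move: fin; rewrite E fin_numD => /andP[_] /fin_numPlt/andP[_ //].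
Qed.

Lemma integral_drift :
  mu.-integrable `[0, t] (EFin \o (fun s => wgt s * co c (drift h n beta k s))) /\
  co c (EPhi h.+1 n.+1 t beta k) = expR (- rate k * t) * co c (chi0 k) +
    Rintegral mu `[0, t] (fun s => wgt s * co c (drift h n beta k s)).
Proof.
have iPhi := integrable_Phi HS HV mg chi0M gM h.+1 n.+1 beta k c tT.
have dc s (sT : 0 <= s <= T) := drift_coord HS HV mg chi0M gM c h n beta k sT.
have [ip Ip] := part_integrable (@pos_part0 R r c) (@pos_part_ge0 R r c) (@measurable_pos_part R r c)
  (integral_pos_fin measurableT iPhi) (fun s sT => let: And3 a _ _ := dc s sT in a).
have [iN In] := part_integrable (@neg_part0 R r c) (@neg_part_ge0 R r c) (@measurable_neg_part R r c)
  (integral_neg_fin measurableT iPhi) (fun s sT => let: And3 _ b _ := dc s sT in b).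
set fp := fun s => fine (psi_mean S V chi0 g (pos_part c) h n beta k s) in ip Ip.
set fn := fun s => fine (psi_mean S V chi0 g (neg_part c) h n beta k s) in iN In.
have dE s : s \in (`[0, t] : interval R) -> co c (drift h n beta k s) = fp s - fn s.
  move=> /inT sT; have [a b E] := dc s sT.
  by have := E; rewrite -(fineK a) -(fineK b) -EFinB => -[].
have mI : measurable (`[0, t] : set (measurableTypeR R)) by exact: measurable_itv.
have wE s : s \in (`[0, t]%classic : set R) ->
    ((wgt s * fp s)%:E - (wgt s * fn s)%:E = (wgt s * co c (drift h n beta k s))%:E)%E.
  by rewrite inE/= => st; rewrite dE// mulrBr EFinB.
have iD : mu.-integrable `[0, t] (EFin \o (fun s => wgt s * co c (drift h n beta k s))).
  apply: eq_integrable (integrableB mI ip iN) => //.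
split => //.
have := integral_pos_neg measurableT iPhi.
rewrite [X in (X - _)%E]Ip [X in (_ - X)%E]In co_vintegral => E.
have ID := integralB mI ip iN.
have fp' := integrable_fin_num mI ip; have fn' := integrable_fin_num mI iN.
pose u := fine (\int[mu]_(s in `[0%R, t]) (wgt s * fp s)%:E)%E.
pose v := fine (\int[mu]_(s in `[0%R, t]) (wgt s * fn s)%:E)%E.
have U : (\int[mu]_(s in `[0%R, t]) (wgt s * fp s)%:E = u%:E)%E by rewrite /u fineK.
have W : (\int[mu]_(s in `[0%R, t]) (wgt s * fn s)%:E = v%:E)%E by rewrite /v fineK.
have -> : Rintegral mu `[0, t] (fun s => wgt s * co c (drift h n beta k s)) = u - v.
  rewrite /Rintegral -[RHS]/(fine (u%:E - v%:E)%E) -U -W -ID; congr fine.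
  by apply: eq_integral => s st; rewrite -wE.
move: E; rewrite U W => -[<-].
rewrite -[in RHS](max_pos_neg (co c (chi0 k))) /pos_part /neg_part; ring.
Qed.

End coordinate.

Lemma EPhi_level0 h t beta k : 0 <= t <= T ->
  EPhi h.+1 0 t beta k = (expR (- rate k * t))%:C *: chi0 k.
Proof.
move=> tT; have /andP[t0 _] := tT; apply: co_ext => c; rewrite coZ.
have := integral_pos_neg measurableT (integrable_Phi HS HV mg chi0M gM h.+1 0 beta k c tT).
rewrite [X in (X - _)%E](integral_Phi_step0 HS HV chi0 g (@pos_part0 R r c) (@pos_part_ge0 R r c) h beta k t0).
rewrite [X in (_ - X)%E](integral_Phi_step0 HS HV chi0 g (@neg_part0 R r c) (@neg_part_ge0 R r c) h beta k t0).
rewrite co_vintegral => -[<-].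
rewrite -[in RHS](max_pos_neg (co c (chi0 k))) /pos_part /neg_part; ring.
Qed.

(* The law of a subtree depends on its root position only: an induction on the
   depth through the recursion, which does not mention the root label. *)
Lemma EPhi_label h n t beta k : 0 <= t <= T -> EPhi h n t beta k = EPhi h n t [::] k.
Proof.
elim: h n t beta k => [|h IH] [|n] t beta k tT.
- by apply: co_ext => c; rewrite !co_vintegral.
- by apply: co_ext => c; rewrite !co_vintegral.
- by rewrite !EPhi_level0.
have D s : 0 <= s <= T -> drift h n beta k s = drift h n [::] k s.
  move=> sT; rewrite /offspring_drift.
  rewrite (IH n.+1 s (rcons beta i0) k sT) (IH n.+1 s (rcons [::] i0) k sT).
  have -> : (fun l m => (q_ S k l m)%:C *: B_ S k l m (EPhi h n.+1 s (rcons beta i1) l)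
        (EPhi h n s (rcons beta i2) m)) =
      (fun l m => (q_ S k l m)%:C *: B_ S k l m (EPhi h n.+1 s (rcons [::] i1) l)
        (EPhi h n s (rcons [::] i2) m)).
    apply/funext => l; apply/funext => m.
    rewrite (IH n.+1 s (rcons beta i1) l sT) (IH n s (rcons beta i2) m sT).
    by rewrite (IH n.+1 s (rcons [::] i1) l sT) (IH n s (rcons [::] i2) m sT).
  by [].
apply: co_ext => c.
rewrite (integral_drift h n beta k c tT).2 (integral_drift h n [::] k c tT).2.
apply: (f_equal (fun z => _ + z)); apply: eq_Rintegral => s.
rewrite inE/= in_itv/= => /andP[s0 st]; rewrite D// s0 (le_trans st)//.
by case/andP: tT.
Qed.

Definition mean h n k s := EPhi h n s [::] k.

Definition mild_drift (cur prev : Zd d -> R -> Cvec R r) k s : Cvec R r :=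
  (Cf S * p_ S k)%:C *: cur k s +
  (Cb S)%:C *: vsum2 (fun l m => (q_ S k l m)%:C *: B_ S k l m (cur l s) (prev m s)) +
  (d_ S k)%:C *: g k s.

(** With the labels removed by [EPhi_label], the right side involves only the root expectations of
    depth h: this is the mild equation up to the shift of the depth. *)
Lemma mean_step h n t k c : 0 <= t <= T ->
  let F s := rate k * expR (- rate k * (t - s)) *
    co c (mild_drift (mean h n.+1) (mean h n) k s) in
  mu.-integrable `[0, t] (EFin \o F) /\
  co c (mean h.+1 n.+1 k t) = expR (- rate k * t) * co c (chi0 k) + Rintegral mu `[0, t] F.
Proof.
move=> tT F; have [iD ID] := integral_drift h n [::] k c tT.
have dE s : s \in (`[0, t]%classic : set R) ->
    rate k * expR (- rate k * (t - s)) * co c (drift h n [::] k s) = F s.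
  rewrite inE/= in_itv/= => /andP[s0 st].
  have sT : 0 <= s <= T by rewrite s0 (le_trans st)//; case/andP: tT.
  rewrite /F; apply: (f_equal (fun z => _ * co c z)); rewrite /offspring_drift /mild_drift /mean.
  rewrite (EPhi_label h n.+1 (rcons [::] i0) k sT).
  have -> : (fun l m => (q_ S k l m)%:C *: B_ S k l m (EPhi h n.+1 s (rcons [::] i1) l)
        (EPhi h n s (rcons [::] i2) m)) =
      (fun l m => (q_ S k l m)%:C *: B_ S k l m (EPhi h n.+1 s [::] l) (EPhi h n s [::] m)).
    apply/funext => l; apply/funext => m.
    by rewrite (EPhi_label h n.+1 (rcons [::] i1) l sT) (EPhi_label h n (rcons [::] i2) m sT).
  by [].
split; last first.
  by rewrite /mean ID; apply: (f_equal (fun z => _ + z)); exact: eq_Rintegral.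
have mI : measurable (`[0, t] : set (measurableTypeR R)) by exact: measurable_itv.
refine (@eq_integrable _ _ _ mu _ mI (EFin \o (fun s => rate k * expR (- rate k * (t - s)) * co c (drift h n [::] k s))) (EFin \o F) (fun s st => congr1 EFin (dE s st)) iD).
Qed.

End recursion.

(** * Removing the truncation *)

Section dominated.
Context dd (X : measurableType dd) (R : realType) (mu : {measure set X -> \bar R}).
Variables (D : set X) (mD : measurable D) (f_ : nat -> X -> R) (f G : X -> R).
Hypothesis mf_ : forall n, measurable_fun D (f_ n).
Hypothesis f_f : forall x, D x -> f_ n x @[n --> \oo] --> f x.
Hypothesis iG : mu.-integrable D (EFin \o G).
Hypothesis f_G : {ae mu, forall x, forall n, D x -> `|f_ n x| <= G x}.

Lemma Rintegral_dominated : mu.-integrable D (EFin \o f) /\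
  Rintegral mu D (f_ n) @[n --> \oo] --> Rintegral mu D f.
Proof.
have mf : measurable_fun D f := measurable_fun_cvg mf_ f_f.
have f_f' : {ae mu, forall x, D x -> (EFin \o f_ n) x @[n --> \oo] --> (EFin \o f) x}.
  by apply: aeW => x Dx; apply: cvg_EFin; [exact: nearW|exact: f_f].
have mEf : measurable_fun D (EFin \o f) by exact/measurable_EFinP.
have mEf_ n : measurable_fun D (EFin \o f_ n) by exact/measurable_EFinP.
have [i _ c] := dominated_convergence mD mEf_ mEf f_f' iG f_G.
split => //; rewrite /Rintegral.
apply: fine_cvg; rewrite fineK//.
exact: integrable_fin_num.
Qed.

End dominated.

Lemma cvg_norm_bound (R : realType) (u : nat -> R) (l A : R) :
  u n @[n --> \oo] --> l -> (forall n, `|u n| <= A) -> `|l| <= A.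
Proof.
move=> ul uA; have nl : `|u n| @[n --> \oo] --> `|l| by exact: cvg_norm.
by apply: (cvgr_to_le nl); exact: nearW.
Qed.

Lemma cvg_bilinear_co (R : realType) (r : nat) (B : {bilinear Cvec R r -> Cvec R r -> Cvec R r})
    (x y : nat -> Cvec R r) (x' y' : Cvec R r) (c : coord_ix r) :
  (forall c, co c (x n) @[n --> \oo] --> co c x') ->
  (forall c, co c (y n) @[n --> \oo] --> co c y') ->
  co c (B (x n) (y n)) @[n --> \oo] --> co c (B x' y').
Proof.
move=> cx cy; under eq_fun do rewrite co_bilinear; rewrite co_bilinear.
apply: cvg_big => [|a _]; first exact: add_continuous.
apply: cvg_big => [|b _]; first exact: add_continuous.
by apply: cvgM; [exact: cvg_cst|exact: cvgM].
Qed.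

Section limit.
Context (R : realType) (d r : nat) (S : params R d r) (HS : standing S).
Context (disp : measure_display) (Omega : measurableType disp)
  (P : probability Omega R) (V : driving d P) (HV : is_driving S V).
Variables (chi0 : Zd d -> Cvec R r) (g : Zd d -> R -> Cvec R r).
Hypothesis mg : forall k c, measurable_fun setT (fun t => co c (g k t)).
Variables (Mc Mg : R).
Hypothesis chi0M : forall k, norm1 (chi0 k) <= Mc.
Hypothesis gM : {ae @lebesgue_measure R, forall t, forall k, norm1 (g k t) <= Mg}.
Variable T : R.

Local Notation Phi h n t beta k w := (Phi S V chi0 g w h n t beta k).
Local Notation mass := (mass S V chi0 g).

Local Notation mn := (mean S V chi0 g).

Variable gamma : Zd d -> R -> Cvec R r.
Hypothesis gammaE : forall k t, 0 <= t <= T -> g k t = gamma k t.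

Definition pruned_value n t k w := Rev S chi0 gamma n t (btree S V k w).

Definition chi n k t : Cvec R r := tree_expectation S V k (Rev S chi0 gamma n t).

Lemma co_chi n k t c : co c (chi n k t) = Rintegral P setT (fun w => co c (pruned_value n t k w)).
Proof. exact: co_vintegral. Qed.

Lemma cvg_Phi n t k w c : t <= T -> co c (Phi h n t [::] k w) @[h --> \oo] --> co c (pruned_value n t k w).
Proof.
move=> tT; have [[h0 H] _] := Rev_Phi HS HV chi0 gammaE w n k tT.
apply: cvg_near_cst; exists h0 => // h /= /H; rewrite /pruned_value => ->//.
Qed.

Lemma norm1_Phi_le n t k w h : t <= T -> norm1 (Phi h n t [::] k w) <= norm1 (pruned_value n t k w).
Proof.
move=> tT; have [_ H] := Rev_Phi HS HV chi0 gammaE w n k tT.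
by case: (H h) => ->; rewrite ?norm10 ?norm1_ge0.
Qed.

Lemma measurable_pruned_value n t k c : t <= T -> measurable_fun setT (fun w => co c (pruned_value n t k w)).
Proof.
move=> tT; apply: (measurable_fun_cvg (h := fun h w => co c (Phi h n t [::] k w))).
- by move=> h; exact: measurable_Phi_Omega.
- by move=> w _; exact: cvg_Phi.
Qed.

(** Fatou's lemma: at each sample the norms of the truncated evaluations are eventually equal to
    that of [Rev]. *)
Lemma mass_pruned_value n A t k : 0 <= t <= T -> (forall h, (mass h n t [::] k <= A%:E)%E) ->
  (\int[P]_w (norm1 (pruned_value n t k w))%:E <= A%:E)%E.
Proof.
move=> /andP[t0 tT] HA.
pose f h w := (norm1 (Phi h n t [::] k w))%:E.
have mf h : measurable_fun setT (f h).
  by apply/measurable_EFinP/measurable_norm1 => c; exact: measurable_Phi_Omega.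
have f0 h w : setT w -> (0 <= f h w)%E by move=> _; rewrite lee_fin norm1_ge0.
have := fatou P measurableT mf f0.
have limE w : limn_einf (f ^~ w) = (norm1 (pruned_value n t k w))%:E.
  have cv : f h w @[h --> \oo] --> (norm1 (pruned_value n t k w))%:E.
    have [[h0 H] _] := Rev_Phi HS HV chi0 gammaE w n k tT.
    by apply: cvg_near_cst; exists h0 => // h /= /H; rewrite /f /pruned_value => ->.
  by rewrite is_cvg_limn_einfE; [exact/cvg_lim|apply/cvg_ex; eexists; exact: cv].
under eq_integral do rewrite limE.
move=> /le_trans; apply.
rewrite limn_einf_lim; apply: lime_le; first exact: is_cvg_einfs.
apply: nearW => h; apply: le_trans (HA h).
by apply: ereal_inf_lbound; exists h => /=.
Qed.

Lemma integrable_norm1_pruned_value n t k : 0 <= t <= T ->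
  P.-integrable setT (fun w => (norm1 (pruned_value n t k w))%:E).
Proof.
move=> tT; have [A A0 HA] := mass_bound HS HV mg chi0M gM T n.
apply/integrableP; split.
  by apply/measurable_EFinP/measurable_norm1 => c; apply: measurable_pruned_value; case/andP: tT.
under eq_integral do rewrite /= ger0_norm ?norm1_ge0//.
by apply: le_lt_trans (mass_pruned_value tT (fun h => HA h t [::] k tT)) _; rewrite ltry.
Qed.

(** The dominating function is the norm of [Rev] itself: every truncated evaluation is 0 or [Rev],
    and this norm is integrable by the Fatou bound. *)
Lemma mean_cvg n t k c : 0 <= t <= T ->
  P.-integrable setT (fun w => (co c (pruned_value n t k w))%:E) /\
  co c (mn h n k t) @[h --> \oo] --> co c (chi n k t).
Proof.
move=> tT; have /andP[t0 tT'] := tT.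
have cP w : setT w -> co c (Phi h n t [::] k w) @[h --> \oo] --> co c (pruned_value n t k w).
  by move=> _; exact: cvg_Phi.
have leP' w h : setT w -> `|co c (Phi h n t [::] k w)| <= norm1 (pruned_value n t k w).
  by move=> _; exact: le_trans (co_le_norm1 _ _) (norm1_Phi_le _ _ _ _ tT').
have [i cv] := @Rintegral_dominated _ _ _ P setT measurableT
  (fun h w => co c (Phi h n t [::] k w)) (fun w => co c (pruned_value n t k w))
  (fun w => norm1 (pruned_value n t k w))
  (fun h => measurable_Phi_Omega S V chi0 mg h n t [::] k c)
  cP (integrable_norm1_pruned_value n k tT) (aeW _ leP').
split=> //; rewrite co_chi; under eq_fun do rewrite co_vintegral; exact: cv.
Qed.

Lemma co_chi_le n A t k c : 0 <= t <= T -> (forall h, (mass h n t [::] k <= A%:E)%E) ->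
  `|co c (chi n k t)| <= A.
Proof.
move=> tT HA; have [_ cv] := mean_cvg n k c tT.
apply: (cvg_norm_bound cv) => h; exact: (co_EPhi_le HS HV mg chi0M gM c tT (HA h)).
Qed.

(** The expectation is split into positive and negative parts, whose integrals depend measurably on
    t by Tonelli. *)
Lemma measurable_mean h n k c : measurable_fun setT (fun t => co c (mn h n k t)).
Proof.
under eq_fun do rewrite /mean co_vintegral.
apply: (measurableT_comp (f := fine)) => //.
rewrite (_ : (fun _ => _) = (fun t => (\int[P]_w (pos_part c (Phi h n t [::] k w))%:E -
   \int[P]_w (neg_part c (Phi h n t [::] k w))%:E)%E)).
  apply: emeasurable_funB.
  - apply: (measurable_integral_slice (V := V) (D := at_or_below [::])
      (X := fun x => (pos_part c (Phi h n x.1 [::] k x.2))%:E)) => [|x].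
      apply/measurable_EFinP; apply: measurable_pos_part => c'; exact: measurable_Phi.
    by rewrite lee_fin pos_part_ge0.
  - apply: (measurable_integral_slice (V := V) (D := at_or_below [::])
      (X := fun x => (neg_part c (Phi h n x.1 [::] k x.2))%:E)) => [|x].
      apply/measurable_EFinP; apply: measurable_neg_part => c'; exact: measurable_Phi.
    by rewrite lee_fin neg_part_ge0.
apply/funext => t; rewrite integralE; congr (_ - _)%E; apply: eq_integral => w _.
- by rewrite funeposE -EFin_max.
- by rewrite funenegE -EFinN -EFin_max.
Qed.

End limit.

(** * Lipschitz and growth bounds for the mild drift *)

Section drift_bounds.
Context (R : realType) (d r : nat) (S : params R d r) (HS : standing S).
Variables (chi0 : Zd d -> Cvec R r) (g : Zd d -> R -> Cvec R r).
Implicit Types (cur prev : Zd d -> R -> Cvec R r).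
Local Notation Z2 := (Zd d * Zd d)%type.

Definition pair_term cur prev k s c (lm : Z2) : R :=
  co c (B_ S k lm.1 lm.2 (cur lm.1 s) (prev lm.2 s)).

Lemma co_mild_drift cur prev k s c : co c (mild_drift S g cur prev k s) =
  Cf S * p_ S k * co c (cur k s) +
  Cb S * Rintegral (@counting Z2 R) setT (fun lm => q_ S k lm.1 lm.2 * pair_term cur prev k s c lm) +
  d_ S k * co c (g k s).
Proof.
rewrite /mild_drift !coD !coZ co_vintegral.
apply: (f_equal (fun z => _ + _ * z + _)); apply: eq_Rintegral => lm _; exact: coZ.
Qed.

Lemma pair_term_le cur prev k s c (N A : R) lm :
  (forall l, norm1 (cur l s) <= N) -> (forall m, norm1 (prev m s) <= A) ->
  `|pair_term cur prev k s c lm| <= dimR R r * (N * A).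
Proof.
move=> HN HA; apply: (le_trans (co_le_norm1 _ _)).
apply: (le_trans (norm1_bilinear (B_le HS k lm.1 lm.2) _ _)).
by rewrite ler_wpM2l ?dimR_ge0// ler_pM ?norm1_ge0.
Qed.

Lemma Rintegral_q_le k (F : Z2 -> R) (M : R) : (forall lm, `|F lm| <= M) ->
  `|Rintegral (@counting Z2 R) setT (fun lm => q_ S k lm.1 lm.2 * F lm)| <= M * qtot S k.
Proof.
move=> FM; have M0 : 0 <= M by exact: le_trans (normr_ge0 _) (FM (0, 0)).
have iF := integrable_q HS k FM.
apply: (le_trans (le_normr_Rintegral measurableT iF)).
have iM : (@counting Z2 R).-integrable setT (fun lm => (q_ S k lm.1 lm.2 * M)%:E).
  by apply: (integrable_q (M := M) HS k) => lm; rewrite ger0_norm.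
have -> : M * qtot S k = Rintegral (@counting Z2 R) setT (fun lm => q_ S k lm.1 lm.2 * M).
  rewrite /Rintegral; under eq_integral do rewrite EFinM.
  rewrite ge0_integralZr//.
  - by rewrite (integral_q HS) -EFinM/= mulrC.
  - exact: Z2_measurable_fun.
  - by move=> lm _; rewrite lee_fin (q_ge0 HS).
apply: le_Rintegral => //; first exact: integrable_norm iF.
by move=> lm _; rewrite normrM ger0_norm ?(q_ge0 HS)// ler_wpM2l ?(q_ge0 HS).
Qed.

(** For a common [prev] the drift is affine in [cur]: the forcing cancels, and linearity of [B] in
    its first argument leaves the bilinear sum of the difference. [M] serves to split the sum over
    pairs; the estimate itself sees [N] and [A]. *)
Lemma mild_drift_lipschitz cur cur' prev k s c (M N A : R) :
  (forall l, norm1 (cur l s) <= M) -> (forall l, norm1 (cur' l s) <= M) ->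
  (forall m, norm1 (prev m s) <= A) ->
  (forall l, norm1 (cur l s - cur' l s) <= N) ->
  `|co c (mild_drift S g cur prev k s) - co c (mild_drift S g cur' prev k s)| <=
  (Cf S * p_ S k + Cb S * dimR R r * A * qtot S k) * N.
Proof.
move=> HM HM' HA HN.
have b1 lm := pair_term_le k c lm HM HA.
have b2 lm := pair_term_le k c lm HM' HA.
have b3 lm : `|pair_term (fun l s => cur l s - cur' l s) prev k s c lm| <= dimR R r * (N * A).
  exact: (@pair_term_le (fun l s => cur l s - cur' l s)).
have p0 := p_ge0 HS k; have Cf0 := Cf_ge0 HS; have Cb0 := Cb_ge0 HS.
pose x := Rintegral (@counting Z2 R) setT
  (fun lm => q_ S k lm.1 lm.2 * pair_term cur prev k s c lm).
pose y := Rintegral (@counting Z2 R) setT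
  (fun lm => q_ S k lm.1 lm.2 * pair_term cur' prev k s c lm).
have xy : x - y = Rintegral (@counting Z2 R) setT
   (fun lm => q_ S k lm.1 lm.2 * pair_term (fun l s => cur l s - cur' l s) prev k s c lm).
  rewrite -RintegralB//; [|exact: (integrable_q HS k b1)|exact: (integrable_q HS k b2)].
  apply: eq_Rintegral => lm _.
  by rewrite -mulrBr /pair_term linearBl coB.
have -> : co c (mild_drift S g cur prev k s) - co c (mild_drift S g cur' prev k s) =
   Cf S * p_ S k * co c (cur k s - cur' k s) + Cb S * (x - y).
  have E1 : _ = _ + Cb S * x + _ := co_mild_drift cur prev k s c.
  have E2 : _ = _ + Cb S * y + _ := co_mild_drift cur' prev k s c.
  etransitivity; first exact: (f_equal2 (fun a b => a - b) E1 E2).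
  rewrite coB.
  clearbody x y; move: (co c (cur k s)) (co c (cur' k s)) (co c (g k s)) => a b e; ring.
rewrite mulrDl; apply: (le_trans (ler_normD _ _)); apply: lerD.
  rewrite normrM ger0_norm ?mulr_ge0// ler_wpM2l ?mulr_ge0//.
  exact: le_trans (co_le_norm1 _ _) (HN k).
rewrite normrM ger0_norm// xy.
have := Rintegral_q_le k b3 => /(ler_wpM2l Cb0) /le_trans; apply.
by rewrite le_eqVlt; apply/orP; left; apply/eqP; ring.
Qed.

(** Comparison with [cur] = 0, where only the forcing is left. *)
Lemma mild_drift_le cur prev k s c (N A : R) :
  (forall l, norm1 (cur l s) <= N) -> (forall m, norm1 (prev m s) <= A) ->
  `|co c (mild_drift S g cur prev k s)| <=
  (Cf S * p_ S k + Cb S * dimR R r * A * qtot S k) * N + norm1 (g k s).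
Proof.
move=> HN HA; pose z : Zd d -> R -> Cvec R r := fun _ _ => 0.
have N0 : 0 <= N by exact: le_trans (norm1_ge0 _) (HN 0).
have zN l : norm1 (z l s) <= N by rewrite norm10.
have dN l : norm1 (cur l s - z l s) <= N by rewrite subr0.
have H := mild_drift_lipschitz k c HN zN HA dN.
have E : co c (mild_drift S g z prev k s) = d_ S k * co c (g k s).
  rewrite co_mild_drift co0 mulr0 add0r [X in _ * X + _](_ : _ = 0) ?mulr0 ?add0r//.
  by rewrite /Rintegral integral0_eq//= => lm _; rewrite /pair_term linear0l co0 mulr0.
have dg : `|d_ S k * co c (g k s)| <= norm1 (g k s).
  rewrite normrM ger0_norm ?(d_ge0 HS)//.
  apply: le_trans (co_le_norm1 c _); rewrite ler_piMl//.
  by case/andP: (d_itv HS k).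
move: H E dg; generalize (co c (mild_drift S g cur prev k s)) (co c (mild_drift S g z prev k s)).
move=> x y H E dg; rewrite -[x](subrK y).
by apply: (le_trans (ler_normD _ _)); apply: lerD; [exact: H|rewrite E].
Qed.

Lemma co_mild_rhs cur prev k t c : co c (mild_rhs S chi0 g cur prev k t) =
  expR (- lam_ S k * t) * co c (chi0 k) +
  Rintegral (@lebesgue_measure R) `[0, t]
    (fun s => lam_ S k * expR (- lam_ S k * (t - s)) * co c (mild_drift S g cur prev k s)).
Proof.
rewrite /mild_rhs coD coZ co_vintegral.
by apply: (f_equal (fun z => _ + z)); apply: eq_Rintegral => s _; exact: coZ.
Qed.

End drift_bounds.

Lemma cvg_ext (R : realType) (u v : nat -> R) (a b : R) : u =1 v -> a = b ->
  v n @[n --> \oo] --> b -> u n @[n --> \oo] --> a.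
Proof. by move=> /funext -> ->. Qed.

Section limit.
Context (R : realType) (d r : nat) (S : params R d r) (HS : standing S).
Context (disp : measure_display) (Omega : measurableType disp)
  (P : probability Omega R) (V : driving d P) (HV : is_driving S V).
Variables (chi0 : Zd d -> Cvec R r) (g : Zd d -> R -> Cvec R r).
Hypothesis mg : forall k c, measurable_fun setT (fun t => co c (g k t)).
Variables (Mc Mg : R).
Hypothesis chi0M : forall k, norm1 (chi0 k) <= Mc.
Hypothesis gM : {ae @lebesgue_measure R, forall t, forall k, norm1 (g k t) <= Mg}.
Variable T : R.
Variable gamma : Zd d -> R -> Cvec R r.
Hypothesis gammaE : forall k t, 0 <= t <= T -> g k t = gamma k t.

Local Notation Z2 := (Zd d * Zd d)%type.
Local Notation mu := (@lebesgue_measure R).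
Local Notation rate := (lam_ S).
Local Notation mn := (mean S V chi0 g).
Local Notation chi := (chi S V chi0 gamma).

Lemma mean_chi_bound n : exists2 A, 0 <= A & forall k t, 0 <= t <= T ->
  (forall h, norm1 (mn h n k t) <= A) /\ norm1 (chi n k t) <= A.
Proof.
have [A A0 HA] := mass_bound HS HV mg chi0M gM T n.
exists (dimR R r * A) => [|k t tT]; first by rewrite mulr_ge0 ?dimR_ge0.
split=> [h|]; apply: sum_le_dimR => c.
  exact: (co_EPhi_le HS HV mg chi0M gM c tT (HA h t [::] k tT)).
exact: (co_chi_le HS HV mg chi0M gM gammaE c tT (fun h => HA h t [::] k tT)).
Qed.

Lemma measurable_chi n k c : measurable_fun (`[0, T] : set (measurableTypeR R))
  (fun t => co c (chi n k t)).
Proof.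
apply: (measurable_fun_cvg (h := fun h t => co c (mn h n k t))).
  by move=> h; apply: measurable_funTS; exact: measurable_mean.
move=> t; rewrite /= in_itv/= => tT.
exact: (mean_cvg HS HV mg chi0M gM gammaE n k c tT).2.
Qed.

Lemma chi_level0 k t : 0 <= t <= T ->
  chi 0 k t = (expR (- rate k * t))%:C *: chi0 k.
Proof.
move=> tT; apply: co_ext => c.
have [_ cv] := mean_cvg HS HV mg chi0M gM gammaE 0 k c tT.
apply: (cvg_unique _ cv) => //.
apply: cvg_near_cst; exists 1%N => // -[|h] //= _.
by rewrite /mean (EPhi_level0 HS HV mg chi0M gM h [::] k tT).
Qed.

Lemma cvg_mild_drift n k s c : 0 <= s <= T ->
  co c (mild_drift S g (mn h n.+1) (mn h n) k s) @[h --> \oo] -->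
  co c (mild_drift S g (chi n.+1) (chi n) k s).
Proof.
move=> sT.
have [N N0 HN] := mean_chi_bound n.+1; have [A A0 HA] := mean_chi_bound n.
have cv m l c' := (mean_cvg HS HV mg chi0M gM gammaE m l c' sT).2.
apply: (cvg_ext (fun h => co_mild_drift S g (mn h n.+1) (mn h n) k s c)
  (co_mild_drift S g (chi n.+1) (chi n) k s c)).
apply: cvgD; last exact: cvg_cst.
apply: cvgD; first by apply: cvgM; [exact: cvg_cst|exact: cv].
apply: cvgM; first exact: cvg_cst.
have HB h lm := pair_term_le HS k c lm (fun l => (HN l s sT).1 h) (fun m => (HA m s sT).1 h).
apply: (@Rintegral_dominated _ _ _ (@counting Z2 R) setT measurableT
  (fun h lm => q_ S k lm.1 lm.2 * pair_term S (mn h n.+1) (mn h n) k s c lm)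
  (fun lm => q_ S k lm.1 lm.2 * pair_term S (chi n.+1) (chi n) k s c lm)
  (fun lm => q_ S k lm.1 lm.2 * (dimR R r * (N * A))) _ _ _ _).2.
- by move=> h; exact: Z2_measurable_fun.
- move=> lm _; apply: cvgM; first exact: cvg_cst.
  by apply: cvg_bilinear_co => c'; exact: cv.
- apply: (integrable_q (M := dimR R r * (N * A)) HS k (F := fun=> dimR R r * (N * A))) => lm.
  by rewrite ger0_norm// !mulr_ge0 ?dimR_ge0.
- apply: aeW => lm h _.
  by rewrite normrM ger0_norm ?(q_ge0 HS)// ler_wpM2l ?(q_ge0 HS).
Qed.

(** Dominated convergence in [mean_step]: the kernel is at most the rate, and the drift is bounded
    uniformly in h for almost every s by [mild_drift_le]. *)
Lemma chi_step n k t c : 0 <= t <= T ->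
  let F s := rate k * expR (- rate k * (t - s)) *
    co c (mild_drift S g (chi n.+1) (chi n) k s) in
  mu.-integrable `[0, t] (EFin \o F) /\
  co c (chi n.+1 k t) = expR (- rate k * t) * co c (chi0 k) + Rintegral mu `[0, t] F.
Proof.
move=> tT F; have /andP[t0 t_T] := tT.
have inT s : s \in (`[0, t] : interval R) -> 0 <= s <= T.
  by rewrite in_itv/= => /andP[s0 st]; rewrite s0 (le_trans st).
have [N N0 HN] := mean_chi_bound n.+1; have [A A0 HA] := mean_chi_bound n.
pose F_ h s := rate k * expR (- rate k * (t - s)) *
    co c (mild_drift S g (mn h n.+1) (mn h n) k s).
have st h := mean_step HS HV mg chi0M gM h n k c tT.
have l0 : 0 <= rate k by rewrite ltW// (lam_gt0 HS).
pose K := Cf S * p_ S k + Cb S * dimR R r * A * qtot S k.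
have mI : measurable (`[0, t] : set (measurableTypeR R)) by exact: measurable_itv.
have [||||i cv] := @Rintegral_dominated _ _ _ mu (`[0, t] : set (measurableTypeR R)) mI F_ F
   (fun=> rate k * (K * N + Mg)).
- by move=> h; apply/measurable_EFinP; exact: measurable_int (st h).1.
- move=> s /inT sT; apply: cvgM; first exact: cvg_cst.
  exact: cvg_mild_drift.
- apply/integrableP; split; first exact: measurable_cst.
  rewrite /= integral_cst//= lebesgue_measure_itv/= lte_fin.
  by case: ifP => _; rewrite ?mule0 -?EFinD -?EFinM ltry.
- apply: ae_lebesgueS gM => s gs h st'; have sT := inT _ st'.
  rewrite /F_ normrM ger0_norm ?mulr_ge0 ?expR_ge0//.
  apply: ler_pM; rewrite ?mulr_ge0 ?expR_ge0//.
    rewrite ler_piMr// -expR0 ler_expR mulNr oppr_le0 mulr_ge0// subr_ge0.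
    by move: st'; rewrite /= in_itv/= => /andP[].
  apply: le_trans (lerD (lexx _) (gs k)).
  exact: (mild_drift_le HS g k c (fun l => (HN l s sT).1 h) (fun m => (HA m s sT).1 h)).
split=> //.
have [_ cL] := mean_cvg HS HV mg chi0M gM gammaE n.+1 k c tT.
(* The left side of [mean_step] has one generation more than the right side; the shift is absorbed
   in the limit. *)
have cL' : co c (mn h.+1 n.+1 k t) @[h --> \oo] --> co c (chi n.+1 k t).
  by move: cL; rewrite -(cvg_shiftS (fun h => co c (mn h n.+1 k t))).
apply: (cvg_unique _ cL') => //.
rewrite (funext (fun h => (st h).2)).
by apply: cvgD; [exact: cvg_cst|exact: cv].
Qed.

End limit.

(** * Uniqueness *)

Lemma ae_lebesgueI (R : realType) (A B : R -> Prop) :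
  {ae @lebesgue_measure R, forall t, A t} -> {ae @lebesgue_measure R, forall t, B t} ->
  {ae @lebesgue_measure R, forall t, A t /\ B t}.
Proof.
exact: (@filterI _ _ (ae_filter_ringOfSetsType (@lebesgue_measure R))).
Qed.

Lemma integrable_ae_bounded (R : realType) (f : R -> R) (a b K : R) :
  measurable_fun setT f ->
  {ae @lebesgue_measure R, forall s, s \in `[a, b] -> `|f s| <= K} ->
  (@lebesgue_measure R).-integrable `[a, b] (EFin \o f).
Proof.
move=> mf fK.
have mI : measurable (`[a, b] : set (measurableTypeR R)) by exact: measurable_itv.
have mf' : measurable_fun (`[a, b] : set (measurableTypeR R)) (EFin \o f).
  by apply: measurable_funTS; exact/measurable_EFinP.
apply/integrableP; split => //.
apply: (@le_lt_trans _ _ (\int[@lebesgue_measure R]_(s in `[a, b]) (Num.max 0 K)%:E)%E).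
  apply: ae_ge0_le_integral => //.
  - exact: measurableT_comp.
  - by move=> s _; rewrite lee_fin le_max lexx.
  - by apply: ae_lebesgueS fK => s H sab; rewrite lee_fin le_max (H sab) orbT.
rewrite /= integral_cst//= lebesgue_measure_itv/= lte_fin.
by case: ifP => _; rewrite ?mule0 -?EFinD -?EFinM ltry.
Qed.

Lemma weighted_distance_le (R : realType) (w x y B N e : R) :
  0 <= w -> `|x - y| <= B * (N * e) -> `|w * x - w * y| <= B * N * (w * e).
Proof.
by move=> w0 H; rewrite -mulrBr normrM ger0_norm// [leRHS]mulrCA ler_wpM2l// -mulrA.
Qed.

Lemma integral_exp_windowZ (R : realType) (l m t C : R) : 0 < l -> 0 <= m -> 0 <= t -> 0 <= C ->
  (\int[@lebesgue_measure R]_(s in `[0%R, t]) (C * (l * expR (- l * (t - s)) * expR (m * s)))%:E =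
   (C * (l / (l + m) * (expR (m * t) - expR (- l * t))))%:E)%E.
Proof.
move=> l0 m0 t0 C0; rewrite [in RHS]EFinM -integral_exp_window//.
under eq_integral do rewrite EFinM.
rewrite ge0_integralZl//.
- apply: measurable_funTS; apply/measurable_EFinP.
  apply: measurable_funM; last by apply: measurableT_comp => //; exact: measurable_funM.
  apply: measurable_funM => //; apply: measurableT_comp => //.
  by apply: measurable_funM => //; exact: measurable_funB.
- by move=> s _; rewrite lee_fin !mulr_ge0 ?expR_ge0// ltW.
Qed.

Section uniqueness.
Context (R : realType) (d r : nat) (S : params R d r) (HS : standing S).
Variables (chi0 : Zd d -> Cvec R r) (g : Zd d -> R -> Cvec R r).
Hypothesis mg : forall k c, measurable_fun setT (fun t => co c (g k t)).
Implicit Types (cur prev : Zd d -> R -> Cvec R r).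
Local Notation Z2 := (Zd d * Zd d)%type.
Local Notation mu := (@lebesgue_measure R).
Local Notation rate := (lam_ S).

Lemma measurable_mild_drift cur prev k c :
  (forall l c, measurable_fun setT (fun t => co c (cur l t))) ->
  (forall l c, measurable_fun setT (fun t => co c (prev l t))) ->
  measurable_fun setT (fun s => co c (mild_drift S g cur prev k s)).
Proof.
move=> mcur mprev; under eq_fun do rewrite co_mild_drift.
apply: measurable_funD; last exact: measurable_funM.
apply: measurable_funD; first exact: measurable_funM.
apply: measurable_funM => //; apply: (measurableT_comp (f := fine)) => //.
pose F lm s := q_ S k lm.1 lm.2 * pair_term S cur prev k s c lm.
have mF lm : measurable_fun setT (F lm).
  apply: measurable_funM => //; rewrite /pair_term.
  by apply: measurable_co_bilinear => c'; [exact: mcur|exact: mprev].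
rewrite (_ : (fun _ => _) = (fun s => (\int[@counting Z2 R]_lm (Num.max (F lm s) 0)%:E -
   \int[@counting Z2 R]_lm (Num.max (- F lm s) 0)%:E)%E)).
  apply: emeasurable_funB.
  - apply: (measurable_integral_counting (f := fun lm s => (Num.max (F lm s) 0)%:E)) => [lm|lm s].
      by apply/measurable_EFinP; exact: measurable_maxr.
    by rewrite lee_fin le_max lexx orbT.
  - apply: (measurable_integral_counting (f := fun lm s => (Num.max (- F lm s) 0)%:E)) => [lm|lm s].
      by apply/measurable_EFinP; apply: measurable_maxr => //; exact: measurableT_comp.
    by rewrite lee_fin le_max lexx orbT.
apply/funext => t; rewrite integralE; congr (_ - _)%E; apply: eq_integral => lm _.
- by rewrite funeposE -EFin_max.
- by rewrite funenegE -EFinN -EFin_max.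
Qed.

(** The equation of one level, in coordinates and for almost every t only, since a competing
    solution is constrained off a null set; one null set serves all positions. *)
Definition solves (T : R) cur prev : Prop :=
  {ae mu, forall t, t \in `[0, T] -> forall k c, co c (cur k t) =
    expR (- rate k * t) * co c (chi0 k) + Rintegral mu `[0, t]
    (fun s => rate k * expR (- rate k * (t - s)) * co c (mild_drift S g cur prev k s))}.

Definition ae_bounded (M : R) (f : Zd d -> R -> Cvec R r) : Prop :=
  {ae mu, forall t, forall k, norm1 (f k t) <= M}.

Variables (T Mg M A : R) (cur cur' prev prev' : Zd d -> R -> Cvec R r).
Hypothesis gM : ae_bounded Mg g.
Hypotheses (mcur : forall l c, measurable_fun setT (fun t => co c (cur l t)))
  (mcur' : forall l c, measurable_fun setT (fun t => co c (cur' l t)))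
  (mprev : forall l c, measurable_fun setT (fun t => co c (prev l t)))
  (mprev' : forall l c, measurable_fun setT (fun t => co c (prev' l t))).
Hypotheses (curM : ae_bounded M cur) (curM' : ae_bounded M cur') (prevA : ae_bounded A prev).
Hypothesis prevE : {ae mu, forall t, forall k, prev k t = prev' k t}.
Hypotheses (cur_solves : solves T cur prev) (cur_solves' : solves T cur' prev').
Hypotheses (M0 : 0 <= M) (A0 : 0 <= A).

Let b k := Cf S * p_ S k + Cb S * dimR R r * A * qtot S k.

Let b0 k : 0 <= b k.
Proof.
by rewrite addr_ge0 ?mulr_ge0 ?(Cf_ge0 HS) ?(Cb_ge0 HS) ?(p_ge0 HS) ?(qtot_ge0 HS) ?dimR_ge0.
Qed.

Let driftE k s : (forall m, prev m s = prev' m s) ->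
  mild_drift S g cur' prev' k s = mild_drift S g cur' prev k s.
Proof.
move=> E; rewrite /mild_drift.
apply: (f_equal (fun z => _ + _ *: vsum2 z + _)).
by apply/funext => l; apply/funext => m; rewrite E.
Qed.

Let wgt k t s := rate k * expR (- rate k * (t - s)).

Let wgt_ge0 k t s : 0 <= wgt k t s.
Proof. by rewrite mulr_ge0 ?expR_ge0// ltW// (lam_gt0 HS). Qed.

Let wgt_le k t s : s \in `[0, t] -> wgt k t s <= rate k.
Proof.
have l0 : 0 <= rate k by rewrite ltW// (lam_gt0 HS).
rewrite in_itv/= => /andP[_ st]; rewrite ler_piMr// -expR0 ler_expR mulNr oppr_le0.
by rewrite mulr_ge0// subr_ge0.
Qed.

Let drift_integrable cu k t c : (forall l c, measurable_fun setT (fun t => co c (cu l t))) ->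
  ae_bounded M cu ->
  mu.-integrable `[0, t] (EFin \o (fun s => wgt k t s * co c (mild_drift S g cu prev k s))).
Proof.
move=> mcu cuM; apply: (@integrable_ae_bounded _ _ _ _ (rate k * (b k * M + Mg))).
  by apply: measurable_funM; [exact: (measurable_wgt S k t)|exact: measurable_mild_drift].
apply: ae_lebesgueS (ae_lebesgueI (ae_lebesgueI gM cuM) prevA) => s [[gs cus] ps] st.
rewrite normrM ger0_norm//; apply: ler_pM => //; first exact: wgt_le.
apply: (le_trans (mild_drift_le HS g k c cus ps)).
by rewrite lerD2l.
Qed.

(** One application of the contraction. Each coordinate of the difference is bounded through the
    Lipschitz constant [b k], and the sum over coordinates accounts for the extra [dimR] in the
    condition on m. *)
Lemma solutions_closer (m N : R) : 0 <= m -> 0 <= N ->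
  (forall k, rate k / (rate k + m) * (dimR R r * b k) <= 2^-1) ->
  {ae mu, forall t, t \in `[0, T] -> forall k, norm1 (cur k t - cur' k t) <= N * expR (m * t)} ->
  {ae mu, forall t, t \in `[0, T] -> forall k, norm1 (cur k t - cur' k t) <= 2^-1 * N * expR (m * t)}.
Proof.
move=> m0 N0 Hm HN.
apply: ae_lebesgueS (ae_lebesgueI cur_solves cur_solves') => t [E E'] tT k.
have {}E c := E tT k c; have {}E' c := E' tT k c.
move: tT; rewrite in_itv/= => /andP[t0 tT].
have rk := lam_gt0 HS k.
have mI : measurable (`[0, t] : set (measurableTypeR R)) by exact: measurable_itv.
have H c : `|co c (cur k t - cur' k t)| <= b k * N * (rate k / (rate k + m) * (expR (m * t) - expR (- rate k * t))).
  pose F s := wgt k t s * co c (mild_drift S g cur prev k s).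
  pose F' s := wgt k t s * co c (mild_drift S g cur' prev k s).
  pose F'' s := wgt k t s * co c (mild_drift S g cur' prev' k s).
  have iF : mu.-integrable `[0, t] (EFin \o F) by exact: drift_integrable.
  have iF' : mu.-integrable `[0, t] (EFin \o F') by exact: drift_integrable.
  (* The lower levels agree for almost every time only, which suffices under the integral; from here
     on both solutions share [prev]. *)
  have FF'' : Rintegral mu `[0, t] F'' = Rintegral mu `[0, t] F'.
    apply: (f_equal fine).
    apply: (@ae_eq_integral _ _ _ mu _ (EFin \o F') (EFin \o F'') mI).
    - apply: measurable_funTS; apply/measurable_EFinP.
      by apply: measurable_funM; [exact: (measurable_wgt S k t)|exact: measurable_mild_drift].
    - apply: measurable_funTS; apply/measurable_EFinP.
      by apply: measurable_funM; [exact: (measurable_wgt S k t)|exact: measurable_mild_drift].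
    - by apply: ae_lebesgueS prevE => s ps _; rewrite /= /F'' (driftE _ ps).
  have -> : co c (cur k t - cur' k t) = Rintegral mu `[0, t] (fun s => F s - F' s).
    have E1 : co c (cur k t) = _ + Rintegral mu `[0, t] F := E c.
    have E2 : co c (cur' k t) = _ + Rintegral mu `[0, t] F'' := E' c.
    have RB : Rintegral mu `[0, t] (fun s => F s - F' s) =
      Rintegral mu `[0, t] F - Rintegral mu `[0, t] F' := RintegralB mI iF iF'.
    transitivity (co c (cur k t) - co c (cur' k t)); first exact: coB.
    move: E1 E2 FF'' RB.
    generalize (co c (cur k t)) (co c (cur' k t)) (Rintegral mu `[0, t] F)
      (Rintegral mu `[0, t] F') (Rintegral mu `[0, t] F'').
    by move=> ? ? ? ? ? -> -> -> ->; ring.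
  clear E E'.
  have iB : mu.-integrable `[0, t] (EFin \o (fun s => F s - F' s)).
    exact: (integrableB mI iF iF').
  rewrite -lee_fin; apply: (@le_trans _ _ (\int[mu]_(s in `[0%R, t]) `|F s - F' s|%:E)%E).
    have := le_normr_Rintegral mI iB.
    rewrite -lee_fin => /le_trans; apply.
    have /fineK/eqP := integrable_fin_num mI (integrable_norm iB).
    by rewrite eq_le => /andP[].
  have mw (a : R) : measurable_fun setT (fun s => a * (wgt k t s * expR (m * s))).
    apply: measurable_funM; first exact: measurable_cst.
    apply: measurable_funM; first exact: (measurable_wgt S k t).
    by apply: measurableT_comp; [exact: measurable_expR|exact: measurable_funM].
  apply: (@le_trans _ _ (\int[mu]_(s in `[0%R, t]) (b k * N * (wgt k t s * expR (m * s)))%:E)%E).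
    apply: ae_ge0_le_integral.
    - exact: mI.
    - by move=> s _; rewrite lee_fin normr_ge0.
    - exact: measurable_int (integrable_norm iB).
    - move=> s _; rewrite lee_fin; apply: mulr_ge0; first exact: mulr_ge0 (b0 k) N0.
      exact: mulr_ge0 (wgt_ge0 k t s) (expR_ge0 _).
    - by apply: measurable_funTS; apply/measurable_EFinP; exact: mw.
    apply: ae_lebesgueS (ae_lebesgueI (ae_lebesgueI curM curM') (ae_lebesgueI prevA HN)).
    move=> s [[cM cM'] [pA sN]] st; rewrite lee_fin.
    have sT : s \in `[0, T].
      by move: st; rewrite /= !in_itv/= => /andP[-> st]; exact: le_trans tT.
    exact (weighted_distance_le (wgt_ge0 k t s) (mild_drift_lipschitz HS g k c cM cM' pA (sN sT))).
  by rewrite (integral_exp_windowZ rk m0 t0 (mulr_ge0 (b0 k) N0)).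
apply: (le_trans (sum_le_dimR H)).
have lm0 : 0 < rate k + m by rewrite ltr_wpDr.
rewrite (_ : dimR R r * _ = rate k / (rate k + m) * (dimR R r * b k) *
  (N * (expR (m * t) - expR (- rate k * t)))); last by ring.
rewrite -[leRHS]mulrA; apply: ler_pM => //.
- by rewrite !mulr_ge0 ?dimR_ge0// ?invr_ge0 ltW.
- rewrite mulr_ge0// subr_ge0 ler_expR; apply: (@le_trans _ _ 0); last exact: mulr_ge0.
  by rewrite mulNr oppr_le0 mulr_ge0// ltW.
- by rewrite ler_wpM2l// gerBl expR_ge0.
Qed.

(** [solutions_closer] is iterated from the trivial bound 2M. The countably many exceptional sets
    are merged before j tends to infinity at a fixed time. *)
Lemma solution_unique :
  {ae mu, forall t, t \in `[0, T] -> forall k, cur k t = cur' k t}.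
Proof.
have Cf0 := Cf_ge0 HS; have Cb0 := Cb_ge0 HS; have dim0 := dimR_ge0 R r.
have [m m0 Hm] : exists2 m, 0 <= m & forall k, rate k / (rate k + m) * (dimR R r * b k) <= 2^-1.
  apply: (contraction_rate (C := dimR R r * (Cf S + Cb S * dimR R r * A))).
  - exact: lam_gt0 HS.
  - move=> k; have := pqd1 HS k; have := p_ge0 HS k; have := qtot_ge0 HS k.
    have := d_ge0 HS k => d0 q0 p0 pqd; apply/andP; split; first by rewrite mulr_ge0.
    by rewrite ler_wpM2l// lerD// ler_piMr ?mulr_ge0//; lra.
  - rewrite (_ : (fun k => _) = (fun k => dimR R r * Cf S * p_ S k +
       dimR R r * (Cb S * dimR R r * A) * qtot S k)); last first.
      by apply/funext => k; rewrite /b; ring.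
    by apply: vanishes_at_infinityD; [exact: p_vanishes HS|exact: q_vanishes HS].
have H (j : nat) : {ae mu, forall t, t \in `[0, T] -> forall k,
    norm1 (cur k t - cur' k t) <= 2^-1 ^+ j * (2 * M) * expR (m * t)}.
  elim: j => [|j IH].
    apply: ae_lebesgueS (ae_lebesgueI curM curM') => t [cM cM'] tT k.
    move: tT; rewrite in_itv/= => /andP[t0 _].
    apply: (le_trans (norm1B _ _)); rewrite expr0 mul1r.
    apply: (@le_trans _ _ (2 * M)); first by have := cM k; have := cM' k; lra.
    by rewrite ler_peMr ?mulr_ge0// -expR0 ler_expR mulr_ge0.
  have := solutions_closer m0 _ Hm IH; rewrite exprS -!mulrA; apply.
  by rewrite !mulr_ge0// exprn_ge0// invr_ge0.
apply: ae_lebesgueS (ae_foralln H) => t {}H tT k.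
apply/eqP; rewrite -subr_eq0; apply/eqP; apply: co_ext => c; rewrite co0.
apply/eqP; rewrite -normr_le0; apply: (le_trans (co_le_norm1 _ _)).
have cv : (2^-1 : R) ^+ j * (2 * M) * expR (m * t) @[j --> \oo] --> 0 * (2 * M) * expR (m * t).
  apply: cvgM; last exact: cvg_cst.
  apply: cvgM; last exact: cvg_cst.
  by apply: cvg_expr; rewrite ger0_norm ?invf_lt1 ?ltr1n.
rewrite !mul0r in cv.
by apply: (cvgr_to_ge cv); apply: nearW => j; exact: H.
Qed.

End uniqueness.

(** * Restriction to the time interval and conclusion *)

Section restriction.
Context (R : realType) (d r : nat) (T : R).
Implicit Types f : Zd d -> R -> Cvec R r.

(** Extension by zero: the preceding sections ask for measurability and almost everywhere bounds on
    the whole line, while the data and the solutions are controlled on [0, T] only. *)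
Definition restr f k t : Cvec R r := if 0 <= t <= T then f k t else 0.

Lemma restr_in f k t : 0 <= t <= T -> restr f k t = f k t.
Proof. by rewrite /restr => ->. Qed.

Lemma restr_Linfty f : Linfty T f ->
  (forall k c, measurable_fun setT (fun t => co c (restr f k t))) /\
  exists2 M, 0 <= M & ae_bounded M (restr f).
Proof.
move=> [mf [M fM]]; split.
  move=> k c; have /vmeasurableP/(_ c) mfc := mf k.
  have mI : measurable (`[0, T] : set (measurableTypeR R)) by exact: measurable_itv.
  have := (measurable_restrictT (fun t => co c (f k t)) mI).1 mfc.
  congr (measurable_fun _ _); apply/funext => t.
  rewrite /restr patchE; case: ifPn => tT.
    by move: tT; rewrite inE/= in_itv/= => ->.
  case: ifPn => tT'; last by rewrite co0.
  by move/negP: tT; rewrite inE/= in_itv/= tT'.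
exists (dimR R r * Num.max 0 M); first by rewrite mulr_ge0 ?dimR_ge0// le_max lexx.
apply: ae_lebesgueS fM => t ft k; rewrite /restr; case: ifPn => tT.
  apply: (le_trans (norm1_le_vnorm _)); rewrite ler_wpM2l ?dimR_ge0//.
  by rewrite le_max ft ?orbT// in_itv.
by rewrite norm10 mulr_ge0 ?dimR_ge0// le_max lexx.
Qed.

Variables (S : params R d r) (chi0 : Zd d -> Cvec R r) (gamma : Zd d -> R -> Cvec R r).

Lemma mild_drift_restr cur prev k s : 0 <= s <= T ->
  mild_drift S (restr gamma) (restr cur) (restr prev) k s = mild_drift S gamma cur prev k s.
Proof.
by move=> sT; rewrite /mild_drift /restr sT.
Qed.

Lemma mild_solves (f : nat -> Zd d -> R -> Cvec R r) n :
  {ae @lebesgue_measure R, forall t, t \in `[0, T] -> mild_at S chi0 gamma f t} ->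
  solves S chi0 (restr gamma) T (restr (f n.+1)) (restr (f n)).
Proof.
apply: ae_lebesgueS => t H tT k c; have [_ /(_ n k) E] := H tT.
move: tT; rewrite in_itv/= => tT; rewrite restr_in//.
rewrite E co_mild_rhs; apply: (f_equal (fun z => _ + z)).
apply: eq_Rintegral => s; rewrite inE/= in_itv/= => /andP[s0 st].
apply: (f_equal (fun z => _ * co c z)); rewrite mild_drift_restr// s0 (le_trans st)//.
by case/andP: tT.
Qed.

End restriction.

Theorem proposition5p2 (R : realType) (d r : nat) (d_gt0 : (0 < d)%N)
    (r_gt0 : (0 < r)%N) (S : params R d r) (HS : standing S)
    (disp : measure_display) (Omega : measurableType disp)
    (P : probability Omega R) (V : driving d P) (HV : is_driving S V)
    (chi0 : Zd d -> Cvec R r) (gamma : Zd d -> R -> Cvec R r)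
    (T : R) (T_gt0 : 0 < T) (Hchi0 : linfty chi0) (Hgamma : Linfty T gamma) :
  (forall n k t, t \in `[0, T] ->
     tree_integrable S V k (Rev S chi0 gamma n t)) /\
  let chi n k t := tree_expectation S V k (Rev S chi0 gamma n t) in
  [/\ forall n, Linfty T (chi n),
      forall t, t \in `[0, T] -> mild_at S chi0 gamma chi t
    & forall psi : nat -> Zd d -> R -> Cvec R r,
        (forall n, Linfty T (psi n)) ->
        {ae @lebesgue_measure R, forall t,
          t \in `[0, T] -> mild_at S chi0 gamma psi t} ->
        {ae @lebesgue_measure R, forall t,
          t \in `[0, T] -> forall n k, psi n k t = chi n k t}].
Proof.
have [Mc HMc] := Hchi0.
have chi0M k : norm1 (chi0 k) <= dimR R r * Mc.
  by apply: (le_trans (norm1_le_vnorm _)); rewrite ler_wpM2l ?dimR_ge0.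
have [mg [Mg Mg0 gM]] := restr_Linfty Hgamma.
have gammaE k t : 0 <= t <= T -> restr T gamma k t = gamma k t by exact: restr_in.
split=> [n k t|chi].
  rewrite in_itv/= => tT; apply/vintegrableP => c.
  exact: (mean_cvg HS HV mg chi0M gM gammaE n k c tT).1.
have chiL n : Linfty T (chi n).
  split=> [k|]; first by apply/vmeasurableP => c; exact: (measurable_chi HS HV mg chi0M gM gammaE).
  have [A A0 HA] := mean_chi_bound HS HV mg chi0M gM gammaE n.
  exists A; apply: aeW => t; rewrite in_itv/= => tT k.
  exact: le_trans (vnorm_le_norm1 _) (HA k t tT).2.
have chi_mild t : t \in `[0, T] -> mild_at S chi0 gamma chi t.
  rewrite in_itv/= => tT; split=> [k|n k].
    exact: (chi_level0 HS HV mg chi0M gM gammaE k tT).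
  apply: co_ext => c; rewrite co_mild_rhs.
  have [_ E] := chi_step HS HV mg chi0M gM gammaE n k c tT.
  apply: (etrans E); apply: (f_equal (fun z => _ + z)).
  apply: eq_Rintegral => s; rewrite inE/= in_itv/= => /andP[s0 st].
  apply: (f_equal (fun z => _ * co c z)); rewrite /mild_drift gammaE// s0 (le_trans st)//.
  by case/andP: tT.
split=> // psi psiL psi_mild.
have chi_ae : {ae @lebesgue_measure R, forall t, t \in `[0, T] -> mild_at S chi0 gamma chi t}.
  exact: aeW.
(* Uniqueness is propagated level by level: agreement almost everywhere at level n is the hypothesis
   on [prev] and [prev'] at level n + 1. *)
have H n : {ae @lebesgue_measure R, forall t, forall k, restr T (psi n) k t = restr T (chi n) k t}.
  elim: n => [|n IH].
    apply: ae_lebesgueS psi_mild => t H k; rewrite /restr; case: ifPn => // tT.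
    have tI : t \in `[0, T] by rewrite in_itv.
    by rewrite (H tI).1 (chi_mild t tI).1.
  have [mc [M M0 cM]] := restr_Linfty (psiL n.+1).
  have [mc' [M' M'0 cM']] := restr_Linfty (chiL n.+1).
  have [mp [A A0 pA]] := restr_Linfty (psiL n).
  have [mp' _] := restr_Linfty (chiL n).
  (* [solution_unique] takes a single bound for both solutions; the sum of the two serves. *)
  have widen K (f : Zd d -> R -> Cvec R r) : K <= M + M' -> ae_bounded K f -> ae_bounded (M + M') f.
    by move=> KM; apply: ae_lebesgueS => t fK k; exact: le_trans (fK k) KM.
  have {}cM : ae_bounded (M + M') (restr T (psi n.+1)) by apply: widen cM; rewrite lerDl.
  have {}cM' : ae_bounded (M + M') (restr T (chi n.+1)) by apply: widen cM'; rewrite lerDr.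
  have := solution_unique HS mg gM mc mc' mp mp' cM cM' pA IH
    (@mild_solves _ _ _ T S chi0 gamma psi n psi_mild)
    (@mild_solves _ _ _ T S chi0 gamma chi n chi_ae) (addr_ge0 M0 M'0) A0.
  apply: ae_lebesgueS => t H k.
  rewrite /restr; case: ifPn => // tT.
  by have := H _ k; rewrite in_itv/= /restr tT; apply.
(* The levels are countably many, so one null set serves them all. *)
apply: ae_lebesgueS (ae_foralln H) => t {}H; rewrite in_itv/= => tT n k.
by have := H n k; rewrite !restr_in.
Qed.
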